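(* Assume that the shift $(X,\Sigma)$ is the natural coding of a minimal translation $R_{\mathbf{t}}$ on $\mathbb{T}^{d-1}=\mathbb{R}^{d-1}/\mathbb{Z}^{d-1}$ with respect to a natural partition $\{\mathcal{F}_1,\dots,\mathcal{F}_d\}$ of a bounded fundamental domain $\mathcal{F}$. Then the atoms $\mathcal{F}_1,\dots,\mathcal{F}_d$ are bounded remainder sets of $R_{\mathbf{t}}$. Their Lebesgue measures are rationally independent. If, moreover, $(X,\Sigma)$ is an $S$-adic dynamical system with $X=X_{\boldsymbol{\sigma}}$ for some $\boldsymbol{\sigma}\in\mathcal{S}_d^{\mathbb{N}}$, then - $\mathbf{u}=(\lambda(\mathcal{F}_1),\dots,\lambda(\mathcal{F}_d))$ is a generalized right eigenvector of $\boldsymbol{\sigma}$, where $\lambda$ denotes the Lebesgue measure; - there is an affine map $H:\mathbb{R}^d\to\mathbb{R}^{d-1}$ such that $\mathcal{F}_i=H(\mathcal{R}_{\boldsymbol{\sigma}}(i))$ for $1\le i\le d$; - $(X_{\boldsymbol{\sigma}},\Sigma)$ is a natural coding of $R_{\mathbf{u}'}$ with respect to the natural partition $\{-\mathcal{R}'_{\boldsymbol{\sigma}}(i):1\le i\le d\}$. Furthermore, if the directive sequence $\boldsymbol{\sigma}$ is left proper, then for each word $i_0i_1\cdots i_n\in L_{\boldsymbol{\sigma}}$, the set $\mathcal{F}_{i_0}\cap R_{\mathbf{t}}^{-1}\mathcal{F}_{i_1}\cap\cdots\cap R_{\mathbf{t}}^{-n}\mathcal{F}_{i_n}$ is also a bounded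 remainder set of $R_{\mathbf{t}}$; in particular, $-\mathcal{R}'_{\boldsymbol{\sigma}}(i_0i_1\cdots i_n)$ is a bounded remainder set of $R_{\mathbf{u}'}$.
   Context: **Natural codings.** For $\mathbf{t}\in\mathbb{R}^m$ let $R_{\mathbf{t}}(\mathbf{x})=\mathbf{x}+\mathbf{t}$ on $\mathbb{T}^m=\mathbb{R}^m/\mathbb{Z}^m$. A measurable fundamental domain is a set $\mathcal{F}\subset\mathbb{R}^m$ of Lebesgue measure $1$ with $\mathcal{F}+\mathbb{Z}^m=\mathbb{R}^m$. A collection $\{\mathcal{F}_1,\dots,\mathcal{F}_h\}$ is a natural partition of $\mathcal{F}$ w.r.t. $R_{\mathbf{t}}$ if $\bigcup_i\mathcal{F}_i=\mathcal{F}$; the sets $\mathcal{F}_i\cap\mathcal{F}_j$, $i\ne j$, have measure zero; each $\mathcal{F}_i$ is the closure of its interior and has boundary of measure zero; and there are $\mathbf{t}_i\equiv\mathbf{t}\pmod{\mathbb{Z}^m}$ with $\mathbf{t}_i+\mathcal{F}_i\subset\mathcal{F}$ for all $i$. Define $\tilde R_{\mathbf{t}}(\mathbf{x})=\mathbf{x}+\mathbf{t}_i$ for $\mathbf{x}$ in the interior $\mathring{\mathcal{F}}_i$ (so a.e. on $\mathcal{F}$). The language of the partition is the set of words $i_0\cdots i_n$ with $\bigcap_{k=0}^n\tilde R_{\mathbf{t}}^{-k}\mathring{\mathcal{F}}_{i_k}\ne\emptyset$. A shift $(X,\Sigma)$ (a closed shift-invariant set of one-sided sequences with the shift map $\Sigma$)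 is a natural coding of $(\mathbb{T}^m,R_{\mathbf{t}})$ w.r.t. this partition if its language (set of factors of its elements) is the language of the partition and, for every $(i_n)\in X$, $\bigcap_{n}\overline{\bigcap_{k=0}^n\tilde R_{\mathbf{t}}^{-k}\mathring{\mathcal{F}}_{i_k}}$ is a single point. **Bounded remainder sets.** A bounded remainder set of a dynamical system $(X,T,\mu)$ with invariant probability measure $\mu$ is a measurable set $Y\subseteq X$ for which there is $C>0$ with $|\#\{0\le n<N:T^n(x)\in Y\}-N\mu(Y)|\le C$ for all $N\in\mathbb{N}$ and a.e. $x\in X$. For $R_{\mathbf{t}}$ on $\mathbb{T}^m$ the measure is Haar measure, and subsets of a fundamental domain in $\mathbb{R}^m$ are identified with their images in $\mathbb{T}^m$. **Substitutions and $S$-adic systems.** $\mathbb{N}=\{0,1,2,\dots\}$, $\mathcal{A}=\{1,\dots,d\}$, $\mathcal{A}^*$ is the free monoid of words over $\mathcal{A}$; $|w|_i$ is the number of occurrences of the letter $i$ in $w$, $\boldsymbol{\ell}(w)={}^t(|w|_1,\dots,|w|_d)$, and $w\preceq v$ means that $w$ is a prefix of $v$. A substitution over $\mathcal A$ is an endomorphism $\sigma$ of $\mathcal{A}^*$ that maps nonempty words to nonempty words; its incidence matrix is $M_\sigma=(|\sigma(j)|_i)_{1\le i,j\le d}$. $\mathcal{S}_d$ is the set of substitutions over $\mathcal{A}$ with $|\det M_\sigma|=1$. For $\boldsymbol{\sigma}=(\sigma_n)_{n\in\mathbb{N}}\in\mathcal{S}_d^{\mathbb{N}}$ put $\sigma_{[k,n)}=\sigma_k\circ\cdots\circ\sigma_{n-1}$;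 $L_{\boldsymbol{\sigma}}$ is the set of words that are factors of $\sigma_{[0,n)}(i)$ for some $i\in\mathcal{A}$, $n\in\mathbb{N}$; $X_{\boldsymbol{\sigma}}$ is the set of $\omega\in\mathcal{A}^{\mathbb{N}}$ all of whose factors are in $L_{\boldsymbol{\sigma}}$. A substitution $\sigma$ is left proper if there is $j\in\mathcal{A}$ such that $\sigma(i)$ starts with $j$ for all $i\in\mathcal{A}$; the sequence $\boldsymbol{\sigma}$ is left proper if for each $k\in\mathbb{N}$ there is $n>k$ such that $\sigma_{[k,n)}$ is left proper. **Rauzy fractals.** A generalized right eigenvector of $\boldsymbol{\sigma}$ is a nonzero $\mathbf{u}\in\mathbb{R}_+^d$ ($\mathbb{R}_+=[0,\infty)$) with $\bigcap_{n}M_{\sigma_0}\cdots M_{\sigma_{n-1}}\mathbb{R}_+^d=\mathbb{R}_+\mathbf{u}$. Let $\pi_{\mathbf{u}}:\mathbb{R}^d\to\mathbf{1}^\perp$ be the projection along $\mathbf{u}$ onto the hyperplane $\mathbf{1}^\perp$ orthogonal to $\mathbf{1}=(1,\dots,1)$. For $w\in\mathcal{A}^*$, $\mathcal{R}_{\boldsymbol{\sigma}}(w)$ is the closure of the set of points $\pi_{\mathbf{u}}\boldsymbol{\ell}(p)$ with $p\in\mathcal{A}^*$ such that $pw\preceq\sigma_{[0,n)}(j)$ for infinitely many pairs $(n,j)\in\mathbb{N}\times\mathcal{A}$. Let $\pi':\mathbb{R}^d\to\mathbb{R}^{d-1}$ omit the last coordinate; write $\mathbf{x}'=\pi'(\mathbf{x})$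 and $\mathcal{R}'_{\boldsymbol{\sigma}}(w)=\pi'(\mathcal{R}_{\boldsymbol{\sigma}}(w))$. *)

(* Defs.v *)
From HB Require Import structures.
From mathcomp Require Import all_boot all_order all_algebra.
From mathcomp Require Import all_classical all_reals all_analysis.

Set Implicit Arguments.
Unset Strict Implicit.
Unset Printing Implicit Defensive.

Import Order.TTheory GRing.Theory Num.Theory.
Import numFieldNormedType.Exports.

Local Open Scope classical_set_scope.
Local Open Scope quotient_scope.
Local Open Scope ring_scope.

Definition cV_display : measure_display. Proof. exact. Qed.

Section cV_measurable.
Variables (R : realType) (m : nat).

Let coord : 'I_m -> 'cV[R]_m -> measurableTypeR R := fun i x => x i 0.

Let cV_set0 : g_sigma_preimage coord set0.
Proof. exact: sigma_algebra0. Qed.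

Let cV_setC A : g_sigma_preimage coord A -> g_sigma_preimage coord (~` A).
Proof. exact: sigma_algebraC. Qed.

Let cV_bigcup (F : _^nat) : (forall i, g_sigma_preimage coord (F i)) ->
  g_sigma_preimage coord (\bigcup_i (F i)).
Proof. exact: sigma_algebra_bigcup. Qed.

(* The product sigma-algebra, as the library does for [n.-tuple T]; since R is
   second countable, its elements are the Borel sets of R^m. *)
HB.instance Definition _ := @isMeasurable.Build cV_display
  'cV[R]_m (g_sigma_preimage coord) cV_set0 cV_setC cV_bigcup.

End cV_measurable.

Definition consv (R : realType) (m : nat)
  (z : measurableTypeR R * 'cV[R]_m) : 'cV[R]_m.+1 :=
  col_mx (const_mx z.1 : 'cV[R]_1) z.2.

(* The m-fold product of the Lebesgue measure of R, transported to column
   vectors; as it is an iterated integral, it is meaningful on measurable sets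
   only. *)
Fixpoint lebesgueV (R : realType) (m : nat) : set 'cV[R]_m -> \bar R :=
  match m with
  | 0 => \d_(0 : 'cV[R]_0)
  | k.+1 => pushforward (@lebesgue_measure R \x lebesgueV (m:=k))%E (@consv R k)
  end.

Arguments lebesgueV {R m}.

Section lebesgueV_measure.
Variable R : realType.

Lemma measurable_coord (m : nat) (i : 'I_m) :
  measurable_fun setT (fun x : 'cV[R]_m => x i 0 : measurableTypeR R).
Proof.
move=> _ Y mY; rewrite setTI; apply: sub_sigma_algebra.
rewrite (bigD1 i)//=; left; exists Y => //; by rewrite setTI.
Qed.

Lemma measurable_cV_fun d (T : measurableType d) (m : nat) (f : T -> 'cV[R]_m) :
  (forall i, measurable_fun setT (fun x => f x i 0 : measurableTypeR R)) ->
  measurable_fun setT f.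
Proof.
move=> mf; apply: (@measurability _ _ _ _ setT f
  (\big[setU/set0]_(i < m) preimage_set_system setT
     (fun x : 'cV[R]_m => x i 0 : measurableTypeR R) measurable)) => //.
have bigU (I : finType) (U : Type) (P : I -> set U) B :
    (\big[setU/set0]_(i : I) P i) B -> exists i, P i B.
  elim/big_ind: _ => [//|X Y hX hY [/hX|/hY]//|i _ PB]; by exists i.
move=> _ [B hB <-]; have [i [A mA <-]] := bigU _ _ _ _ hB.
have := mf i measurableT A mA; rewrite !setTI; apply.
Qed.

Lemma measurable_consv (m : nat) : measurable_fun setT (@consv R m).
Proof.
apply: measurable_cV_fun => i.
have [j ->|j ->] := split_ordP (i : 'I_(1 + m)).
  rewrite (_ : (fun _ => _) = fst); first exact: measurable_fst.
  by apply/funext => z; rewrite /consv (@col_mxEu _ 1 m) mxE.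
rewrite (_ : (fun _ => _) = (fun x : 'cV[R]_m => x j 0) \o snd).
  exact: measurableT_comp (measurable_coord _) measurable_snd.
by apply/funext => z; rewrite /consv (@col_mxEd _ 1 m).
Qed.

Lemma product_sigma_finite d1 d2 (T1 : measurableType d1)
    (T2 : measurableType d2) (m1 : {sigma_finite_measure set T1 -> \bar R})
    (m2 : {sigma_finite_measure set T2 -> \bar R}) :
  exists M : {measure set (T1 * T2)%type -> \bar R},
    (M : set _ -> \bar R) = (m1 \x m2)%E /\ sigma_finite setT M.
Proof.
exists (m1 \x m2)%E; split=> //.
have /sigma_finiteP[F [TF ndF Foo]] := sigma_finiteT m1.
have /sigma_finiteP[G [TG ndG Goo]] := sigma_finiteT m2.
exists (fun n => F n `*` G n).
  rewrite -setXTT TF TG predeqE => -[x y]; split.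
    move=> [/= [n _ Fnx] [k _ Gky]]; exists (maxn n k) => //; split.
    - by move: x Fnx; exact/subsetPset/ndF/leq_maxl.
    - by move: y Gky; exact/subsetPset/ndG/leq_maxr.
  by move=> [n _ []/= ? ?]; split; exists n.
move=> k; have [? ?] := Foo k; have [? ?] := Goo k.
split; first exact: measurableX.
by rewrite /= product_measure1E// lte_mul_pinfty// ge0_fin_numE.
Qed.

Lemma lebesgueV_axioms (m : nat) :
  [/\ lebesgueV (set0 : set 'cV[R]_m) = 0%E,
      (forall A : set 'cV[R]_m, (0 <= lebesgueV A)%E),
      semi_sigma_additive (@lebesgueV R m) &
      sigma_finite setT (@lebesgueV R m)].
Proof.
elim: m => [|k [H0 Hge Hadd Hsf]] /=.
  split; first exact: measure0.
  - exact: measure_ge0.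
  - exact: measure_semi_sigma_additive.
  - exact: sigma_finiteT.
pose mi := isMeasure.Build _ _ _ (@lebesgueV R k) H0 Hge Hadd.
pose mu0 : {measure set _ -> \bar R} := HB.pack (@lebesgueV R k) mi.
pose mu : {sigma_finite_measure set _ -> \bar R} :=
  HB.pack (@lebesgueV R k) mu0 (Measure_isSigmaFinite.Build _ _ _ mu0 Hsf).
have [M [ME Msf]] := product_sigma_finite (@lebesgue_measure R) mu.
have mc A : measurable A -> measurable (@consv R k @^-1` A).
  by move=> mA; have := measurable_consv measurableT mA; rewrite setTI.
rewrite /pushforward -ME; split.
- by rewrite preimage_set0; exact: (measure0 M).
- by move=> A; exact: (measure_ge0 M).
- move=> F mF tF mUF; rewrite preimage_bigcup.
  apply: (@measure_semi_sigma_additive _ _ _ M).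
  + by move=> n; exact: mc.
  + apply/trivIsetP => /= i j _ _ ij; rewrite -preimage_setI.
    by move/trivIsetP : tF => /(_ _ _ _ _ ij) ->//; rewrite preimage_set0.
  + by rewrite -preimage_bigcup; exact: mc.
- rewrite [X in sigma_finite _ X](_ : _ = fun A => M (@consv R k @^-1` A))//.
  pose dv (x : 'cV[R]_k.+1) : measurableTypeR R * 'cV[R]_k :=
    (x ord0 0, @dsubmx _ 1 k 1 x).
  have dvK : cancel (@consv R k) dv.
    move=> [a b]; rewrite /dv /consv /= col_mxKd; congr pair.
    by rewrite (_ : ord0 = @lshift 1 k 0) ?(@col_mxEu _ 1 k) ?mxE//; exact/val_inj.
  have mdv : measurable_fun setT dv.
    apply: measurable_fun_pair; first exact: measurable_coord.
    apply: measurable_cV_fun => i.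
    rewrite (_ : (fun _ => _) = fun x : 'cV[R]_k.+1 => x (@rshift 1 k i) 0).
      exact: measurable_coord.
    by apply/funext => x; rewrite mxE.
  have /sigma_finiteP[F [FT _ Foo]] := Msf.
  exists (fun n => dv @^-1` F n).
    by rewrite -preimage_bigcup -FT preimage_setT.
  move=> n; have [mF Fn] := Foo n; split.
    by have := mdv measurableT _ mF; rewrite setTI.
  rewrite -comp_preimage (_ : dv \o @consv R k = id) //.
  by apply/funext => z /=; rewrite dvK.
Qed.

End lebesgueV_measure.

Section lebesgueV_instances.
Variables (R : realType) (m : nat).

Let lebesgueV_set0 : lebesgueV (set0 : set 'cV[R]_m) = 0%E.
Proof. by have [] := lebesgueV_axioms R m. Qed.

Let lebesgueV_ge0 (A : set 'cV[R]_m) : (0 <= lebesgueV A)%E.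
Proof. by have [] := lebesgueV_axioms R m. Qed.

Let lebesgueV_additive : semi_sigma_additive (@lebesgueV R m).
Proof. by have [] := lebesgueV_axioms R m. Qed.

HB.instance Definition _ := isMeasure.Build _ _ _ (@lebesgueV R m)
  lebesgueV_set0 lebesgueV_ge0 lebesgueV_additive.

Let lebesgueV_sigma_finite : sigma_finite setT (@lebesgueV R m).
Proof. by have [] := lebesgueV_axioms R m. Qed.

HB.instance Definition _ := Measure_isSigmaFinite.Build _ _ _
  (@lebesgueV R m) lebesgueV_sigma_finite.

End lebesgueV_instances.

Definition unit_cube (R : realType) (m : nat) : set 'cV[R]_m :=
  [set x | forall i, 0 <= x i 0 < 1].
Arguments unit_cube : clear implicits.

Section unit_cube.
Variable R : realType.

Lemma measurable_unit_cube (m : nat) : measurable (unit_cube R m).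
Proof.
rewrite (_ : unit_cube R m = \bigcap_(i in [set: 'I_m])
    ((fun x : 'cV[R]_m => x i 0 : measurableTypeR R) @^-1` `[0, 1[)).
  apply: fin_bigcap_measurable; first exact: finite_finset.
  move=> i _; rewrite -[X in measurable X]setTI.
  by apply: measurable_coord => //; exact: measurable_itv.
apply/seteqP; split=> x /= h i; first by move=> _; rewrite /= in_itv/=.
by have := h i I; rewrite /= in_itv.
Qed.

Lemma lebesgueV_unit_cube (m : nat) : lebesgueV (unit_cube R m) = 1%E.
Proof.
elim: m => [|k IH] /=; first by rewrite diracE mem_set// => -[].
rewrite /pushforward (_ : _ @^-1` _ = `[0, 1[%classic `*` unit_cube R k).
  rewrite [LHS](@product_measure1E _ _ _ _ _ (@lebesgue_measure R) (@lebesgueV R k)) //.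
  + rewrite [X in (X * _)%E]lebesgue_measure_itv/= lte01 oppr0 adde0 mul1e.
    exact: IH.
  + exact: measurable_unit_cube.
apply/seteqP; split=> -[a b] /=.
  move=> h; split.
    by have := h ord0; rewrite /consv (_ : ord0 = @lshift 1 k 0) ?(@col_mxEu _ 1 k) ?mxE ?in_itv//; exact/val_inj.
  by move=> i; have := h (@rshift 1 k i); rewrite /consv (@col_mxEd _ 1 k).
move=> [/= ha hb] i; have [j ->|j ->] := split_ordP (i : 'I_(1 + k)).
  by rewrite /consv (@col_mxEu _ 1 k) mxE; move: ha; rewrite in_itv.
by rewrite /consv (@col_mxEd _ 1 k).
Qed.

End unit_cube.

Section torus.
Variables (R : realType) (m : nat).

Definition Zvec : set 'cV[R]_m := [set x | forall i, x i 0 \is a Num.int].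

Definition congZ (x y : 'cV[R]_m) : bool :=
  [forall i, (x i 0 - y i 0) \is a Num.int].

Lemma congZ_equiv : equiv_class_of congZ.
Proof.
split=> [x|x y|y x z].
- by apply/forallP => i; rewrite subrr rpred0.
- by apply/eq_forallb => i; rewrite -opprB rpredN.
- move=> /forallP xy /forallP yz; apply/forallP => i.
  by rewrite -(subrKA (y i 0)) rpredD.
Qed.

Canonical congZ_equivRel := EquivRelPack congZ_equiv.

Definition torus : Type := quotient_topology {eq_quot congZ}.

HB.instance Definition _ := Topological.on torus.
HB.instance Definition _ := Pointed.on torus.
HB.instance Definition _ := Quotient.on torus.

Definition torus_pi (x : 'cV[R]_m) : torus := \pi_torus x.

Definition rotation (t : 'cV[R]_m) (x : torus) : torus :=
  torus_pi (repr x + t).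

(* A subset of the torus is measurable iff its Z^m-periodic lift is Borel. *)
Definition torus_measurable : set (set torus) :=
  image_set_system setT torus_pi measurable.

Let torus_measurable0 : torus_measurable set0.
Proof.
by have [] := sigma_algebra_image torus_pi (sigma_algebra_measurable 'cV[R]_m).
Qed.

Let torus_measurableC A : torus_measurable A -> torus_measurable (~` A).
Proof.
rewrite -setTD.
by have [_ h _] := sigma_algebra_image torus_pi (sigma_algebra_measurable 'cV[R]_m); exact: h.
Qed.

Let torus_measurable_bigcup (F : _^nat) : (forall i, torus_measurable (F i)) ->
  torus_measurable (\bigcup_i (F i)).
Proof.
by have [_ _ h] := sigma_algebra_image torus_pi (sigma_algebra_measurable 'cV[R]_m); exact: h.
Qed.

HB.instance Definition _ := @isMeasurable.Build cV_display torus
  torus_measurable torus_measurable0 torus_measurableC torus_measurable_bigcup.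

Lemma measurable_torus_pi : measurable_fun setT torus_pi.
Proof. by move=> _ A. Qed.

(* The unit cube contains exactly one representative of every point. *)
Definition haar (A : set torus) : \bar R :=
  lebesgueV (torus_pi @^-1` A `&` unit_cube R m).

Let haar_set0 : haar set0 = 0%E.
Proof. by rewrite /haar preimage_set0 set0I measure0. Qed.

Let haar_ge0 A : (0 <= haar A)%E.
Proof. exact: measure_ge0. Qed.

Let haar_additive : semi_sigma_additive haar.
Proof.
pose nu := mrestr (@lebesgueV R m) (@measurable_unit_cube R m).
move=> F mF tF mUF; rewrite /haar preimage_bigcup.
apply: (@measure_semi_sigma_additive _ _ _ nu).
- by move=> n; have := measurable_torus_pi measurableT (mF n); rewrite setTI.
- apply/trivIsetP => /= i j _ _ ij; rewrite -preimage_setI.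
  by move/trivIsetP : tF => /(_ _ _ _ _ ij) ->//; rewrite preimage_set0.
- by rewrite -preimage_bigcup; have := measurable_torus_pi measurableT mUF; rewrite setTI.
Qed.

HB.instance Definition _ := isMeasure.Build _ _ _ haar
  haar_set0 haar_ge0 haar_additive.

Let haar_setT : haar setT = 1%E.
Proof. by rewrite /haar preimage_setT setTI lebesgueV_unit_cube. Qed.

HB.instance Definition _ := Measure_isProbability.Build _ _ _ haar haar_setT.

End torus.
Arguments Zvec {R m}.
Arguments torus_pi {R m}.
Arguments haar {R m}.

Definition minimal_map (T : topologicalType) (f : T -> T) : Prop :=
  forall x, closure [set iter n f x | n in [set: nat]] = setT.

Definition bounded_remainder_set d (X : measurableType d) (R : realType)
    (T : X -> X) (mu : probability X R) (Y : set X) : Prop :=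
  measurable Y /\
  exists2 C : R, 0 < C &
    {ae mu, forall x, forall N : nat,
      `|(\sum_(n < N) (iter n T x \in Y))%N%:R - N%:R * fine (mu Y)| <= C}.

Definition fundamental_domain (R : realType) (m : nat) (F : set 'cV[R]_m) :=
  [/\ measurable F, lebesgueV F = 1%E &
      [set x + z | x in F & z in Zvec] = setT].

Section natural_coding.
Variables (R : realType) (m h : nat).
Implicit Types (t : 'cV[R]_m) (F : set 'cV[R]_m) (Fi : 'I_h -> set 'cV[R]_m).
Implicit Types (ti : 'I_h -> 'cV[R]_m).

Definition natural_partition t F Fi ti : Prop :=
  [/\ \bigcup_i Fi i = F,
      (forall i j, i != j -> lebesgueV (Fi i `&` Fi j) = 0%E),
      (forall i, Fi i = closure (interior (Fi i)) /\
                 lebesgueV (closure (Fi i) `\` interior (Fi i)) = 0%E) &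
      (forall i, Zvec (ti i - t) /\
                 [set ti i + x | x in Fi i] `<=` F)].

(* The partial map x |-> x + t_i on the interior of F_i, as a relation; it is
   functional because the interiors are disjoint. *)
Definition induced_map Fi ti (x y : 'cV[R]_m) : Prop :=
  exists2 i, interior (Fi i) x & y = x + ti i.

Fixpoint induced_preimage Fi ti (k : nat) (A : set 'cV[R]_m) :=
  match k with
  | 0 => A
  | k'.+1 => [set x | exists2 y, induced_map Fi ti x y &
                                 induced_preimage Fi ti k' A y]
  end.

Definition cylinder Fi ti (n : nat) (w : nat -> 'I_h) : set 'cV[R]_m :=
  \bigcap_(k in [set k | (k <= n)%N])
    induced_preimage Fi ti k (interior (Fi (w k))).

Definition partition_language Fi ti : set (seq 'I_h) :=
  [set w | exists (i0 : nat -> 'I_h) (n : nat),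
     w = mkseq i0 n.+1 /\ cylinder Fi ti n i0 !=set0].

End natural_coding.

Section shifts.
Variable h : nat.
Local Notation letter := (discrete_topology 'I_h).

Definition shift_map (w : nat -> 'I_h) : nat -> 'I_h := fun n => w n.+1.

Definition shift_space (X : set (nat -> 'I_h)) : Prop :=
  closed (X : set {ptws nat -> letter}) /\ shift_map @` X `<=` X.

Definition factor (w : nat -> 'I_h) (k n : nat) : seq 'I_h :=
  mkseq (fun j => w (k + j)%N) n.

Definition shift_language (X : set (nat -> 'I_h)) : set (seq 'I_h) :=
  [set v | exists2 w, X w & exists k n, v = factor w k n.+1].

Definition natural_coding (R : realType) (m : nat) (X : set (nat -> 'I_h))
    (t : 'cV[R]_m) (F : set 'cV[R]_m) (Fi : 'I_h -> set 'cV[R]_m) : Prop :=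
  [/\ shift_space X, fundamental_domain F &
      exists ti : 'I_h -> 'cV[R]_m,
      [/\ natural_partition t F Fi ti,
          shift_language X = partition_language Fi ti &
          forall w, X w -> exists x,
            \bigcap_n closure (cylinder Fi ti n w) = [set x]]].

End shifts.

Section substitutions.
Variable d : nat.

(* An endomorphism of the free monoid is given by the images of the letters. *)
Definition substitution := 'I_d -> seq 'I_d.
Implicit Types (s : substitution) (sigma : nat -> substitution).

Definition subst_word s (w : seq 'I_d) : seq 'I_d := flatten (map s w).

Definition subst_comp s1 s2 : substitution := fun i => subst_word s1 (s2 i).

Definition subst_id : substitution := fun i => [:: i].

Definition incidence (R : pzRingType) s : 'M[R]_d :=
  \matrix_(i, j) (count_mem i (s j))%:R.

Definition unimodular_subst s : Prop :=
  (forall i, s i != [::]) /\ `|\det (incidence int s)| = 1.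

(* The right fold sigma_k o (... o (sigma_(n-1) o id)). *)
Definition subst_range sigma (k n : nat) : substitution :=
  \big[subst_comp/subst_id]_(k <= l < n) sigma l.

Definition sadic_language sigma : set (seq 'I_d) :=
  [set w | exists n i, infix w (subst_range sigma 0 n i)].

Definition sadic_shift sigma : set (nat -> 'I_d) :=
  [set w | forall k n, sadic_language sigma (factor w k n)].

Definition left_proper s : Prop :=
  exists j, forall i, exists v, s i = j :: v.

Definition left_proper_seq sigma : Prop :=
  forall k, exists2 n, (k < n)%N & left_proper (subst_range sigma k n).

Definition nonneg_cone (R : realType) : set 'cV[R]_d :=
  [set x | forall i, 0 <= x i 0].
Arguments nonneg_cone : clear implicits.

Definition generalized_right_eigenvector (R : realType) sigma (u : 'cV[R]_d) :=
  [/\ u != 0, nonneg_cone R u &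
      \bigcap_n [set (\big[mulmx/1%:M]_(0 <= l < n) incidence R (sigma l)) *m x
                | x in nonneg_cone R]
      = [set c *: u | c in [set c : R | 0 <= c]]].

Definition abelianization (R : realType) (w : seq 'I_d) : 'cV[R]_d :=
  \col_i (count_mem i w)%:R.

(* The projection along u onto the hyperplane orthogonal to (1, ..., 1), for u
   not in this hyperplane. *)
Definition proj_along (R : realType) (u x : 'cV[R]_d) : 'cV[R]_d :=
  x - ((\sum_i x i 0) / (\sum_i u i 0)) *: u.

Definition rauzy (R : realType) (u : 'cV[R]_d) sigma (w : seq 'I_d) :
    set 'cV[R]_d :=
  closure [set proj_along u (abelianization R p) | p in
    [set p | infinite_set [set nj : nat * 'I_d |
                           prefix (p ++ w) (subst_range sigma 0 nj.1 nj.2)]]].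

End substitutions.

Definition drop_last (R : realType) (m : nat) (x : 'cV[R]_m.+1) : 'cV[R]_m :=
  row' ord_max x.

Definition neg_rauzy' (R : realType) (m : nat) (u : 'cV[R]_m.+1)
    (sigma : nat -> substitution m.+1) (w : seq 'I_m.+1) : set 'cV[R]_m :=
  [set - drop_last x | x in rauzy u sigma w].

(* Main.v *)
(** Write T for the matrix of the translations t_i, so that T l(w) is the
    displacement along a word w coded by an orbit of the induced map.  Displacements
    are bounded because F is, and integrating them over the torus gives T u = 0 for
    u = (lambda(F_i)).  The columns t_d - t_i form an integer matrix N with
    N u' = t_d, so minimality forces N to be invertible and the u_i to be rationally
    independent; hence |l(w) - |w| u| is bounded, which is the bounded remainder
    property.  Covering R^m by F + N Z^m shows that N is unimodular, and
    x |-> N x + b transports the given coding to one of R_{u'}.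

    In the S-adic case, a rational functional which is bounded on the level-n words
    vanishes, because these words approximate large multiples of M_[0,n)^-1 u.  This
    implies that the lengths of sigma_[0,n)(i) tend to infinity, and that the
    cylinders of all words sigma_[0,n)(i) shrink to a single point y.  Then
    z |-> y + T z maps R(w) between the open and the closed cylinder of w, which
    gives the description of the atoms by Rauzy fractals. *)

(* Two difficulties shape the proof. The partition lives in [R^m] while remainders are counted on
   the torus, and it has to be shown that distinct integer translates of [F] overlap in null sets.
   Boundedness of [F] gives this; then almost every orbit avoids all boundaries and overlaps, and
   its visits on the torus can be read off a symbolic coding. In the S-adic case, a word of
   [sadic_language] might a priori not extend to a point of the shift, some letters might have
   images of bounded length along infinitely many levels, and the images of different letters might
   have cylinders that shrink to different points. The first is excluded because the coordinates of
   [M^-1 u] are rationally independent, hence nonzero. The other two are excluded by building a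
   rational functional that is bounded on the words of one level: potentials for blocks of short
   letters, and indicators of classes of letters. *)
Require Import Defs.
From HB Require Import structures.
From mathcomp Require Import all_boot all_order all_algebra.
From mathcomp Require Import all_classical all_reals all_analysis.
From mathcomp Require Import measurable_realfun ring lra zify.
Set Implicit Arguments.
Unset Strict Implicit.
Unset Printing Implicit Defensive.
Import Order.TTheory GRing.Theory Num.Theory.
Import numFieldNormedType.Exports.
Local Open Scope classical_set_scope.
Local Open Scope ring_scope.

(** * Column vectors and the Lebesgue measure *)

Section column_vectors.
Variable R : realType.

Lemma cV_normP (m : nat) (x : 'cV[R]_m) (e : R) : 0 <= e ->
  (`|x| <= e) <-> (forall i, `|x i 0| <= e).
Proof.
move=> e0; rewrite [in X in X <-> _]/Num.norm/= mx_normrE; split=> [/bigmax_leP[_ h] i|h].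
  exact: (h (i, 0)).
by apply/bigmax_leP; split=> // -[i j] _ /=; rewrite (ord1 j).
Qed.

Lemma cV_coord_le (m : nat) (x : 'cV[R]_m) i : `|x i 0| <= `|x|.
Proof. by move: i; apply/(cV_normP _ (normr_ge0 x)). Qed.

Lemma cV_norm_ltP (m : nat) (x : 'cV[R]_m) (e : R) : 0 < e ->
  (`|x| < e) <-> (forall i, `|x i 0| < e).
Proof.
move=> e0; rewrite [in X in X <-> _]/Num.norm/= mx_normrE; split=> [/bigmax_ltP[_ h] i|h].
  exact: (h (i, 0)).
by apply/bigmax_ltP; split=> // -[i j] _ /=; rewrite (ord1 j).
Qed.

Lemma mulmx_norm_bound (m n : nat) (A : 'M[R]_(n, m)) :
  exists2 K : R, 0 < K & forall x : 'cV[R]_m, `|A *m x| <= K * `|x|.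
Proof.
exists (1 + \sum_i \sum_j `|A i j|).
  by rewrite ltr_wpDr// sumr_ge0// => i _; rewrite sumr_ge0.
move=> x; apply/cV_normP => [|i].
  by rewrite mulr_ge0// addr_ge0// sumr_ge0// => i _; rewrite sumr_ge0.
rewrite mxE (le_trans (ler_norm_sum _ _ _))//.
rewrite (@le_trans _ _ (\sum_j `|A i j| * `|x|))//.
  by apply: ler_sum => j _; rewrite normrM ler_wpM2l// cV_coord_le.
rewrite -mulr_suml ler_wpM2r// (bigD1 i)//= addrCA lerDl addr_ge0//.
by rewrite sumr_ge0// => k _; rewrite sumr_ge0.
Qed.

Lemma mulmx_continuous (m n : nat) (A : 'M[R]_(n, m)) :
  continuous (fun x : 'cV[R]_m => A *m x).
Proof.
pose L := mulmx A : {linear 'cV[R]_m -> 'cV[R]_n}.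
apply: (@bounded_linear_continuous R _ _ L).
have [K K0 hK] := mulmx_norm_bound A.
apply/bounded_funP => r; exists (K * r) => x xr.
by rewrite (le_trans (hK x))// ler_wpM2l// ltW.
Qed.

Lemma affine_continuous (m n : nat) (A : 'M[R]_(n, m)) (b : 'cV[R]_n) :
  continuous (fun x : 'cV[R]_m => A *m x + b).
Proof. by move=> x; exact: (cvgD (@mulmx_continuous m n A x) (cvg_cst b)). Qed.

Lemma translate_continuous (m : nat) (b : 'cV[R]_m) :
  continuous (fun x : 'cV[R]_m => x + b).
Proof. by move=> x; exact: (cvgD cvg_id (cvg_cst b)). Qed.

Lemma lebesgue_measure_translate (a : R)
    (A : set (measurableTypeR R)) : measurable A ->
  lebesgue_measure ((fun x : R => x + a) @^-1` A) = lebesgue_measure A.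
Proof.
have mf : measurable_fun [set: measurableTypeR R]
    (fun x : measurableTypeR R => x + a : measurableTypeR R).
  by apply: measurable_funD; [exact: measurable_id|exact: measurable_cst].
move=> mA; apply/esym.
pose mu : {measure set (measurableTypeR R) -> \bar R} :=
  measure_function_pushforward__canonical__measure_function_Measure lebesgue_measure mf.
apply: (@lebesgue_measure_unique R mu) => // X [[b c] _ <-] /=.
rewrite /mu/= /pushforward /= [X in _ = lebesgue_measure X](_ : _ = `]b - a, c - a]%classic).
  rewrite !lebesgue_measure_itv/= !lte_fin ltrD2r; case: ifP => // _.
  by rewrite -!EFinD; congr (_%:E); ring.
by apply/seteqP; split=> x /=; rewrite !in_itv/= ltrBlDr lerBrDr.
Qed.

Lemma measurable_translate (m : nat) (a : 'cV[R]_m) :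
  measurable_fun setT (fun x : 'cV[R]_m => x + a).
Proof.
apply: measurable_cV_fun => i.
rewrite (_ : (fun x : 'cV[R]_m => _) = fun x => (x i 0 : measurableTypeR R) + a i 0).
  by apply: measurable_funD; [exact: measurable_coord|exact: measurable_cst].
by apply/funext => x; rewrite mxE.
Qed.

Lemma measurable_translate_preimage (m : nat) (a : 'cV[R]_m) A :
  measurable A -> measurable ((fun x : 'cV[R]_m => x + a) @^-1` A).
Proof. by move=> mA; have := measurable_translate a measurableT mA; rewrite setTI. Qed.

(** Induction on the dimension: read through [consv], the translation acts on the two factors
    separately, and a product measure is determined by its values on rectangles. *)
Lemma lebesgueV_translate (m : nat) (a : 'cV[R]_m) A : measurable A ->
  lebesgueV ((fun x => x + a) @^-1` A) = lebesgueV A.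
Proof.
elim: m => [|m IH] in a A *; first by rewrite [a]flatmx0 => _; congr (lebesgueV _); apply/funext => x /=; rewrite addr0.
move=> mA.
pose a1 : R := a ord0 0; pose a2 : 'cV[R]_m := @dsubmx _ 1 m 1 a.
have aE : a = consv (a1, a2).
  rewrite /consv -[LHS](@vsubmxK _ 1 m 1); rewrite (_ : usubmx _ = const_mx a1)//.
  by apply/colP => i; rewrite !mxE (ord1 i) /a1; congr (a _ 0); apply/val_inj.
pose f (z : measurableTypeR R * 'cV[R]_m) : measurableTypeR R * 'cV[R]_m := (z.1 + a1, z.2 + a2).
have mf : measurable_fun setT f.
  apply: measurable_fun_pair.
    apply: measurable_funD; [exact: measurable_fst|exact: measurable_cst].
  exact: measurableT_comp (measurable_translate a2) measurable_snd.
rewrite /= /pushforward.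
rewrite (_ : _ @^-1` _ = f @^-1` ((@consv R m) @^-1` A)); last first.
  apply/seteqP; split => -[z1 z2] /=; rewrite /f/= aE /consv/= (@add_col_mx _ 1 m);
   (rewrite [const_mx z1 + _](_ : _ = const_mx (z1 + a1)) //; by apply/matrixP => i j; rewrite !mxE).
have mB : measurable ((@consv R m) @^-1` A).
  by have := measurable_consv measurableT mA; rewrite setTI.
move: (_ @^-1` A) mB => B mB.
pose mu : {measure set _ -> \bar R} :=
  measure_function_pushforward__canonical__measure_function_Measure
    (@lebesgue_measure R \x @lebesgueV R m)%E mf.
apply/esym; apply: (@product_measure_unique _ _ _ _ _ (@lebesgue_measure R) (@lebesgueV R m) mu) => //.
move=> X Y mX mY; rewrite /mu/= /pushforward/=.
rewrite (_ : f @^-1` _ = ((fun x : R => x + a1) @^-1` X) `*` ((fun x => x + a2) @^-1` Y)) //.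
rewrite [LHS](@product_measure1E _ _ _ _ _ (@lebesgue_measure R) (@lebesgueV R m)).
- by congr (_ * _)%E; [exact: lebesgue_measure_translate|exact: IH].
- have mg : measurable_fun [set: measurableTypeR R] (fun x : measurableTypeR R => x + a1 : measurableTypeR R).
    apply: measurable_funD; [exact: measurable_id|exact: measurable_cst].
  by have := mg measurableT _ mX; rewrite setTI.
- exact: measurable_translate_preimage.
Qed.

(** * Dyadic cubes and the Borel sigma-algebra *)

Section dyadic.
Variable m : nat.

(** The half-open cube of side [2^-k] with lower corner [2^-k v], for [p = (k, v)]. The floor makes
    cubes of one level disjoint by construction, and the index type is countable, so that unions
    over it can be enumerated by [unpickle]. *)
Definition dyadic (p : nat * 'cV[int]_m) : set 'cV[R]_m :=
  [set x | forall i, Num.floor (2 ^+ p.1 * x i 0) = p.2 i 0].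

Lemma measurable_dyadic p : measurable (dyadic p).
Proof.
rewrite (_ : dyadic p = \bigcap_(i in [set: 'I_m])
    ((fun x : 'cV[R]_m => x i 0 : measurableTypeR R) @^-1`
      `[(p.2 i 0)%:~R / 2 ^+ p.1, (p.2 i 0 + 1)%:~R / 2 ^+ p.1[)).
  apply: fin_bigcap_measurable; first exact: finite_finset.
  move=> i _; rewrite -[X in measurable X]setTI.
  by apply: measurable_coord => //; exact: measurable_itv.
have p0 : 0 < 2 ^+ p.1 :> R by rewrite exprn_gt0.
apply/seteqP; split=> x /= h i.
  move=> _; rewrite /= in_itv/= ler_pdivrMr// ltr_pdivlMr// mulrC.
  by rewrite -floor_eq (h i) eqxx.
have := h i I; rewrite /= in_itv/= ler_pdivrMr// ltr_pdivlMr// mulrC.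
by rewrite -floor_eq => /eqP.
Qed.

Lemma dyadic_floor (k : nat) (x : 'cV[R]_m) :
  dyadic (k, \col_i Num.floor (2 ^+ k * x i 0)) x.
Proof. by move=> i; rewrite !mxE. Qed.

Lemma dyadic_dist p (x y : 'cV[R]_m) :
  dyadic p x -> dyadic p y -> forall i, `|x i 0 - y i 0| < (2 ^+ p.1)^-1.
Proof.
move=> hx hy i; have p0 : 0 < 2 ^+ p.1 :> R by rewrite exprn_gt0.
rewrite -[ltRHS]mul1r ltr_pdivlMr// -[X in _ * X](ger0_norm (ltW p0)) -normrM mulrBl.
have := floor_itv (2 ^+ p.1 * x i 0); have := floor_itv (2 ^+ p.1 * y i 0).
by rewrite (hx i) (hy i) !intrD ltr_norml ![_ * 2 ^+ _]mulrC; lra.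
Qed.

(** Rounding down to a multiple of [1/n] never crosses an integer. So the floor at a finer dyadic
    level determines the one at a coarser level, which nests the cubes. *)
Lemma floor_scale (n : nat) (y : R) : (0 < n)%N ->
  Num.floor y = Num.floor ((Num.floor (n%:R * y))%:~R / n%:R :> R).
Proof.
move=> n0; apply/esym/eqP; rewrite floor_eq.
have n0' : 0 < n%:R :> R by rewrite ltr0n.
have h1 := floor_itv y; have h2 := floor_itv (n%:R * y).
rewrite ler_pdivlMr// ltr_pdivrMr//; apply/andP; split.
  rewrite -[n%:R]/(n%:~R) -rmorphM/= ler_int floor_ge_int rmorphM/= mulrC.
  by rewrite ler_pM2l//; case/andP: h1.
rewrite -[n%:R]/(n%:~R) -rmorphM/= ltr_int floor_lt_int rmorphM/= mulrC.
by rewrite ltr_pM2r//; case/andP: h1.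
Qed.

Lemma dyadic_nested (p q : nat * 'cV[int]_m) x :
  (p.1 <= q.1)%N -> dyadic p x -> dyadic q x -> dyadic q `<=` dyadic p.
Proof.
move=> pq px qx y qy i; rewrite -(px i).
have h (z : R) : Num.floor (2 ^+ p.1 * z) = Num.floor ((Num.floor (2 ^+ q.1 * z))%:~R / (2 ^ (q.1 - p.1))%:R :> R).
  rewrite [LHS](@floor_scale (2 ^ (q.1 - p.1))) ?expn_gt0//.
  by rewrite mulrA natrX -exprD subnK.
by rewrite !h (qx i) (qy i).
Qed.

(** The empty set is added to obtain a pi-system: two cubes are nested or disjoint. *)
Definition dyadics : set (set 'cV[R]_m) := set0 |` range dyadic.

Lemma dyadics_setI_closed : setI_closed dyadics.
Proof.
move=> A B [->|[p _ <-]]; first by rewrite set0I; left.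
move=> [->|[q _ <-]]; first by rewrite setI0; left.
have [[x [px qx]]|] := pselect (dyadic p `&` dyadic q !=set0); last first.
  by move=> /set0P/negP/negPn/eqP ->; left.
have [pq|/ltnW pq] := leqP p.1 q.1.
  by right; exists q => //; rewrite setIidr//; exact: dyadic_nested pq px qx.
by right; exists p => //; rewrite setIidl//; exact: dyadic_nested pq qx px.
Qed.

Lemma open_bigcup_dyadic (U : set 'cV[R]_m) : open U ->
  U = \bigcup_n (if unpickle n is Some p then
                   (if `[< dyadic p `<=` U >] then dyadic p else set0) else set0).
Proof.
move=> oU; apply/seteqP; split=> x; last first.
  by move=> [n _]; case: unpickle => // p; case: asboolP => // h /h.
move=> Ux; have /nbhs_ballP[e /= e0 eU] := open_nbhs_nbhs (conj oU Ux).
have [k ke] : exists k : nat, (2 ^+ k)^-1 < e.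
  have [k ke] : exists k : nat, e^-1 < k%:R.
    by exists (Num.bound e^-1); apply: archi_boundP; rewrite invr_ge0 ltW.
  exists k; rewrite invf_plt ?posrE ?exprn_gt0// (lt_trans ke)//.
  by rewrite -natrX ltr_nat ltn_expl.
pose p := (k, \col_i Num.floor (2 ^+ k * x i 0)) : nat * 'cV[int]_m.
exists (pickle p) => //; rewrite pickleK; case: asboolP => [_|[]]; first exact: dyadic_floor.
move=> y yp; apply: eU; rewrite -ball_normE /=; apply/cV_norm_ltP => // i.
by rewrite !mxE (lt_trans _ ke)//; apply: (@dyadic_dist p) => //; exact: dyadic_floor.
Qed.

Lemma open_measurable_cV (U : set 'cV[R]_m) : open U -> measurable U.
Proof.
move=> /open_bigcup_dyadic ->; apply: bigcupT_measurable => n.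
by case: unpickle => // p; case: asboolP => // _; exact: measurable_dyadic.
Qed.

Lemma closed_measurable_cV (U : set 'cV[R]_m) : closed U -> measurable U.
Proof. by move/closed_openC/open_measurable_cV/measurableC; rewrite setCK. Qed.

(** The coordinate sigma-algebra is generated by the half-spaces [x i 0 < a], which are open and
    hence countable unions of dyadic cubes. *)
Lemma measurable_dyadicsE : @measurable _ 'cV[R]_m = <<s dyadics >>.
Proof.
apply/seteqP; split; last first.
  apply: smallest_sub; first exact: sigma_algebra_measurable.
  by move=> _ [->|[p _ <-]]; [exact: measurable0|exact: measurable_dyadic].
apply: smallest_sub; first exact: smallest_sigma_algebra.
have bigU (I : finType) (U : Type) (P : I -> set U) B :
    (\big[setU/set0]_(i : I) P i) B -> exists i, P i B.
  elim/big_ind: _ => [//|X Y hX hY [/hX|/hY]//|i _ PB]; by exists i.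
move=> B hB; have [i [A mA <-]] := bigU _ _ _ _ hB; rewrite setTI.
pose T := g_sigma_algebraType dyadics.
have : measurable_fun [set: T] (fun x : T => (x : 'cV[R]_m) i 0 : measurableTypeR R).
  apply: (measurability _ (RGenInftyO.measurableE R)) => _ [_ [a ->] <-].
  rewrite setTI.
  have oU : open ((fun x : 'cV[R]_m => x i 0) @^-1` `]-oo, a[).
    by apply: open_comp; [move=> x _; exact: coord_continuous|exact: interval_open].
  rewrite [X in _ X](open_bigcup_dyadic oU).
  apply: bigcupT_measurable => n; apply: sub_sigma_algebra.
  case: unpickle => [p|]; last by left.
  by case: asboolP => _; [right; exists p|left].
by move=> /(_ measurableT _ mA); rewrite setTI.
Qed.

End dyadic.
End column_vectors.

(** * Translation-invariant measures *)

Lemma fsbigT (V : Type) (idx : V) (op : Monoid.com_law idx) (T : finType) (f : T -> V) :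
  \big[op/idx]_(i \in [set: T]) f i = \big[op/idx]_(i : T) f i.
Proof.
rewrite [RHS]fsbig_seq ?index_enum_uniq//; congr (\big[_/_]_(_ \in _) _).
by apply/seteqP; split=> // w _ /=; exact: mem_index_enum.
Qed.

Section invariant_measures.
Variables (R : realType) (m : nat).
Implicit Types (D : set 'cV[R]_m) (mu : {measure set 'cV[R]_m -> \bar R}).

Definition intvec (v : 'cV[int]_m) : 'cV[R]_m := map_mx intr v.

Lemma ZvecP (z : 'cV[R]_m) : Zvec z <-> exists v, z = intvec v.
Proof.
split=> [hz|[v ->] i]; last by rewrite mxE intr_int.
exists (\col_i Num.floor (z i 0)); apply/colP => i; rewrite !mxE.
by apply/esym/eqP; rewrite -intrEfloor; exact: hz.
Qed.

Lemma Zvec_intvec v : Zvec (intvec v). Proof. by apply/ZvecP; exists v. Qed.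

Lemma Zvec0 : Zvec (0 : 'cV[R]_m). Proof. by move=> i; rewrite mxE. Qed.

Lemma ZvecD (x y : 'cV[R]_m) : Zvec x -> Zvec y -> Zvec (x + y).
Proof. by move=> hx hy i; rewrite mxE rpredD// ?hx ?hy. Qed.

Lemma ZvecN (x : 'cV[R]_m) : Zvec x -> Zvec (- x).
Proof. by move=> hx i; rewrite mxE rpredN ?hx. Qed.

Lemma ZvecB (x y : 'cV[R]_m) : Zvec x -> Zvec y -> Zvec (x - y).
Proof. by move=> hx hy; apply: ZvecD => //; exact: ZvecN. Qed.

Lemma Zvec_mulmx n (A : 'M[R]_(n, m)) (z : 'cV[R]_m) :
  (forall i j, A i j \is a Num.int) -> Zvec z -> Zvec (A *m z).
Proof. by move=> hA hz i; rewrite mxE rpred_sum// => j _; rewrite rpredM ?hz. Qed.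

Definition translation_invariant mu :=
  forall (a : 'cV[R]_m) (A : set 'cV[R]_m), measurable A ->
    mu ((fun x => x + a) @^-1` A) = mu A.

Lemma lebesgueV_translation_invariant : translation_invariant (@lebesgueV R m).
Proof. by move=> a A; exact: lebesgueV_translate. Qed.

(** This is [D + Z^m], as [Zvec] is symmetric: the full preimage of the image of [D] in the
    torus. *)
Definition periodize D : set 'cV[R]_m := [set x | exists2 z, Zvec z & D (x + z)].

Let piece D (k : nat) : set 'cV[R]_m :=
  if (pickle_inv k : option 'cV[int]_m) is Some v then (fun x => x + intvec v) @^-1` D else set0.

Lemma periodizeE D : periodize D = \bigcup_k piece D k.
Proof.
apply/seteqP; split=> x.
  move=> [_ /ZvecP[v ->] Dx]; exists (pickle v) => //.
  by rewrite /piece pickleK_inv.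
move=> [k _]; rewrite /piece; case: pickle_inv => // v Dx.
by exists (intvec v) => //; exact: Zvec_intvec.
Qed.

Lemma measurable_piece D k : measurable D -> measurable (piece D k).
Proof.
by move=> mD; rewrite /piece; case: pickle_inv => // v; exact: measurable_translate_preimage.
Qed.

Lemma measurable_periodize D : measurable D -> measurable (periodize D).
Proof.
by move=> mD; rewrite periodizeE; apply: bigcupT_measurable => k; exact: measurable_piece.
Qed.

Lemma unit_cube_shift (x : 'cV[R]_m) : exists2 z, Zvec z & unit_cube R m (x + z).
Proof.
exists (- intvec (\col_i Num.floor (x i 0))); first exact/ZvecN/Zvec_intvec.
by move=> i; rewrite !mxE; have := floor_itv (x i 0); rewrite intrD; lra.
Qed.

Lemma unit_cube_shift_uniq (x : 'cV[R]_m) u v :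
  unit_cube R m (x + intvec u) -> unit_cube R m (x + intvec v) -> u = v.
Proof.
move=> hu hv; apply/colP => i; have := hu i; have := hv i; rewrite !mxE => h1 h2.
have h w : 0 <= x i 0 + w%:~R < 1 -> Num.floor (x i 0) = - w.
  move=> h0; apply/eqP; rewrite floor_eq intrD rmorphN/=; lra.
by apply: oppr_inj; rewrite -(h _ h1) -(h _ h2).
Qed.

Lemma periodize_cover D : (forall x, periodize D x) -> periodize D `&` unit_cube R m = unit_cube R m.
Proof. by move=> h; rewrite setIidr. Qed.

(** [D] is cut along the integer translates of the unit cube. The parts, moved back into the cube,
    cover the set measured on the left, and invariance preserves their measures. *)
Lemma measure_periodize mu D :
  translation_invariant mu ->
  measurable D -> (mu (periodize D `&` unit_cube R m) <= mu D)%E.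
Proof.
move=> inv mD.
(* [pickle_inv] gives each integer vector exactly one index, so distinct indices stand for distinct
   vectors and the parts are disjoint. *)
pose E k : set 'cV[R]_m := if (pickle_inv k : option 'cV[int]_m) is Some v
  then D `&` ((fun x => x - intvec v) @^-1` unit_cube R m) else set0.
have mE k : measurable (E k).
  rewrite /E; case: pickle_inv => // v; apply: measurableI => //.
  by apply: measurable_translate_preimage; exact: measurable_unit_cube.
have tE : trivIset setT E.
  move=> i j _ _ [x []]; rewrite /E.
  case ei: (pickle_inv i) => [u|] //; case ej: (pickle_inv j) => [v|] // [_ hu] [_ hv].
  have uv : - u = - v.
    by apply: (@unit_cube_shift_uniq x); rewrite /intvec map_mxN.
  have := @pickle_invK 'cV[int]_m i; have := @pickle_invK 'cV[int]_m j.
  by rewrite /ocancel ei ej /= (oppr_inj uv) => <- <-.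
apply: (@le_trans _ _ (\sum_(k <oo) mu (E k))%E).
  apply: (@le_trans _ _ (\sum_(k <oo) mu (piece D k `&` unit_cube R m))%E).
    apply: measure_sigma_subadditive.
    - by move=> k; apply: measurableI; [exact: measurable_piece|exact: measurable_unit_cube].
    - by apply: measurableI; [exact: measurable_periodize|exact: measurable_unit_cube].
    - by rewrite periodizeE setI_bigcupl.
  apply: lee_nneseries => // k _; rewrite /piece /E.
  case: pickle_inv => [v|]; last by rewrite set0I.
  rewrite -[leRHS](inv (intvec v)); last first.
    apply: measurableI => //; apply: measurable_translate_preimage; exact: measurable_unit_cube.
  rewrite le_eqVlt; apply/orP; left; apply/eqP; congr (mu _).
  by apply/seteqP; split=> y /= [h1 h2]; split=> //; move: h2; rewrite addrK.
rewrite -measure_semi_bigcup//; last exact: bigcupT_measurable.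
apply: le_measure; rewrite ?inE//; first exact: bigcupT_measurable.
by move=> x [k _]; rewrite /E; case: pickle_inv => // v [].
Qed.

Lemma dyadic_translate k v :
  dyadic (k, v) = (fun x => x - (2 ^+ k)^-1 *: intvec v) @^-1` dyadic (k, 0).
Proof.
have p0 : 2 ^+ k != 0 :> R by rewrite expf_neq0.
have h x i : Num.floor (2 ^+ k * (x - (2 ^+ k)^-1 *: intvec v) i 0) = Num.floor (2 ^+ k * x i 0) - v i 0.
  apply/eqP; rewrite !mxE mulrBr mulVKf// floor_eq.
  by have := floor_itv (2 ^+ k * x i 0); rewrite !intrD rmorphN/=; lra.
apply/seteqP; split=> x hx i; have := hx i; rewrite /= h !mxE => e.
  by rewrite e subrr.
by apply/eqP; rewrite -subr_eq0 e.
Qed.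

Lemma unit_cube_dyadic k : unit_cube R m =
  \bigcup_(w in [set: 'cV['I_(2 ^ k)]_m]) dyadic (k, map_mx (fun i => (nat_of_ord i)%:Z) w).
Proof.
have p0 : 0 < 2 ^+ k :> R by rewrite exprn_gt0.
apply/seteqP; split=> x.
  move=> h; have h' i : (`|Num.floor (2 ^+ k * x i ord0)|%N < 2 ^ k)%N.
    have /andP[x0 x1] := h i.
    have f0 : 0 <= Num.floor (2 ^+ k * x i 0) by rewrite floor_ge0 mulr_ge0// ltW.
    rewrite -ltz_nat gez0_abs// floor_lt_int -[X in _ < X]mulr1.
    rewrite -pmulrn natrX ltr_pM2l//.
  exists (\col_i Ordinal (h' i)) => // i; rewrite !mxE /= gez0_abs//.
  by rewrite floor_ge0 mulr_ge0// ?(ltW p0)//; case/andP: (h i).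
move=> [w _ h] i; have := h i; rewrite !mxE => /eqP; rewrite floor_eq.
move=> /andP[h1 h2]; apply/andP; split.
  by rewrite -(pmulr_rge0 _ p0) (le_trans _ h1).
rewrite -(ltr_pM2l p0) mulr1 (lt_le_trans h2)// -natrX -[leRHS]/((2 ^ k)%:Z%:~R).
by rewrite ler_int -[1]/(1%:Z) -PoszD lez_nat addn1.
Qed.

(** The cubes of level [k] are translates of each other, and those with corners in the unit cube
    tile it. *)
Lemma measure_dyadic mu k v :
  translation_invariant mu ->
  mu (unit_cube R m) = 1%E ->
  mu (dyadic (k, v)) = ((#|{: 'cV['I_(2 ^ k)]_m}|%:R)^-1)%:E.
Proof.
move=> inv mu1.
have hv w : mu (dyadic (k, w)) = mu (dyadic (k, (0 : 'cV[int]_m)%R)).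
  by rewrite dyadic_translate inv//; exact: measurable_dyadic.
rewrite hv.
have : mu (unit_cube R m) = (\sum_(w : 'cV['I_(2 ^ k)]_m) mu (dyadic (k, (0 : 'cV[int]_m)%R)))%E.
  rewrite (unit_cube_dyadic k) measure_fin_bigcup//=; last 2 first.
  - move=> u w _ _ [x [/= hu hw]]; apply/colP => i; have := hu i; have := hw i.
    by rewrite !mxE => -> [] /val_inj.
  - by move=> w _; exact: measurable_dyadic.
  by rewrite fsbigT; apply: eq_bigr => w _; exact: hv.
rewrite mu1; set c := mu _ => hc.
have cfin : c \is a fin_num.
  rewrite ge0_fin_numE ?measure_ge0//; apply: (@le_lt_trans _ _ 1%E); last exact: ltry.
  rewrite -mu1.
  apply: le_measure; rewrite ?inE; [exact: measurable_dyadic|exact: measurable_unit_cube|].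
  move=> x h; rewrite (unit_cube_dyadic k).
  exists (\col_i Ordinal (expn_gt0 2 k : (0 < 2 ^ k)%N)) => // i.
  by rewrite (h i) !mxE.
have {}hc : 1 = fine c *+ #|{: 'cV['I_(2 ^ k)]_m}|.
  rewrite -sumr_const; apply/EFin_inj; rewrite -sumEFin hc.
  by apply: eq_bigr => w _; rewrite fineK.
rewrite -(fineK cfin); congr (_%:E).
have n0 : #|{: 'cV['I_(2 ^ k)]_m}|%:R != 0 :> R.
  apply/eqP => n0; move: hc; rewrite -mulr_natr n0 mulr0 => /eqP; by rewrite oner_eq0.
by apply: (mulIf n0); rewrite mulVf// mulr_natr -hc.
Qed.

Lemma dyadic_cover : \bigcup_n (if unpickle n is Some v then
   dyadic (0%N, v) else set0) = [set: 'cV[R]_m].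
Proof.
apply/seteqP; split=> // x _.
exists (pickle (\col_i Num.floor (2 ^+ 0 * x i 0))) => //.
by rewrite pickleK; exact: dyadic_floor.
Qed.

(** The two measures agree on dyadic cubes by counting; these form a pi-system, and the cubes of
    level 0 exhaust the space with finite measure. *)
Lemma invariant_measure_unique mu A :
  translation_invariant mu ->
  mu (unit_cube R m) = 1%E -> measurable A -> mu A = lebesgueV A.
Proof.
move=> inv mu1 mA.
have D0 p : mu (dyadic p) = lebesgueV (dyadic p).
  case: p => k v; rewrite measure_dyadic//; apply/esym/measure_dyadic.
    exact: lebesgueV_translation_invariant.
  exact: lebesgueV_unit_cube.
apply: (measure_unique (@dyadics R m) (fun n => if unpickle n is Some v then
   dyadic (0%N, v) else set0) _ _ _ _ mu (@lebesgueV R m)) => //.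
- exact: measurable_dyadicsE.
- exact: dyadics_setI_closed.
- by move=> n; case: unpickle => [v|]; [right; exists (0%N, v)|left].
- exact: dyadic_cover.
- by move=> B [->|[p _ <-]]; [rewrite !measure0|exact: D0].
- by move=> n; case: unpickle => [v|]; rewrite ?measure0// measure_dyadic// ltry.
Qed.

Lemma lebesgueV_open_gt0 (U : set 'cV[R]_m) : open U -> U !=set0 -> (0 < lebesgueV U)%E.
Proof.
move=> oU [x Ux]; have := Ux; rewrite {1}(open_bigcup_dyadic oU) => -[n _].
case: unpickle => // -[k v]; case: asboolP => // sU _.
apply: (@lt_le_trans _ _ (lebesgueV (dyadic (k, v)))); last first.
  apply: le_measure; rewrite ?inE//; [exact: measurable_dyadic|exact: open_measurable_cV].
rewrite measure_dyadic//; last 2 first.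
  exact: lebesgueV_translation_invariant.
  exact: lebesgueV_unit_cube.
rewrite lte_fin invr_gt0 ltr0n; apply/card_gt0P.
by exists (\col_i Ordinal (expn_gt0 2 k : (0 < 2 ^ k)%N)).
Qed.

Lemma measurable_mulmx (A : 'M[R]_m) : measurable_fun setT (fun x : 'cV[R]_m => A *m x).
Proof.
apply: measurable_cV_fun => i.
rewrite (_ : (fun x : 'cV[R]_m => _) = fun x => \sum_j A i j * (x j 0 : measurableTypeR R)).
  apply: measurable_sum => j; apply: measurable_funM; first exact: measurable_cst.
  exact: measurable_coord.
by apply/funext => x; rewrite mxE.
Qed.

(** The image of Lebesgue measure under [A] is again translation invariant, so it remains to find
    its mass on the unit cube. [measure_periodize] bounds this mass from both sides, since the
    preimages of the cube under [A] and under [B] meet every class modulo [Z^m]. *)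
Lemma lebesgueV_unimodular (A B : 'M[R]_m) S :
  (forall i j, A i j \is a Num.int) -> (forall i j, B i j \is a Num.int) ->
  A *m B = 1%:M -> B *m A = 1%:M -> measurable S ->
  lebesgueV ((fun x => A *m x) @^-1` S) = lebesgueV S.
Proof.
move=> iA iB AB BA mS.
pose mu : {measure set _ -> \bar R} :=
  measure_function_pushforward__canonical__measure_function_Measure
    (@lebesgueV R m) (measurable_mulmx A).
have mpre C (M : 'M[R]_m) : measurable C -> measurable ((fun x : 'cV[R]_m => M *m x) @^-1` C).
  by move=> mC; have := measurable_mulmx M measurableT mC; rewrite setTI.
have cover (M N : 'M[R]_m) : M *m N = 1%:M -> (forall i j, N i j \is a Num.int) ->
    forall x, periodize ((fun x => M *m x) @^-1` unit_cube R m) x.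
  move=> MN iN x; have [z hz hx] := unit_cube_shift (M *m x).
  exists (N *m z); first exact: Zvec_mulmx.
  by rewrite /= mulmxDr mulmxA MN mul1mx.
have inv : translation_invariant mu.
  move=> a C mC; rewrite /mu/= /pushforward -comp_preimage.
  rewrite -[RHS](lebesgueV_translate (B *m a)); last exact: mpre.
  congr (lebesgueV _); apply/funext => x /=; congr (C _).
  by rewrite mulmxDr mulmxA AB mul1mx.
apply: (@invariant_measure_unique mu S) => //.
apply/eqP; rewrite eq_le; apply/andP; split.
  have := @measure_periodize mu ((fun x => B *m x) @^-1` unit_cube R m) inv.
  rewrite (periodize_cover (cover _ _ BA iA)) => /(_ (mpre _ _ (@measurable_unit_cube R m))).
  move/le_trans; apply; rewrite /mu/= /pushforward -comp_preimage.
  rewrite (_ : _ \o _ = id) ?lebesgueV_unit_cube//.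
  by apply/funext => x /=; rewrite mulmxA BA mul1mx.
have := @measure_periodize (@lebesgueV R m) ((fun x => A *m x) @^-1` unit_cube R m).
rewrite (periodize_cover (cover _ _ AB iB)) => h; apply: le_trans (h _ _).
- by rewrite [leRHS]lebesgueV_unit_cube.
- exact: lebesgueV_translation_invariant.
- by apply: mpre; exact: measurable_unit_cube.
Qed.

End invariant_measures.

(** * The torus and its Haar measure *)

Section torus_maps.
Variables (R : realType) (m : nat).
Implicit Types (t x y z : 'cV[R]_m) (D : set 'cV[R]_m).

Lemma torus_piP x y : torus_pi x = torus_pi y <-> Zvec (x - y).
Proof.
have e : reflect (torus_pi x = torus_pi y) (congZ x y) by exact: eqquotP.
split=> [/e/forallP h i|h]; first by rewrite !mxE.
by apply/e/forallP => i; have := h i; rewrite !mxE.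
Qed.

Lemma torus_piD x z : Zvec z -> torus_pi (x + z) = torus_pi x.
Proof. by move=> hz; apply/torus_piP; rewrite addrAC subrr add0r. Qed.

Lemma torus_pi_surj (a : torus R m) : exists x, a = torus_pi x.
Proof. by exists (repr a); rewrite /torus_pi reprK. Qed.

Lemma rotation_pi t x : rotation t (torus_pi x) = torus_pi (x + t).
Proof.
apply/torus_piP; rewrite opprD addrACA subrr addr0; apply/torus_piP.
by rewrite {1}/torus_pi reprK.
Qed.

Lemma iter_rotation t x n : iter n (rotation t) (torus_pi x) = torus_pi (x + t *+ n).
Proof. by elim: n => [|n IH]; rewrite ?mulr0n ?addr0//= IH rotation_pi -addrA -mulrSr. Qed.

Lemma preimage_image_torus_pi D : torus_pi @^-1` (torus_pi @` D) = periodize D.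
Proof.
apply/seteqP; split=> x.
  move=> [y Dy /torus_piP h]; exists (y - x) => //; by rewrite addrC subrK.
move=> [z hz Dz]; exists (x + z) => //; apply/torus_piP.
by rewrite addrAC subrr add0r.
Qed.

Lemma measurable_torus_preimage (A : set (torus R m)) :
  measurable A <-> measurable (torus_pi @^-1` A).
Proof.
by split=> h; [have := measurable_torus_pi measurableT h; rewrite setTI|rewrite /measurable/= /torus_measurable /image_set_system/= setTI].
Qed.

Lemma measurable_image_torus_pi D : measurable D -> measurable (torus_pi @` D).
Proof.
by move=> mD; apply/measurable_torus_preimage; rewrite preimage_image_torus_pi; exact: measurable_periodize.
Qed.

Lemma haar_image_le D : measurable D -> (haar (torus_pi @` D) <= lebesgueV D)%E.
Proof.
move=> mD; rewrite /haar preimage_image_torus_pi.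
apply: (@measure_periodize R m (@lebesgueV R m)) => //.
exact: lebesgueV_translation_invariant.
Qed.

Lemma rotation_preimage t (Y : set (torus R m)) :
  torus_pi @^-1` (rotation t @^-1` Y) = (fun x => x + t) @^-1` (torus_pi @^-1` Y).
Proof. by apply/seteqP; split=> x /=; rewrite rotation_pi. Qed.

Lemma measurable_rotation t (Y : set (torus R m)) :
  measurable Y -> measurable (rotation t @^-1` Y).
Proof.
move=> /measurable_torus_preimage mY; apply/measurable_torus_preimage.
by rewrite rotation_preimage; exact: measurable_translate_preimage.
Qed.

(** The inequality [<=] holds for every rotation by [measure_periodize]; applied to the rotation by
    [- t] it gives the reverse one. *)
Lemma haar_rotation t (Y : set (torus R m)) : measurable Y ->
  haar (rotation t @^-1` Y) = haar Y.
Proof.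
have le s (Z : set (torus R m)) : measurable Z -> (haar (rotation s @^-1` Z) <= haar Z)%E.
  move=> /measurable_torus_preimage mZ; rewrite /haar rotation_preimage.
  set P := torus_pi @^-1` Z; pose D := (fun x => x + s) @^-1` (P `&` unit_cube R m).
  have mD0 : measurable (P `&` unit_cube R m) by apply: measurableI => //; exact: measurable_unit_cube.
  have mD : measurable D by exact: measurable_translate_preimage.
  have PD : (fun x => x + s) @^-1` P = periodize D.
    apply/seteqP; split=> x /=.
      move=> Px; have [z hz hx] := unit_cube_shift (x + s).
      exists z => //; split; rewrite /= addrAC//.
      by rewrite /P/= torus_piD.
    move=> [z hz hD]; have [h _] : P (x + z + s) /\ unit_cube R m (x + z + s) := hD.
    by move: h; rewrite /P/= (addrAC x z s) (torus_piD (x + s) hz).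
  rewrite PD; apply: (le_trans (measure_periodize (@lebesgueV_translation_invariant R m) mD)).
  by rewrite [leLHS](@lebesgueV_translate R m s).
move=> mY; apply/eqP; rewrite eq_le le//=.
have E : Y = rotation (- t) @^-1` (rotation t @^-1` Y).
  apply/seteqP; split=> a /=; have [x ->] := torus_pi_surj a; by rewrite !rotation_pi subrK.
by rewrite {1}E le//; exact: measurable_rotation.
Qed.

Lemma haar_iter_rotation t n (Y : set (torus R m)) : measurable Y ->
  measurable (iter n (rotation t) @^-1` Y) /\ haar (iter n (rotation t) @^-1` Y) = haar Y.
Proof.
move=> mY; elim: n => [//|n [mI hI]].
have -> : iter n.+1 (rotation t) @^-1` Y = rotation t @^-1` (iter n (rotation t) @^-1` Y).
  by apply/seteqP; split=> a /=; rewrite -iterS iterSr.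
by split; [exact: measurable_rotation|rewrite haar_rotation].
Qed.

End torus_maps.

Lemma Rintegral_sum_indic d (T : measurableType d) (R : realType) (P : probability T R)
    (J : Type) (s : seq J) (c : J -> R) (A : J -> set T) :
  (forall j, measurable (A j)) ->
  P.-integrable setT (EFin \o (fun x => \sum_(j <- s) c j * \1_(A j) x)) /\
  (\int[P]_x (\sum_(j <- s) c j * \1_(A j) x) = \sum_(j <- s) c j * fine (P (A j)))%R.
Proof.
move=> mA.
have i1 j : P.-integrable setT (EFin \o (\1_(A j) : T -> R)).
  apply/integrableP; split; first by apply/measurable_EFinP; exact: measurable_indic.
  rewrite (eq_integral (fun x => (\1_(A j) x)%:E)); last by move=> x _ /=; rewrite ger0_norm.
  by rewrite integral_indic// setIT (@le_lt_trans _ _ 1%E) ?ltry// probability_le1.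
have i2 j : P.-integrable setT (EFin \o (fun x => c j * \1_(A j) x)).
  by have := integrableZl measurableT (c j) (i1 j); apply: eq_integrable => // x _ /=; rewrite EFinM.
elim: s => [|j s [IH1 IH2]].
  split; last by under eq_Rintegral do rewrite big_nil; rewrite big_nil Rintegral_cst// mul0r.
  rewrite (_ : _ \o _ = EFin \o (fun=> 0)); last by apply/funext => x /=; rewrite big_nil.
  exact: finite_measure_integrable_cst.
have E : (fun x => \sum_(i <- j :: s) c i * \1_(A i) x) =
   (fun x => c j * \1_(A j) x + \sum_(i <- s) c i * \1_(A i) x).
  by apply/funext => x; rewrite big_cons.
rewrite E; split.
  have := integrableD measurableT (i2 j) IH1; by apply: eq_integrable => // x _ /=; rewrite EFinD.
rewrite RintegralD// IH2 big_cons RintegralZl//; congr (_ * _ + _).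
by rewrite /Rintegral integral_indic// setIT.
Qed.

(** Transfers a bound on orbit sums to the measures. With the null set removed from every [A j], the
    sum is 0 on that set, so the bound holds at every point and can be integrated. *)
Lemma ae_bounded_sum_indic d (T : measurableType d) (R : realType) (P : probability T R)
    (J : Type) (s : seq J) (c : J -> R) (A : J -> set T) (C : R) :
  (forall j, measurable (A j)) ->
  {ae P, forall x, `|\sum_(j <- s) c j * \1_(A j) x| <= C} ->
  `|\sum_(j <- s) c j * fine (P (A j))| <= C.
Proof.
move=> mA [N [mN N0 hN]].
have C0 : 0 <= C.
  have [x nNx] : exists x, ~ N x.
    apply: contrapT => h; have NT : N = setT.
      by apply/seteqP; split=> // x _; apply: contrapT => nx; apply: h; exists x.
    by have : (0 < P N)%E; [rewrite NT probability_setT|rewrite N0 ltxx].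
  apply: (@le_trans _ _ `|\sum_(j <- s) c j * \1_(A j) x|) => //.
  by apply: contrapT => h; apply: nNx; exact: hN.
have PA j : P (A j) = P (A j `\` N).
  rewrite {1}(_ : A j = (A j `&` N) `|` (A j `\` N)); last by rewrite setUIDK.
  rewrite measureU//.
  - by rewrite [X in (X + _)%E = _](_ : _ = 0%E) ?add0e//; apply: subset_measure0 N0; rewrite ?subIsetr//; exact: measurableI.
  - exact: measurableI.
  - exact: measurableD.
  - by apply/seteqP; split=> // x [[_ Nx] [_ nNx]].
rewrite (eq_bigr (fun j => c j * fine (P (A j `\` N)))); last by move=> j _; rewrite -PA.
have [i <-] := @Rintegral_sum_indic _ _ _ P _ s c (fun j => A j `\` N) (fun j => measurableD (mA j) mN).
have bnd x : `|\sum_(j <- s) c j * \1_(A j `\` N) x| <= C.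
  have [Nx|nNx] := pselect (N x).
    rewrite big1 ?normr0// => j _; rewrite indicE memNset ?mulr0// => -[_ /(_ Nx) []].
  rewrite (eq_bigr (fun j => c j * \1_(A j) x)).
    by apply: contrapT => h; apply: nNx; exact: hN.
  move=> j _; rewrite !indicE; congr (_ * (nat_of_bool _)%:R).
  by apply/idP/idP; rewrite !inE; [case|split].
have ic (r : R) : P.-integrable setT (EFin \o (fun=> r)) by exact: finite_measure_integrable_cst.
have ir (r : R) : (\int[P]_(_ in setT) r)%R = r.
  rewrite Rintegral_cst// -[RHS]mulr1; congr (_ * _).
  by rewrite -[RHS]/(fine 1%:E); congr fine; exact: probability_setT.
rewrite ler_norml -[X in X <= _ <= _]ir -[X in _ <= _ <= X]ir.
by apply/andP; split; apply: le_Rintegral => // x _; have := bnd x; rewrite ler_norml => /andP[].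
Qed.

(** * Natural partitions and their cylinders *)

Lemma mkseq_consE (T : Type) (f : nat -> T) n :
  mkseq f n.+1 = f 0%N :: mkseq (fun k => f k.+1) n.
Proof. by rewrite /mkseq /= (iotaDl 1 0) -map_comp. Qed.

Lemma bounded_setP (R : realType) (V : normedModType R) (A : set V) :
  bounded_set A <-> exists2 M : R, 0 < M & forall x, A x -> `|x| <= M.
Proof.
split=> [[M [Mreal hM]]|[M M0 hM]].
  exists (`|M| + 1); first by rewrite ltr_wpDl.
  by apply: hM; rewrite (le_lt_trans (ler_norm M))// ltrDl.
exists M; split; first exact: num_real.
by move=> N MN x Ax /=; rewrite (le_trans (hM x Ax))// ltW.
Qed.

(* If the overlap had positive measure, removing it from F would leave a set of
   measure less than 1 whose translates still cover, as F is bounded. *)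
Lemma fundamental_domain_overlap (R : realType) (m : nat) (F : set 'cV[R]_m) z :
  fundamental_domain F -> bounded_set F -> Zvec z -> z != 0 ->
  lebesgueV (F `&` (fun x => x - z) @^-1` F) = 0%E.
Proof.
move=> [mF F1 Fcov] /bounded_setP[M M0 hM] hz z0.
set D := _ `&` _; have mD : measurable D.
  by apply: measurableI => //; exact: measurable_translate_preimage.
have mFD : measurable (F `\` D) by exact: measurableD.
have cov x : periodize (F `\` D) x.
  have [y Fy [v hv yv]] : [set x + z | x in F & z in Zvec] x by rewrite Fcov.
  (* Walking from [y] in the direction [- z], the last point in [F] lies outside [D], since the next
     one has left [F]; it exists because [F] is bounded. *)
  pose P k := `[< F (y - z *+ k) >].
  have P0 : exists k, P k by exists 0%N; apply/asboolP; rewrite mulr0n subr0.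
  have zn0 : 0 < `|z| by rewrite normr_gt0.
  have Pb k : P k -> (k <= Num.bound ((M + `|y|) / `|z|))%N.
    move=> /asboolP/hM hk; rewrite -(ler_nat R) ltW//.
    apply: le_lt_trans (archi_boundP _); last first.
      by rewrite divr_ge0// addr_ge0// ltW.
    rewrite ler_pdivlMr// mulrC mulr_natr -normrMn.
    rewrite (_ : z *+ k = y - (y - z *+ k)); last by rewrite opprB addrC subrK.
    by rewrite (le_trans (ler_normB _ _))// addrC lerD2r.
  have [k /asboolP hk kmax] := ex_maxnP P0 Pb.
  exists (- v - z *+ k).
    apply: ZvecB; first exact: ZvecN.
    elim: k {hk kmax} => [|k IH]; first exact: Zvec0.
    by rewrite mulrS; exact: ZvecD.
  rewrite -yv addrA addrK; split=> // -[_ /= hk'].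
  suff : P k.+1 by move/kmax; rewrite ltnn.
  by apply/asboolP; rewrite mulrSr opprD addrA.
have h1 : (1 <= lebesgueV (F `\` D))%E.
  have := measure_periodize (@lebesgueV_translation_invariant R m) mFD.
  by rewrite (periodize_cover cov) [X in (X <= _)%E -> _]lebesgueV_unit_cube.
have h2 : (lebesgueV F = lebesgueV D + lebesgueV (F `\` D))%E.
  rewrite -{1}(setUIDK F D) measureU//; last 2 first.
  - exact: measurableI.
  - by apply/seteqP; split=> // x [[_ Nx] [_ nNx]].
  by congr (lebesgueV _ + _)%E; apply: setIidr => x [].
have : (lebesgueV D + 1 <= 1)%E by rewrite -{2}F1 h2 leeD2l.
have : (0 <= lebesgueV D)%E by exact: measure_ge0.
by case: (lebesgueV D) => [r| |]//; rewrite -EFinD !lee_fin => r0 r1; congr (_%:E); lra.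
Qed.

Section natural_partition.
Variables (R : realType) (m h : nat).
Variables (t : 'cV[R]_m) (F : set 'cV[R]_m) (Fi : 'I_h -> set 'cV[R]_m).
Variable ti : 'I_h -> 'cV[R]_m.

Definition displacement (w : seq 'I_h) : 'cV[R]_m := \sum_(a <- w) ti a.

(** The recursion follows the translation of each letter, so that cylinders split along
    concatenations; [cylinderE] identifies them with those of [cylinder]. *)
Fixpoint word_cylinder (w : seq 'I_h) : set 'cV[R]_m :=
  if w is a :: w' then interior (Fi a) `&` (fun x => x + ti a) @^-1` word_cylinder w'
  else setT.

Fixpoint closed_cylinder (w : seq 'I_h) : set 'cV[R]_m :=
  if w is a :: w' then Fi a `&` (fun x => x + ti a) @^-1` closed_cylinder w'
  else setT.

Lemma displacement_cat w1 w2 : displacement (w1 ++ w2) = displacement w1 + displacement w2.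
Proof. exact: big_cat. Qed.

Lemma displacement_cons a w : displacement (a :: w) = ti a + displacement w.
Proof. exact: big_cons. Qed.

Lemma word_cylinder_cat w1 w2 x :
  word_cylinder (w1 ++ w2) x <-> word_cylinder w1 x /\ word_cylinder w2 (x + displacement w1).
Proof.
elim: w1 x => [|a w1 IH] x /=; first by rewrite /displacement big_nil addr0; split=> [|[]].
by rewrite displacement_cons addrA; have := IH (x + ti a); split=> [[? /IH[]]|[[? ?] ?]] //; split=> //; apply/IH.
Qed.

Lemma open_word_cylinder w : open (word_cylinder w).
Proof.
elim: w => [|a w IH] /=; first exact: openT.
apply: openI; first exact: open_interior.
by apply: open_comp => // x _; exact: translate_continuous.
Qed.

Lemma word_cylinder_sub_closed w : word_cylinder w `<=` closed_cylinder w.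
Proof.
elim: w => [//|a w IH] x /= [/interior_subset ? ?]; split=> //; exact: IH.
Qed.

Lemma closed_closed_cylinder w : (forall i, closed (Fi i)) -> closed (closed_cylinder w).
Proof.
move=> cF; elim: w => [|a w IH] /=; first exact: closedT.
apply: closedI => //.
by apply: preimage_closed => // x _; exact: translate_continuous.
Qed.

Hypotheses (Ffd : fundamental_domain F) (Fb : bounded_set F).
Hypothesis np : natural_partition t F Fi ti.

Lemma atom_closed i : closed (Fi i).
Proof. by have [_ _ /(_ i)[-> _] _] := np; exact: closed_closure. Qed.

Lemma domain_closed : closed F.
Proof.
have [<- _ _ _] := np; apply: closed_bigcup; first exact: finite_finset.
by move=> i _; exact: atom_closed.
Qed.

Lemma atom_measurable i : measurable (Fi i).
Proof. by apply: closed_measurable_cV; exact: atom_closed. Qed.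

Lemma atom_sub i : Fi i `<=` F.
Proof. by have [<- _ _ _] := np => x Fx; exists i. Qed.

Lemma atom_step i x : Fi i x -> F (x + ti i).
Proof. by move=> Fx; have [_ _ _ /(_ i)[_]] := np; apply; exists x; rewrite // addrC. Qed.

Lemma atom_exists x : F x -> exists i, Fi i x.
Proof. by have [<- _ _ _] := np => -[i _ Fx]; exists i. Qed.

Lemma ti_cong i : Zvec (ti i - t).
Proof. by have [_ _ _ /(_ i)[]] := np. Qed.

Lemma atom_overlap i j z : Zvec z -> (i != j) || (z != 0) ->
  lebesgueV (Fi i `&` (fun x => x - z) @^-1` Fi j) = 0%E.
Proof.
move=> hz ijz; have [z0|z0] := eqVneq z 0.
  move: ijz; rewrite z0 eqxx orbF => ij.
  rewrite (_ : (fun x => x - 0) = id); last by apply/funext => x; rewrite subr0.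
  by have [_ /(_ i j ij)] := np.
apply: subset_measure0 (fundamental_domain_overlap Ffd Fb hz z0).
- apply: measurableI; first exact: atom_measurable.
  by apply: measurable_translate_preimage; exact: atom_measurable.
- have [mF _ _] := Ffd; apply: measurableI => //; exact: measurable_translate_preimage.
- by move=> x [/atom_sub ? /atom_sub].
Qed.

(** Otherwise, since [Fi j] is the closure of its interior, the interiors of [Fi i] and of the
    translate of [Fi j] would share a nonempty open set, which has positive measure, contrary to
    [atom_overlap]. *)
Lemma interior_atom_disjoint i j x z : Zvec z -> interior (Fi i) x ->
  Fi j (x - z) -> i = j /\ z = 0.
Proof.
move=> hz ix jx; apply: contrapT => nij.
have ijz : (i != j) || (z != 0).
  by apply/negPn/negP; rewrite negb_or !negbK => /andP[/eqP ? /eqP ?]; apply: nij.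
have [y [jy iy]] : interior (Fi j) `&` (fun y => y + z) @^-1` interior (Fi i) !=set0.
  have [_ _ /(_ j)[cj _] _] := np.
  have : closure (interior (Fi j)) (x - z) by rewrite -cj.
  apply; apply: open_nbhs_nbhs; split; last by rewrite /= subrK.
  by apply: open_comp; [move=> ? _; exact: translate_continuous|exact: open_interior].
pose U := interior (Fi i) `&` (fun y => y - z) @^-1` interior (Fi j).
have oU : open U.
  apply: openI; first exact: open_interior.
  by apply: open_comp; [move=> ? _; exact: translate_continuous|exact: open_interior].
have : (0 < lebesgueV U)%E.
  by apply: lebesgueV_open_gt0 => //; exists (y + z); split=> //; rewrite /= addrK.
rewrite (_ : lebesgueV U = 0%E) ?ltxx//.
apply: subset_measure0 (atom_overlap hz ijz).
- exact: open_measurable_cV.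
- apply: measurableI; first exact: atom_measurable.
  by apply: measurable_translate_preimage; exact: atom_measurable.
- by move=> w [/interior_subset ? /interior_subset].
Qed.

Lemma interior_atom_inj i j x : interior (Fi i) x -> Fi j x -> i = j.
Proof.
by move=> ix jx; have [] := @interior_atom_disjoint i j x 0 (@Zvec0 R m) ix; rewrite ?subr0.
Qed.

(** It is enough that one side is an open cylinder: an interior point of an atom lies in no other
    atom, not even on its boundary. This covers limit points such as those of Rauzy fractals. *)
Lemma word_cylinder_inj w1 w2 x : size w1 = size w2 ->
  word_cylinder w1 x -> closed_cylinder w2 x -> w1 = w2.
Proof.
elim: w1 w2 x => [|a w1 IH] [|b w2] x //= [sz] [ax h1] [bx h2].
have ab := interior_atom_inj ax bx; subst b.
by congr (_ :: _); apply: (IH _ (x + ti a)).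
Qed.

Lemma induced_preimageE k a w x :
  interior (Fi a) x ->
  induced_preimage Fi ti k.+1 (interior (Fi w)) x <-> induced_preimage Fi ti k (interior (Fi w)) (x + ti a).
Proof.
move=> ax; split=> /=; last by move=> hx; exists (x + ti a) => //; exists a.
move=> [y [i ix ->]]; by rewrite (interior_atom_inj ax (interior_subset ix)).
Qed.

Lemma cylinderE n (w : nat -> 'I_h) : cylinder Fi ti n w = word_cylinder (mkseq w n.+1).
Proof.
elim: n w => [|n IH] w; apply/seteqP; split=> x.
- by move=> /(_ 0%N isT) /= h0; split.
- by move=> [hx _] [|k] //.
- move=> hx; have h0 : interior (Fi (w 0%N)) x by exact: (hx 0%N).
  rewrite mkseq_consE; split=> //; rewrite /preimage/=.
  have : cylinder Fi ti n (fun k => w k.+1) (x + ti (w 0%N)); last by rewrite IH.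
  move=> k /= kn; have := hx k.+1 kn.
  exact: (@induced_preimageE k (w 0%N) (w k.+1) x h0).1.
- rewrite mkseq_consE => -[h0 hc] [|k] //= kn.
  have := (@induced_preimageE k (w 0%N) (w k.+1) x h0).2; apply.
  have : cylinder Fi ti n (fun k => w k.+1) (x + ti (w 0%N)) by rewrite IH.
  exact.
Qed.

Lemma partition_languageP w : partition_language Fi ti w <-> w != [::] /\ word_cylinder w !=set0.
Proof.
split=> [[i0 [n [-> ]]]|].
  by rewrite cylinderE => hc; split=> //.
case: w => [[]//|a w] [_ hc]; exists (nth a (a :: w)), (size w).
have e : mkseq (nth a (a :: w)) (size w).+1 = a :: w := mkseq_nth a (a :: w).
by rewrite cylinderE e.
Qed.

End natural_partition.

(** * Codings of generic orbits and bounded remainder sets *)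

Lemma bounded_multiples_eq0 (R : realType) (a C : R) :
  (forall N : nat, `|N%:R * a| <= C) -> a = 0.
Proof.
move=> h; apply/eqP; apply: contraT => a0.
have a1 : 0 < `|a| by rewrite normr_gt0.
have C0 : 0 <= C by apply: le_trans (h 0%N).
have := h (Num.bound (C / `|a|)); rewrite normrM ger0_norm// leNgt => /negP[].
by rewrite -ltr_pdivrMr// archi_boundP// divr_ge0.
Qed.

Definition occurrences (T : eqType) (v s : seq T) : nat :=
  count (fun k => prefix v (drop k s)) (iota 0 (size s)).

Lemma drop_mkseq (T : Type) (f : nat -> T) k n :
  drop k (mkseq f n) = mkseq (fun j => f (k + j)%N) (n - k).
Proof.
by rewrite /mkseq -map_drop drop_iota add0n -[k in iota k _]addn0 iotaDl -map_comp.
Qed.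

Lemma prefix_mkseq (T : eqType) (f : nat -> T) (v : seq T) n :
  prefix v (mkseq f n) = (size v <= n)%N && (mkseq f (size v) == v).
Proof.
rewrite prefixE; case: (leqP (size v) n) => [h|h] /=.
  rewrite (_ : take _ _ = mkseq f (size v))//.
  by rewrite /mkseq -map_take take_iota (minn_idPl h).
by apply/eqP => /(congr1 size); rewrite size_take size_mkseq ltnNge (ltnW h)/= => e; rewrite e ltnn in h.
Qed.

(** A window of length [size v] starting before [N] ends within the first [N + (size v).-1] letters,
    and one starting later does not fit. *)
Lemma occurrences_mkseq (T : eqType) (x : nat -> T) (v : seq T) N : v != [::] ->
  occurrences v (mkseq x (N + (size v).-1)) =
  (\sum_(n < N) (mkseq (fun j => x (n + j)%N) (size v) == v))%N.
Proof.
move=> v0; have sv : (0 < size v)%N by case: v v0.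
rewrite /occurrences size_mkseq iotaD count_cat add0n.
rewrite [X in (_ + X)%N](_ : _ = 0%N) ?addn0; last first.
  apply/eqP; rewrite -leqn0 leqNgt -has_count; apply/hasPn => k; rewrite mem_iota => /andP[kN _].
  rewrite drop_mkseq prefix_mkseq negb_and -ltnNge; apply/orP; left.
  by rewrite -subn1; lia.
rewrite -sum1_count big_mkcond/= -(big_mkord xpredT (fun n => nat_of_bool (mkseq (fun j => x (n + j)%N) (size v) == v))).
rewrite /index_iota subn0 big_seq [RHS]big_seq; apply: eq_bigr => k; rewrite mem_iota add0n => /andP[_ kN].
rewrite drop_mkseq prefix_mkseq (_ : (size v <= _)%N); last by rewrite -subn1; lia.
by case: eqP.
Qed.

Lemma occurrences_cons (T : eqType) (v : seq T) a s :
  occurrences v (a :: s) = (prefix v (a :: s) + occurrences v s)%N.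
Proof. by rewrite /occurrences /= (iotaDl 1 0) count_map. Qed.

Lemma occurrences_letter (T : eqType) (a : T) s : occurrences [:: a] s = count_mem a s.
Proof.
by elim: s => // b s IH; rewrite occurrences_cons IH /= prefix0s andbT eq_sym.
Qed.

Section codings.
Variables (R : realType) (m h : nat).
Variables (t : 'cV[R]_m) (F : set 'cV[R]_m) (Fi : 'I_h -> set 'cV[R]_m).
Variable ti : 'I_h -> 'cV[R]_m.
Hypotheses (Ffd : fundamental_domain F) (Fb : bounded_set F).
Hypothesis np : natural_partition t F Fi ti.

Let mF i : measurable (Fi i). Proof. exact: (atom_measurable np). Qed.

Lemma atom_measure_le1 i : (lebesgueV (Fi i) <= 1)%E.
Proof.
have [mFF <- _] := Ffd; apply: le_measure; rewrite ?inE//; exact: (atom_sub np).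
Qed.

Lemma atom_measure_fin i : lebesgueV (Fi i) \is a fin_num.
Proof.
by rewrite ge0_fin_numE ?measure_ge0// (le_lt_trans (atom_measure_le1 i))// ltry.
Qed.

Lemma atom_interior_measure i : lebesgueV (interior (Fi i)) = lebesgueV (Fi i).
Proof.
have [_ _ /(_ i)[_ b0] _] := np.
have mI : measurable (interior (Fi i)) by apply: open_measurable_cV; exact: open_interior.
rewrite -[in RHS](setDUK (@interior_subset _ (Fi i))) measureU//.
- rewrite [X in (_ + X)%E](_ : _ = 0%E) ?adde0//.
  apply: subset_measure0 b0; [exact: measurableD| |].
    by apply: measurableD => //; apply: closed_measurable_cV; exact: closed_closure.
  by move=> x [Fx nx]; split=> //; exact: subset_closure.
- exact: measurableD.
- by rewrite setDE setICA setICr setI0.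
Qed.

(** The interiors are disjoint subsets of [F], so the Lebesgue measures sum to at most 1; the images
    cover the torus, so the Haar measures sum to at least 1. As Haar is bounded by Lebesgue
    termwise, equality holds throughout. *)
Lemma haar_atom_sum : (forall i, haar (torus_pi @` Fi i) = lebesgueV (Fi i)) /\
  \sum_i fine (lebesgueV (Fi i)) = 1.
Proof.
have mI i : measurable (interior (Fi i)) by apply: open_measurable_cV; exact: open_interior.
have hle i : (haar (torus_pi @` Fi i) <= lebesgueV (Fi i))%E by exact: haar_image_le.
have hfin i : haar (torus_pi @` Fi i) \is a fin_num.
  by rewrite ge0_fin_numE ?measure_ge0// (le_lt_trans (hle i))// (le_lt_trans (atom_measure_le1 i))// ltry.
have s1 : \sum_i fine (lebesgueV (Fi i)) <= 1.
  rewrite -lee_fin -sumEFin (eq_bigr (fun i => lebesgueV (interior (Fi i)))); last first.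
    by move=> i _; rewrite fineK ?atom_measure_fin// atom_interior_measure.
  rewrite -measure_bigsetU_ord//; last first.
    by move=> i j _ _ [x [ix /interior_subset jx]]; exact: (interior_atom_inj Ffd Fb np ix jx).
  have [mFF <- _] := Ffd; apply: le_measure; rewrite ?inE//.
    exact: bigsetU_measurable.
  elim/big_ind: _ => [//|A B hA hB x [/hA|/hB]//|i _ x ix].
  exact: (atom_sub np (interior_subset ix)).
have s2 : 1 <= \sum_i fine (haar (torus_pi @` Fi i)).
  rewrite -lee_fin -sumEFin (eq_bigr (fun i => haar (torus_pi @` Fi i))); last first.
    by move=> i _; rewrite fineK.
  rewrite -(@probability_setT _ _ _ (@haar R m)) -fsbigT.
  apply: content_sub_fsum; [exact: finite_finset|by move=> i _; exact: measurable_image_torus_pi|exact: measurableT|].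
  move=> a _; have [y ->] := torus_pi_surj a; have [_ _ Fcov] := Ffd.
  have [z Fz [v hv <-]] : [set x + z | x in F & z in Zvec] y by rewrite Fcov.
  by have [i iz] := atom_exists np Fz; exists i => //; exists z; rewrite // torus_piD.
have e : \sum_i (fine (lebesgueV (Fi i)) - fine (haar (torus_pi @` Fi i))) = 0.
  apply/eqP; rewrite eq_le sumrB subr_le0 (le_trans s1)//= subr_ge0.
  by apply: ler_sum => i _; rewrite fine_le// atom_measure_fin.
have h0 i : fine (lebesgueV (Fi i)) - fine (haar (torus_pi @` Fi i)) = 0.
  have := @psumr_eq0P _ _ xpredT (fun i => fine (lebesgueV (Fi i)) - fine (haar (torus_pi @` Fi i))).
  by apply => // j _; rewrite subr_ge0 fine_le// atom_measure_fin.
split=> [i|].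
  by rewrite -(fineK (hfin i)) -(fineK (atom_measure_fin i)); congr (_%:E); have := h0 i; lra.
apply/eqP; rewrite eq_le s1/= (le_trans s2)// le_eqVlt; apply/orP; left; apply/eqP.
by apply: eq_bigr => i _; have := h0 i; lra.
Qed.

Lemma haar_atom i : haar (torus_pi @` Fi i) = lebesgueV (Fi i).
Proof. by have [/(_ i)] := haar_atom_sum. Qed.

Lemma sum_atom_measure : \sum_i fine (lebesgueV (Fi i)) = 1.
Proof. by have [] := haar_atom_sum. Qed.

Lemma haar_negligible_image (D : set 'cV[R]_m) :
  measurable D -> lebesgueV D = 0%E -> haar.-negligible (torus_pi @` D).
Proof.
move=> mD D0; apply/negligibleP; first exact: measurable_image_torus_pi.
by apply/eqP; rewrite eq_le measure_ge0 andbT -D0 haar_image_le.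
Qed.

(** A pair of equal letters stands for the boundary of an atom, a pair of distinct letters for the
    points of the torus with representatives in both atoms. *)
Let exceptional_pair (p : 'I_h * 'I_h) : set (torus R m) :=
  if p.1 == p.2 then torus_pi @` (Fi p.1 `\` interior (Fi p.1))
  else torus_pi @` Fi p.1 `&` torus_pi @` Fi p.2.

Definition exceptional : set (torus R m) :=
  \bigcup_k (if unpickle k is Some p then exceptional_pair p else set0).

Lemma measurable_exceptional : measurable exceptional.
Proof.
apply: bigcupT_measurable => k; case: unpickle => // -[i j]; rewrite /exceptional_pair/=.
case: ifP => _; last by apply: measurableI; exact: measurable_image_torus_pi.
apply: measurable_image_torus_pi; apply: measurableD => //.
by apply: open_measurable_cV; exact: open_interior.
Qed.

Lemma haar_exceptional : haar exceptional = 0%E.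
Proof.
apply/negligibleP; first exact: measurable_exceptional.
apply: negligible_bigcup => k; case: unpickle => [[i j]|]; last exact: negligible_set0.
rewrite /exceptional_pair/=; case: eqP => [_|/eqP ij].
  apply: haar_negligible_image.
    by apply: measurableD => //; apply: open_measurable_cV; exact: open_interior.
  have [_ _ /(_ i)[_ b0] _] := np.
  apply: subset_measure0 b0.
  - by apply: measurableD => //; apply: open_measurable_cV; exact: open_interior.
  - apply: measurableD => //; first by apply: closed_measurable_cV; exact: closed_closure.
    by apply: open_measurable_cV; exact: open_interior.
  - by move=> x [Fx nx]; split=> //; exact: subset_closure.
(* Two atoms meet on the torus where one meets an integer translate of the other; there are
   countably many such translates, each with a null overlap. *)
pose E k := if unpickle k is Some v then
   Fi i `&` (fun x => x - intvec R v) @^-1` Fi j else set0.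
have mE k0 : measurable (E k0).
  rewrite /E; case: unpickle => // v; apply: measurableI => //.
  exact: measurable_translate_preimage.
apply: (@negligibleS _ _ _ _ (torus_pi @` \bigcup_k E k)).
  move=> a [[x xi xa] [y yj ya]].
  have /torus_piP/ZvecP[v hv] : torus_pi x = torus_pi y by rewrite xa ya.
  exists x => //; exists (pickle v) => //; rewrite /E pickleK; split=> //=.
  by rewrite -hv opprB addrC subrK.
apply: haar_negligible_image; first exact: bigcupT_measurable.
apply/negligibleP; first exact: bigcupT_measurable.
apply: negligible_bigcup => k0; apply/negligibleP => //.
rewrite /E; case: unpickle => [v|]; last exact: measure0.
by apply: (atom_overlap Ffd Fb np); [exact: Zvec_intvec|rewrite ij].
Qed.

Definition generic (a : torus R m) := forall n, ~ exceptional (iter n (rotation t) a).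

Lemma ae_generic : {ae haar, forall a, generic a}.
Proof.
apply: (@negligibleS _ _ _ _ (\bigcup_n (iter n (rotation t) @^-1` exceptional))).
  by move=> a /= /existsNP[n /contrapT hn]; exists n.
apply: negligible_bigcup => n; have [mI hI] := haar_iter_rotation t n measurable_exceptional.
by apply/negligibleP => //; exact: (etrans hI haar_exceptional).
Qed.

(** The first clause follows the orbit in [R^m] through interiors; the second makes visits on the
    torus readable from the letters, without double counting. *)
Definition codes (y : 'cV[R]_m) (x : nat -> 'I_h) :=
  (forall n, word_cylinder Fi ti (mkseq x n) y) /\
  (forall n i, (torus_pi @` Fi i) (torus_pi (y + t *+ n)) <-> i = x n).

Lemma displacement_cong w : Zvec (displacement ti w - t *+ size w).
Proof.
elim: w => [|a w IH]; first by rewrite /displacement big_nil mulr0n subr0; exact: Zvec0.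
rewrite displacement_cons /= mulrS opprD addrACA; apply: ZvecD => //.
exact: (ti_cong np).
Qed.

Lemma torus_pi_displacement y w :
  torus_pi (y + displacement ti w) = torus_pi (y + t *+ size w).
Proof.
apply/torus_piP; rewrite opprD addrACA subrr add0r; exact: displacement_cong.
Qed.

Lemma codes_shift y x n : codes y x ->
  codes (y + displacement ti (mkseq x n)) (fun k => x (n + k)%N).
Proof.
move=> [h1 h2]; split=> k.
  have := h1 (n + k)%N; rewrite /mkseq iotaD map_cat => /word_cylinder_cat[_].
  by rewrite add0n -[n in iota n]addn0 iotaDl -map_comp.
move=> i; rewrite -(h2 (n + k)%N i) (_ : torus_pi _ = torus_pi (y + t *+ (n + k)))//.
have := torus_pi_displacement (y + t *+ k) (mkseq x n).
by rewrite addrAC => ->; rewrite size_mkseq mulrnDr addrAC addrA.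
Qed.

(** Any representative in [F] and any choice of an atom at each time will do: genericity excludes
    boundaries, which makes the point interior, and overlaps, which makes the letter unique. *)
Lemma generic_codes a : generic a -> exists y x, torus_pi y = a /\ codes y x.
Proof.
move=> ga; have [y0 ya] := torus_pi_surj a.
have [_ _ Fcov] := Ffd.
have [y Fy [v hv yv]] : [set x + z | x in F & z in Zvec] y0 by rewrite Fcov.
have {}ya : torus_pi y = a by rewrite ya -yv torus_piD.
have [i0 _] := atom_exists np Fy.
pose idx z := xget i0 [set i | Fi i z].
have hidx z : F z -> Fi (idx z) z.
  by move=> /(atom_exists np); exact: (@xgetPex _ i0 [set i | Fi i z]).
pose Y := fix Y n := if n is n'.+1 then Y n' + ti (idx (Y n')) else y.
pose x n := idx (Y n).
have FY n : F (Y n) by elim: n => [//|n IH] /=; apply: (atom_step np); exact: hidx.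
have YE n : Y n = y + displacement ti (mkseq x n).
  elim: n => [|n IH]; first by rewrite /displacement big_nil addr0.
  by rewrite mkseqS -cats1 displacement_cat addrA -IH /= /displacement big_seq1.
have piY n : torus_pi (Y n) = iter n (rotation t) a.
  by rewrite YE torus_pi_displacement size_mkseq -ya iter_rotation.
have intY n : interior (Fi (x n)) (Y n).
  apply: contrapT => nint; apply: (ga n); rewrite -piY.
  exists (pickle (x n, x n)) => //; rewrite pickleK /exceptional_pair eqxx.
  by exists (Y n) => //; split=> //; exact: hidx.
exists y, x; split=> //; split=> [n|n i].
  elim: n => [//|n IH]; rewrite mkseqS -cats1; apply/word_cylinder_cat; split=> //.
  by rewrite -YE; split.
rewrite -iter_rotation ya; split=> [hi|->].
  apply: contrapT => /eqP ixn; apply: (ga n).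
  exists (pickle (i, x n)) => //; rewrite pickleK /exceptional_pair/= (negbTE ixn); split=> //.
  by exists (Y n); [exact: hidx|exact: piY].
by exists (Y n); [exact: hidx|exact: piY].
Qed.

(** Integrating the discrepancy bounds [N |haar Y - kappa|] uniformly in [N], which forces [kappa]
    to be the measure. *)
Lemma discrepancy_bounded_remainder (Y : set (torus R m)) (kappa C : R) :
  measurable Y ->
  {ae haar, forall a, forall N : nat,
    `|(\sum_(n < N) (iter n (rotation t) a \in Y))%N%:R - N%:R * kappa| <= C} ->
  bounded_remainder_set (rotation t) haar Y /\ fine (haar Y) = kappa.
Proof.
move=> mY hY.
have hk : fine (haar Y) = kappa.
  apply/eqP; rewrite -subr_eq0; apply/eqP; apply: (@bounded_multiples_eq0 R _ C) => N.
  (* The extra index [N] carries the constant [- N kappa], attached to the whole space, so that the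
     discrepancy becomes a sum of indicators. *)
  pose A j := if (j < N)%N then iter j (rotation t) @^-1` Y else setT.
  pose c j : R := if (j < N)%N then 1 else - (N%:R * kappa).
  have := @ae_bounded_sum_indic _ _ _ (@haar R m) _ (iota 0 N.+1) c A C.
  have E (f : nat -> R) : \sum_(j <- iota 0 N.+1) f j = \sum_(j < N) f j + f N.
    by rewrite -addn1 iotaD big_cat/= big_seq1 add0n -[N in iota 0 N]subn0 big_mkord.
  rewrite E (eq_bigr (fun=> fine (haar Y))); last first.
    by move=> j _; rewrite /c /A ltn_ord mul1r; congr fine; exact: (haar_iter_rotation t j mY).2.
  rewrite sumr_const card_ord /c /A ltnn.
  rewrite (_ : fine (haar setT) = 1); last first.
    by rewrite -[RHS]/(fine 1%:E); congr fine; exact: probability_setT.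
  rewrite (_ : N%:R * (fine (haar Y) - kappa) = fine (haar Y) *+ N + - (N%:R * kappa) * 1); last first.
    by rewrite -mulr_natl; ring.
  apply.
    by move=> j; rewrite /A; case: ifP => // _; exact: (haar_iter_rotation t j mY).1.
  apply: filterS hY => a /(_ N); rewrite E ltnn indicE in_setT mulr1.
  rewrite natr_sum (eq_bigr (fun j : 'I_N => (iter j (rotation t) a \in Y)%:R))// => hh.
  rewrite (eq_bigr (fun j : 'I_N => (iter j (rotation t) a \in Y)%:R))// => j _.
  by rewrite ltn_ord mul1r indicE; congr (nat_of_bool _)%:R; apply/idP/idP; rewrite !inE.
split=> //; split=> //; exists (`|C| + 1); first by rewrite ltr_wpDl.
apply: filterS hY => a hh N; rewrite hk (le_trans (hh N))// (le_trans (ler_norm C))//.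
by rewrite lerDl.
Qed.

(** Visits to [Y] before time [N] are the occurrences of [v] in the coding word of length
    [N + |v| - 1]; replacing that length by [N] costs at most [kappa |v|]. *)
Lemma coding_bounded_remainder (v : seq 'I_h) (Y : set (torus R m)) (kappa C : R) :
  v != [::] -> 0 <= kappa -> measurable Y ->
  (forall y x, codes y x -> Y (torus_pi y) <-> mkseq x (size v) = v) ->
  (forall s, partition_language Fi ti s ->
     `|(occurrences v s)%:R - kappa * (size s)%:R| <= C) ->
  bounded_remainder_set (rotation t) haar Y /\ fine (haar Y) = kappa.
Proof.
move=> v0 kappa0 mY hY hocc.
apply: (@discrepancy_bounded_remainder Y kappa (`|C| + kappa * (size v)%:R)) => //.
apply: filterS ae_generic => a /generic_codes[y [x [<- cx]]] N.
have E : (\sum_(n < N) (iter n (rotation t) (torus_pi y) \in Y))%N =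
    occurrences v (mkseq x (N + (size v).-1)).
  rewrite occurrences_mkseq//; apply: eq_bigr => n _; congr nat_of_bool.
  rewrite iter_rotation -[X in t *+ X](size_mkseq x n) -torus_pi_displacement.
  have H := hY _ _ (codes_shift n cx).
  by apply/idP/eqP; rewrite inE => /H.
(* The empty word is not in the partition language and is treated apart. *)
rewrite E; have [N0|Npos] := posnP (N + (size v).-1).
  have -> : N = 0%N by lia.
  rewrite (_ : (0 + _)%N = 0%N) /occurrences/=; last by lia.
  by rewrite mul0r subrr normr0 addr_ge0// mulr_ge0.
have : partition_language Fi ti (mkseq x (N + (size v).-1)).
  apply/(partition_languageP Ffd Fb np); split; last by exists y; exact: cx.1.
  by rewrite -size_eq0 size_mkseq -lt0n.
move/hocc; rewrite size_mkseq natrD mulrDr => hh.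
rewrite (_ : _ - _ = ((occurrences v (mkseq x (N + (size v).-1)))%:R - (kappa * N%:R + kappa * ((size v).-1)%:R)) + kappa * ((size v).-1)%:R); last by ring.
rewrite (le_trans (ler_normD _ _))// lerD//; first by rewrite (le_trans hh)// ler_norm.
by rewrite ger0_norm ?mulr_ge0// ler_wpM2l// ler_nat leq_pred.
Qed.

End codings.

(** * The lattice of displacements and rational independence *)

Lemma closed_int (R : realType) : closed [set r : R | r \is a Num.int].
Proof.
rewrite -openC (_ : ~` _ = \bigcup_(n in [set: int]) `]n%:~R, (n + 1)%:~R[%classic).
  by apply: bigcup_open => n _; exact: interval_open.
apply/seteqP; split=> r.
  move=> /= hr; exists (Num.floor r) => //=; rewrite in_itv/= lt_neqAle.
  have /andP[h1 h2] := floor_itv r; rewrite h1 h2 !andbT.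
  by apply/eqP => e; apply: hr; rewrite intrEfloor e.
move=> [n _] /=; rewrite in_itv/= => /andP[h1 h2] /intrP[k rk]; move: h1 h2.
by rewrite rk !ltr_int ltzD1 ltNge => /negP.
Qed.

Lemma common_denominator (I : finType) (q : I -> rat) :
  exists (D : int) (p : I -> int), D != 0 /\ forall i, q i * D%:~R = (p i)%:~R.
Proof.
exists (\prod_i denq (q i)), (fun i => numq (q i) * \prod_(j | j != i) denq (q j)).
split; first by apply/prodf_neq0 => i _; exact: denq_neq0.
move=> i; rewrite (bigD1 i)//= !rmorphM/= mulrA; congr (_ * _).
by rewrite -{1}(divq_num_den (q i)) divfK// intr_eq0 denq_neq0.
Qed.

Lemma minimal_orbit_dense (R : realType) (m : nat) (t y0 x : 'cV[R]_m) (e : R) :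
  minimal_map (rotation t) -> 0 < e ->
  exists n z, Zvec z /\ `|y0 + t *+ n + z - x| < e.
Proof.
move=> tmin e0.
pose U := torus_pi @` ball x e.
have oU : open U.
  suff : open (torus_pi @^-1` U) by [].
  rewrite preimage_image_torus_pi periodizeE; apply: bigcup_open => k _.
  case: pickle_inv => [v|]; last exact: open0.
  by apply: open_comp; [move=> ? _; exact: translate_continuous|exact: ball_open].
have : closure [set iter n (rotation t) (torus_pi y0) | n in [set: nat]] (torus_pi x).
  by rewrite tmin.
move=> /(_ U) []; first by apply: open_nbhs_nbhs; split=> //; exists x => //; exact: ballxx.
move=> _ [[n _ <-]]; rewrite iter_rotation => -[y xy /torus_piP hz].
exists n, (y - (y0 + t *+ n)); split=> //.
by rewrite [_ + (y - _)]addrC subrK distrC; move: xy; rewrite -ball_normE.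
Qed.

(** A nonzero functional of this kind would be integer valued on the orbit of 0 and its integer
    translates, hence everywhere by density and continuity; but at [x0] it takes the value [1/2]. *)
Lemma minimal_int_independent (R : realType) (m : nat) (t : 'cV[R]_m) (q : 'I_m -> int) :
  minimal_map (rotation t) ->
  \sum_k (q k)%:~R * t k 0 \is a Num.int -> forall k, q k = 0.
Proof.
move=> tmin qt k0; apply/eqP; apply: contraT => qk0.
pose f (x : 'cV[R]_m) := \sum_k (q k)%:~R * x k 0.
have fZ z : Zvec z -> f z \is a Num.int.
  by move=> hz; apply: rpred_sum => k _; rewrite rpredM ?intr_int ?hz.
have fD x y : f (x + y) = f x + f y.
  by rewrite /f -big_split; apply: eq_bigr => k _; rewrite mxE mulrDr.
have ft n : f (t *+ n) \is a Num.int.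
  elim: n => [|n IH]; first by apply: fZ; rewrite mulr0n; exact: Zvec0.
  by rewrite mulrSr fD rpredD.
have fc : continuous f.
  rewrite (_ : f = fun x => (((\row_k (q k)%:~R : 'rV[R]_m) *m x : 'cV[R]_1) 0 0)).
    by move=> x; apply: (@continuous_comp _ _ _ (fun x => (\row_k (q k)%:~R : 'rV[R]_m) *m x) (fun A : 'cV[R]_1 => A 0 0)); [exact: mulmx_continuous|exact: coord_continuous].
  by apply/funext => x; rewrite mxE; apply: eq_bigr => k _; rewrite mxE.
pose x0 : 'cV[R]_m := \col_k (if k == k0 then (2 * (q k0)%:~R)^-1 else 0).
have fx0 : f x0 = 2^-1.
  rewrite /f (bigD1 k0)//= big1; last by move=> k /negbTE kk; rewrite mxE kk mulr0.
  by rewrite mxE eqxx addr0 invfM mulrCA mulfV ?mulr1// intr_eq0.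
have cS : closed (f @^-1` [set r : R | r \is a Num.int]).
  by apply: preimage_closed; [move=> ? _; exact: fc|exact: closed_int].
have /= : (f @^-1` [set r : R | r \is a Num.int]) x0.
  apply: cS => B /nbhs_ballP[e /= e0 eB].
  have [n [z [hz hn]]] := minimal_orbit_dense 0 x0 tmin e0.
  exists (t *+ n + z); split; first by rewrite /= fD rpredD// fZ.
  by apply: eB; rewrite -ball_normE/= distrC; rewrite add0r in hn.
rewrite fx0 => /intrP[k hk].
have : (2 * k)%:~R = 1%:~R :> R by rewrite rmorphM/= -hk mulfV.
by move/intr_inj => /eqP; lia.
Qed.

Lemma minimal_rat_independent (R : realType) (m : nat) (t : 'cV[R]_m) (q : 'I_m -> rat) (r : rat) :
  minimal_map (rotation t) ->
  \sum_k ratr (q k) * t k 0 = ratr r -> forall k, q k = 0.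
Proof.
move=> tmin qt k.
have [D [p [D0 hp]]] := common_denominator (fun o : option 'I_m => if o is Some k then q k else r).
suff hpk : p (Some k) = 0.
  by have := hp (Some k); rewrite hpk => /eqP; rewrite mulf_eq0 intr_eq0 (negbTE D0) orbF => /eqP.
apply: (@minimal_int_independent R m t (fun k => p (Some k)) tmin _ k).
rewrite (_ : \sum__ _ = (p None)%:~R) ?intr_int//.
have h o : (p o)%:~R = ratr ((if o is Some k then q k else r) * D%:~R) :> R by rewrite hp ratr_int.
rewrite (h None) rmorphM/= -qt mulr_suml; apply: eq_bigr => k' _.
by rewrite (h (Some k')) rmorphM/= mulrAC.
Qed.

Section abelianization.
Variables (R : realType) (d : nat).
Implicit Types w : seq 'I_d.

Lemma abelianization_nil : abelianization R ([::] : seq 'I_d) = 0.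
Proof. by apply/colP => i; rewrite !mxE. Qed.

Lemma abelianization_cat w1 w2 :
  abelianization R (w1 ++ w2) = abelianization R w1 + abelianization R w2.
Proof. by apply/colP => i; rewrite !mxE count_cat natrD. Qed.

Lemma abelianization_cons a w :
  abelianization R (a :: w) = delta_mx a 0 + abelianization R w.
Proof. by apply/colP => i; rewrite !mxE /= natrD eq_sym andbT. Qed.

Lemma sum_abelianization w : \sum_i abelianization R w i 0 = (size w)%:R.
Proof.
elim: w => [|a w IH]; first by rewrite big1// => i _; rewrite mxE.
rewrite abelianization_cons /= -[(size w).+1]add1n natrD -IH.
under eq_bigr do rewrite mxE.
rewrite big_split/=; congr (_ + _); rewrite (bigD1 a)//= mxE !eqxx big1 ?addr0//.
by move=> i /negbTE ia; rewrite mxE ia.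
Qed.

Lemma abelianization_le w : `|abelianization R w| <= (size w)%:R.
Proof.
apply/cV_normP => // i; rewrite mxE ger0_norm// ler_nat count_size//.
Qed.

End abelianization.

Lemma sum_ord_max (V : nmodType) m (f : 'I_m.+1 -> V) :
  \sum_i f i = f ord_max + \sum_(i < m) f (lift ord_max i).
Proof. exact: (bigD1_ord ord_max). Qed.

Lemma drop_lastE (R : realType) m (x : 'cV[R]_m.+1) i : drop_last x i 0 = x (lift ord_max i) 0.
Proof. by rewrite mxE. Qed.

Section lattice.
Variables (R : realType) (m : nat).
Variables (t : 'cV[R]_m) (F : set 'cV[R]_m) (Fi : 'I_m.+1 -> set 'cV[R]_m).
Variable ti : 'I_m.+1 -> 'cV[R]_m.

Definition freq : 'cV[R]_m.+1 := \col_i fine (lebesgueV (Fi i)).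

Definition translation_mx : 'M[R]_(m, m.+1) := \matrix_(k, i) ti i k 0.

Definition lattice_mx : 'M[R]_m := \matrix_(k, i) (ti ord_max - ti (lift ord_max i)) k 0.

(** The inverse of [translation_mx] on the hyperplane of coordinate sum 0: the entries other than
    the last are those of [- N^-1 y], and the last one makes the sum vanish. *)
Definition section_mx : 'M[R]_(m.+1, m) :=
  \matrix_(i, k) if unlift ord_max i is Some j then - (invmx lattice_mx) j k
                 else \sum_j (invmx lattice_mx) j k.

Local Notation T := translation_mx.
Local Notation N := lattice_mx.

Lemma translation_mxE (x : 'cV[R]_m.+1) :
  T *m x = (\sum_i x i 0) *: ti ord_max - N *m drop_last x.
Proof.
apply/colP => k; rewrite !mxE [LHS]sum_ord_max [T k ord_max]mxE.
rewrite (sum_ord_max (fun i => x i 0)) mulrDl [ti _ _ _ * _]mulrC -addrA; congr (_ + _).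
by rewrite mulr_suml -sumrB; apply: eq_bigr => i _; rewrite !mxE; ring.
Qed.

Lemma translation_mx_abelianization w : T *m abelianization R w = displacement ti w.
Proof.
elim: w => [|a w IH]; first by rewrite abelianization_nil mulmx0 /displacement big_nil.
rewrite abelianization_cons mulmxDr IH displacement_cons; congr (_ + _).
apply/colP => k; rewrite mxE (bigD1 a)//= !mxE !eqxx mulr1 big1 ?addr0//.
by move=> i /negbTE ia; rewrite !mxE ia mulr0.
Qed.

Hypotheses (Ffd : fundamental_domain F) (Fb : bounded_set F).
Hypothesis np : natural_partition t F Fi ti.

Lemma sum_freq : \sum_i freq i 0 = 1.
Proof. by rewrite -(sum_atom_measure Ffd Fb np); apply: eq_bigr => i _; rewrite mxE. Qed.

Lemma word_cylinder_ends w y : w != [::] -> word_cylinder Fi ti w y ->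
  F y /\ F (y + displacement ti w).
Proof.
case: w => // a w _ h; split.
  by case: h => /interior_subset h _; exact: (atom_sub np h).
move: h; rewrite lastI -cats1 => /word_cylinder_cat[_ [/interior_subset h _]].
by rewrite displacement_cat addrA /displacement big_seq1; exact: (atom_step np).
Qed.

Lemma displacement_bounded : exists2 C : R, 0 < C &
  forall w y, word_cylinder Fi ti w y -> `|displacement ti w| <= C.
Proof.
have [M M0 hM] := (bounded_setP F).1 Fb; exists (M + M); first by rewrite addr_gt0.
move=> w y; have [->|w0 /(word_cylinder_ends w0)[h1 h2]] := eqVneq w [::].
  by rewrite /displacement big_nil normr0 => _; rewrite addr_ge0// ltW.
rewrite (_ : displacement ti w = (y + displacement ti w) - y); last by rewrite addrC addKr.
by rewrite (le_trans (ler_normB _ _))// lerD// hM.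
Qed.

Lemma exists_coding : exists y x, codes t Fi ti y x.
Proof.
have [Nn [mN N0 hN]] := ae_generic Ffd Fb np.
have [a na] : exists a, ~ Nn a.
  apply: contrapT => h; have NT : Nn = setT.
    by apply/seteqP; split=> // x _; apply: contrapT => nx; apply: h; exists x.
  by have : (0 < haar Nn)%E; [rewrite NT [ltRHS]probability_setT|rewrite [ltRHS]N0 ltxx].
have ga : generic t Fi a by apply: contrapT => h; apply: na; exact: hN.
by have [y [x [_ cx]]] := generic_codes Ffd np ga; exists y, x.
Qed.

Lemma translation_mx_freq : T *m freq = 0.
Proof.
apply/colP => k; rewrite mxE [RHS]mxE.
have [C C0 hC] := displacement_bounded.
apply: (@bounded_multiples_eq0 R _ C) => n.
(* The indices are pairs of a time and a letter; on a coded orbit exactly one letter contributes at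
   each time, and the sum is a coordinate of the displacement after [n] steps. *)
pose s := [seq (j, i) | j <- iota 0 n, i <- enum 'I_m.+1].
pose A (p : nat * 'I_m.+1) := iter p.1 (rotation t) @^-1` (torus_pi @` Fi p.2).
have mpi i : measurable (torus_pi @` Fi i).
  by apply: measurable_image_torus_pi; exact: (atom_measurable np).
have sE (f : nat * 'I_m.+1 -> R) : \sum_(p <- s) f p = \sum_(j < n) \sum_i f (nat_of_ord j, i).
  rewrite big_allpairs/= -[n in iota 0 n]subn0 big_mkord; apply: eq_bigr => j _.
  by rewrite big_enum.
have := @ae_bounded_sum_indic _ _ _ (@haar R m) _ s (fun p => ti p.2 k 0) A C.
rewrite !sE (eq_bigr (fun=> \sum_i T k i * freq i 0)); last first.
  move=> j _; apply: eq_bigr => i _ /=; rewrite !mxE; congr (_ * fine _).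
  by rewrite -(haar_atom Ffd Fb np); exact: (haar_iter_rotation t j (mpi i)).2.
rewrite sumr_const card_ord => H; rewrite mulr_natl; apply: H.
  by move=> [j i]; exact: (haar_iter_rotation t j (mpi i)).1.
apply: filterS (ae_generic Ffd Fb np) => a /(generic_codes Ffd np)[y [x [<- [c1 c2]]]].
rewrite sE; apply: le_trans (hC _ _ (c1 n)).
apply: le_trans (cV_coord_le _ k); rewrite le_eqVlt; apply/orP; left; apply/eqP; congr `|_|.
rewrite /displacement /mkseq big_map -[n in iota 0 n]subn0 big_mkord summxE.
apply: eq_bigr => j _; rewrite (bigD1 (x j))//= indicE mem_set ?mulr1; last first.
  by rewrite /A/= iter_rotation; apply/c2.
rewrite big1 ?addr0// => i /eqP ix; rewrite indicE memNset ?mulr0//.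
by rewrite /A/= iter_rotation => /c2.
Qed.

Lemma lattice_mx_freq : N *m drop_last freq = ti ord_max.
Proof.
have := translation_mx_freq; rewrite translation_mxE sum_freq scale1r => /eqP.
by rewrite subr_eq0 => /eqP.
Qed.

Lemma lattice_mx_int k i : N k i \is a Num.int.
Proof.
rewrite !mxE (_ : _ - _ = (ti ord_max - t) k 0 - (ti (lift ord_max i) - t) k 0); last by rewrite !mxE; ring.
by rewrite rpredB// (ti_cong np).
Qed.

Hypothesis tmin : minimal_map (rotation t).

Let Nq : 'M[rat]_m := \matrix_(k, i) (Num.floor (N k i))%:~R.

Let NqE : N = map_mx ratr Nq.
Proof.
apply/matrixP => k i; rewrite [RHS]mxE [in RHS]mxE ratr_int.
by apply/esym/eqP; rewrite -intrEfloor lattice_mx_int.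
Qed.

(** [ti ord_max] differs from [t] by an integer vector, so the rational independence of 1 and the
    coordinates of [t] passes to it. *)
Let last_independent (v : 'rV[rat]_m) (r : rat) :
  (map_mx ratr v *m ti ord_max) 0 0 = ratr r :> R -> v = 0.
Proof.
move=> h; apply/rowP => k; rewrite [RHS]mxE.
pose z k := Num.floor ((ti ord_max - t) k 0).
have zE k' : (ti ord_max) k' 0 = t k' 0 + (z k')%:~R.
  have := ti_cong np ord_max k'; rewrite intrEfloor => /eqP; rewrite /z => ->; rewrite !mxE; ring.
apply: (@minimal_rat_independent R m t (fun k => v 0 k) (r - \sum_k v 0 k * (z k)%:~R) tmin).
rewrite rmorphB/= -h mxE rmorph_sum/= -sumrB; apply: eq_bigr => k' _.
by rewrite !mxE rmorphM/= ratr_int zE; ring.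
Qed.

(** A singular integer matrix has a nonzero rational row [v] in its left kernel, and
    [v t_max = v N u' = 0] contradicts the independence. *)
Lemma lattice_mx_unit : N \in unitmx.
Proof.
rewrite NqE map_unitmx -row_free_unit -kermx_eq0; apply: contraT => /rowV0Pn[v /sub_kermxP hv v0].
have v00 : v = 0.
  apply: (@last_independent v 0); rewrite -lattice_mx_freq mulmxA NqE -map_mxM/= hv.
  by rewrite map_mx0 mul0mx mxE rmorph0.
by rewrite v00 eqxx in v0.
Qed.

(** As the frequencies sum to 1, a relation between them yields a rational row [p] with [p u']
    rational. Writing [p = r N] makes [r t_max] rational, so [r = 0]. *)
Lemma freq_independent (q : 'I_m.+1 -> rat) :
  \sum_i ratr (q i) * freq i 0 = 0 -> forall i, q i = 0.
Proof.
move=> h.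
pose p : 'rV[rat]_m := \row_i (q (lift ord_max i) - q ord_max).
have pu : (map_mx ratr p *m drop_last freq) 0 0 = - ratr (q ord_max) :> R.
  have := h; rewrite sum_ord_max => /eqP; rewrite addrC addr_eq0 => /eqP h1.
  have h2 : freq ord_max 0 = 1 - \sum_i drop_last freq i 0.
    have := sum_freq; rewrite sum_ord_max => <-.
    rewrite [X in _ = _ - X](eq_bigr (fun i => freq (lift ord_max i) 0)); first by rewrite addrK.
    by move=> i _; rewrite drop_lastE.
  rewrite mxE (eq_bigr (fun i => ratr (q (lift ord_max i)) * freq (lift ord_max i) 0 - ratr (q ord_max) * drop_last freq i 0)).
    by rewrite sumrB h1 h2 -mulr_sumr; ring.
  by move=> i _; rewrite drop_lastE !mxE rmorphB/=; ring.
have NqU : Nq \in unitmx by have := lattice_mx_unit; rewrite NqE map_unitmx.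
have p0 : p = 0.
  have r0 : p *m invmx Nq = 0.
    apply: (@last_independent _ (- q ord_max)).
    by rewrite -lattice_mx_freq mulmxA NqE -map_mxM/= mulmxKV// pu rmorphN.
  by rewrite -(mulmxKV NqU p) r0 mul0mx.
have ql : q ord_max = 0.
  move: pu; rewrite p0 map_mx0 mul0mx mxE => /esym/eqP; rewrite oppr_eq0.
  by rewrite -(rmorph0 (@ratr R)) => /eqP/fmorph_inj.
move=> i; case: (unliftP ord_max i) => [j ->|->] //.
by have /rowP/(_ j) := p0; rewrite !mxE ql subr0.
Qed.

Lemma sum_section_mx (y : 'cV[R]_m) : \sum_i (section_mx *m y) i 0 = 0.
Proof.
rewrite sum_ord_max mxE (eq_bigr (fun k => (\sum_j invmx N j k) * y k 0)); last first.
  by move=> k _; rewrite mxE unlift_none.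
rewrite [X in _ + X](eq_bigr (fun i => - (invmx N *m y) i 0)); last first.
  by move=> i _; rewrite !mxE -sumrN; apply: eq_bigr => k _; rewrite mxE liftK mulNr.
rewrite sumrN; apply/eqP; rewrite subr_eq0; apply/eqP.
under [RHS]eq_bigr do rewrite mxE.
by rewrite exchange_big/=; apply: eq_bigr => k _; rewrite mulr_suml.
Qed.

Lemma drop_last_section_mx (y : 'cV[R]_m) : drop_last (section_mx *m y) = - (invmx N *m y).
Proof.
apply/colP => i; rewrite drop_lastE !mxE -sumrN; apply: eq_bigr => k _.
by rewrite mxE liftK mulNr.
Qed.

Lemma translation_section (y : 'cV[R]_m) : T *m (section_mx *m y) = y.
Proof.
rewrite translation_mxE sum_section_mx scale0r add0r drop_last_section_mx mulmxN opprK.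
by rewrite mulKVmx// lattice_mx_unit.
Qed.

Lemma sum_zero_section (z : 'cV[R]_m.+1) : \sum_i z i 0 = 0 -> z = section_mx *m (T *m z).
Proof.
move=> z0; have d : drop_last z = drop_last (section_mx *m (T *m z)).
  rewrite drop_last_section_mx translation_mxE z0 scale0r add0r mulmxN opprK.
  by rewrite mulKmx// lattice_mx_unit.
have dE i : z (lift ord_max i) 0 = (section_mx *m (T *m z)) (lift ord_max i) 0.
  by rewrite -!drop_lastE d.
apply/colP => i; case: (unliftP ord_max i) => [j ->|->]; first exact: dE.
have := z0; have := sum_section_mx (T *m z); rewrite !sum_ord_max.
under eq_bigr do rewrite -dE.
by move=> h1 h2; apply: (addIr (\sum_(i < m) z (lift ord_max i) 0)); rewrite h1 h2.
Qed.

(** The left side is the projection along the frequencies, whose sum is 1. It depends on a word only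
    through its displacement, which ties balance and Rauzy fractals to the geometry of [F]. *)
Lemma proj_along_section (x : 'cV[R]_m.+1) :
  x - (\sum_i x i 0) *: freq = section_mx *m (T *m x).
Proof.
rewrite [LHS]sum_zero_section.
  by rewrite mulmxBr -scalemxAr translation_mx_freq scaler0 subr0.
rewrite (eq_bigr (fun i => x i 0 - (\sum_j x j 0) * freq i 0)); last first.
  by move=> i _; rewrite !mxE.
by rewrite sumrB -mulr_sumr sum_freq mulr1 subrr.
Qed.

Lemma language_balanced : exists2 C : R, 0 < C & forall w y,
  word_cylinder Fi ti w y -> `|abelianization R w - (size w)%:R *: freq| <= C.
Proof.
have [C C0 hC] := displacement_bounded.
have [K K0 hK] := mulmx_norm_bound section_mx.
exists (K * C); first by rewrite mulr_gt0.
move=> w y wy; rewrite -sum_abelianization proj_along_section translation_mx_abelianization.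
by rewrite (le_trans (hK _))// ler_wpM2l ?(ltW K0)// (hC _ _ wy).
Qed.

Lemma atom_bounded_remainder i :
  bounded_remainder_set (rotation t) haar (torus_pi @` Fi i).
Proof.
have [C C0 hC] := language_balanced.
have mpi : measurable (torus_pi @` Fi i).
  by apply: measurable_image_torus_pi; exact: (atom_measurable np).
have := @coding_bounded_remainder R m _ t F Fi ti Ffd Fb np [:: i] (torus_pi @` Fi i) (freq i 0) C.
case=> //.
- by rewrite mxE fine_ge0// measure_ge0.
- move=> y x [_ /(_ 0%N i)]; rewrite mulr0n addr0 /mkseq/= => ->.
  by split=> [->//|[]].
- move=> s /(partition_languageP Ffd Fb np)[_ [y /hC hs]].
  have := le_trans (cV_coord_le _ i) hs; rewrite !mxE mulrC.
  by rewrite occurrences_letter.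
Qed.

End lattice.

(** * Charts of the fundamental domain *)

Lemma open_subset_interior (T : topologicalType) (U A : set T) :
  open U -> U `<=` A -> U `<=` interior A.
Proof. by move=> oU UA x Ux; apply: (filterS UA); exact: open_nbhs_nbhs. Qed.

Lemma finite_common_eps (R : realType) (I : finType) (P : I -> R -> Prop) :
  (forall i (e e' : R), P i e -> 0 < e' -> e' <= e -> P i e') ->
  (forall i, exists2 e : R, 0 < e & P i e) -> exists2 e : R, 0 < e & forall i, P i e.
Proof.
move=> mono /(_ _)/cid2 h; pose f i := s2val (h i).
have f0 i : 0 < f i by exact: s2valP (h i).
have fP i : P i (f i) by exact: s2valP' (h i).
exists (\big[Num.min/1]_i f i).
  by elim/big_ind: _ => // x y x0 y0; rewrite lt_min x0.
move=> i; apply: mono (fP i) _ _; last exact: bigmin_le.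
by elim/big_ind: _ => // x y x0 y0; rewrite lt_min x0.
Qed.

Lemma absz_shift_lt (q : int) (b : nat) :
  `|q| <= b%:Z -> (absz (q + b%:Z)%R < (2 * b).+1)%N.
Proof. lia. Qed.

Lemma absz_shift_natr (R : realType) (q : int) (b : nat) :
  `|q| <= b%:Z -> (absz (q + b%:Z)%R)%:R - b%:R = q%:~R :> R.
Proof.
move=> h; rewrite natr_absz ger0_norm; last by lia.
by rewrite intrD addrK.
Qed.

Section chart.
Variables (R : realType) (m : nat).
Variables (t : 'cV[R]_m) (F : set 'cV[R]_m) (Fi : 'I_m.+1 -> set 'cV[R]_m).
Variable ti : 'I_m.+1 -> 'cV[R]_m.
Hypotheses (Ffd : fundamental_domain F) (Fb : bounded_set F).
Hypothesis np : natural_partition t F Fi ti.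
Hypothesis tmin : minimal_map (rotation t).

Local Notation N := (lattice_mx ti).
Local Notation T := (translation_mx ti).
Local Notation u := (freq Fi).

Let iN k i : N k i \is a Num.int. Proof. exact: (lattice_mx_int np). Qed.
Let uN : N \in unitmx. Proof. exact: (lattice_mx_unit Ffd Fb np tmin). Qed.

(* The points of the coded orbit of y lie in F and are y + n t_max modulo N Z^m;
   with Q = |det N|, Q Z^m lies in N Z^m, so density of (n t) modulo Z^m gives
   density of F + N Z^m. *)
Lemma lattice_approx p e : 0 < e -> exists f z, F f /\ Zvec z /\ `|f + N *m z - p| < e.
Proof.
move=> e0; have [y [x [cx _]]] := exists_coding Ffd Fb np.
pose Nz : 'M[int]_m := \matrix_(k, i) Num.floor (N k i).
have NzE : N = map_mx intr Nz.
  by apply/matrixP => k i; rewrite [RHS]mxE [in RHS]mxE; apply/esym/eqP; rewrite -intrEfloor; exact: iN.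
have detN : \det N \is a Num.int by rewrite NzE det_map_mx intr_int.
pose Q := `|Num.floor (\det N)|%N.
have det0 : \det N != 0 by rewrite -unitfE -unitmxE.
have Q0 : (0 < Q)%N.
  rewrite absz_gt0; apply/eqP => h; move: det0.
  by have := detN; rewrite intrEfloor h => /eqP <-; rewrite eqxx.
have iadj i j : \adj N i j \is a Num.int.
  by rewrite NzE -map_mx_adj mxE intr_int.
(* By Cramer's rule [N] maps [adj N z] to [det N z]; the sign of the determinant turns this into
   [Q z]. *)
have lat z : Zvec z -> exists2 z', Zvec z' & Q%:R *: z = N *m z'.
  move=> hz; exists (Num.sg (\det N) *: (\adj N *m z)).
    move=> i; rewrite mxE rpredM//; last by apply: Zvec_mulmx.
    by case: sgrP => _; rewrite ?rpred0 ?rpred1 ?rpredN ?rpred1.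
  rewrite -scalemxAr mulmxA mul_mx_adj mul_scalar_mx scalerA; congr (_ *: _).
  rewrite -normrEsg; have := detN; rewrite intrEfloor => /eqP <-.
  by rewrite -intr_norm -abszE.
have Qp : 0 < Q%:R :> R by rewrite ltr0n.
have [n [z [hz hn]]] := minimal_orbit_dense 0 (Q%:R^-1 *: (p - y)) tmin (divr_gt0 e0 Qp).
pose k := (Q * n)%N; pose w := mkseq x k.
have Fy : F (y + displacement ti w).
  have := cx k.+1; rewrite mkseqS -cats1 => /word_cylinder_cat[_ [/interior_subset h _]].
  exact: (atom_sub np h).
have [z1 hz1 e1] : exists2 z', Zvec z' & Q%:R *: (z - (ti ord_max - t) *+ n) = N *m z'.
  apply: lat; apply: ZvecB => //; elim: n {hn k w Fy} => [|n IH]; first exact: Zvec0.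
  by rewrite mulrS; apply: ZvecD => //; exact: (ti_cong np).
(* The displacement of [w] is [|w| t_max] minus [N] times the counts of the letters other than the
   last; adding these counts to the lattice vector cancels that term. *)
exists (y + displacement ti w), (z1 + drop_last (abelianization R w)); split=> //; split.
  by apply: ZvecD => // i; rewrite drop_lastE mxE; exact: natr_int.
rewrite mulmxDr -e1 -translation_mx_abelianization translation_mxE sum_abelianization size_mkseq.
rewrite (_ : _ - p = Q%:R *: (0 + t *+ n + z - Q%:R^-1 *: (p - y))).
  by rewrite normrZ ger0_norm ?(ltW Qp)// mulrC -ltr_pdivlMr.
have Qn0 : Q%:R != 0 :> R by rewrite gt_eqF.
rewrite /k natrM -[t *+ n]scaler_nat -[(_ - t) *+ n]scaler_nat.
set D := N *m drop_last (abelianization R w); move: D => D.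
by apply/colP => i; rewrite !mxE; field.
Qed.

(** Only finitely many of the closed sets [F + N z] come near [p]. If none contained [p], they would
    stay at a common positive distance from it, against [lattice_approx]. *)
Lemma lattice_cover p : exists f z, F f /\ Zvec z /\ p = f + N *m z.
Proof.
apply: contrapT => h0.
have nF z : Zvec z -> ~ F (p - N *m z).
  by move=> hz Fz; apply: h0; exists (p - N *m z), z; rewrite subrK.
have [M M0 hM] := (bounded_setP F).1 Fb.
pose b := Num.bound (`|p| + 1 + M).
(* [g] enumerates the integer vectors with entries between [-b] and [b]; by the choice of [b] these
   include [N z] whenever [f + N z] is within 1 of [p] for some [f] in [F]. *)
pose g (v : 'cV['I_(2 * b).+1]_m) : 'cV[R]_m := \col_i ((v i 0)%:R - b%:R).
have [e e0 he] : exists2 e : R, 0 < e & forall v, (forall z, Zvec z -> g v = N *m z ->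
    forall f, F f -> e <= `|p - g v - f|).
  apply: finite_common_eps.
    by move=> v e e' h e'0 e'e z hz gz f Ff; rewrite (le_trans e'e)//; exact: (h z).
  move=> v; have [[z [hz gz]]|nz] := pselect (exists z, Zvec z /\ g v = N *m z); last first.
    by exists 1 => // z hz gz; case: nz; exists z.
  have oF : open (~` F) by rewrite openC; exact: (domain_closed np).
  have : nbhs (p - g v) (~` F).
    by apply: open_nbhs_nbhs; split=> //; rewrite gz; exact: nF.
  move=> /nbhs_ballP[e /= e0 eB]; exists e => // _ _ _ f Ff; rewrite leNgt; apply/negP => hf.
  by apply: (eB f) => //; rewrite -ball_normE.
have e1 : 0 < Num.min e 1 by rewrite lt_min e0 ltr01.
have [f [z [Ff [hz hfz]]]] := lattice_approx p e1.
have Nz : Zvec (N *m z) by exact: Zvec_mulmx.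
have Nzb i : `|(N *m z) i 0| <= b%:R.
  apply: le_trans (cV_coord_le _ i) _.
  rewrite (_ : N *m z = (f + N *m z - p) + p - f); last by rewrite subrK addrC addKr.
  apply: le_trans (_ : `|p| + 1 + M <= _); last first.
    by apply/ltW/archi_boundP; rewrite !addr_ge0// ltW.
  rewrite (le_trans (ler_normB _ _))// lerD ?hM// (le_trans (ler_normD _ _))// addrC lerD2l.
  by rewrite ltW// (lt_le_trans hfz)// ge_min lexx orbT.
have bnd i : (absz (Num.floor ((N *m z) i 0) + b%:Z)%R < (2 * b).+1)%N.
  have := Nzb i; have := Nz i; rewrite intrEfloor => /eqP {1}<-.
  by rewrite -intr_norm -[b%:R]/(b%:~R) ler_int; exact: absz_shift_lt.
pose v : 'cV['I_(2 * b).+1]_m := \col_i Ordinal (bnd i).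
have gv : g v = N *m z.
  apply/colP => i; rewrite 2!mxE /=.
  have := Nzb i; have := Nz i; rewrite intrEfloor => /eqP e2; rewrite -{1}e2.
  rewrite -intr_norm -[b%:R]/(b%:~R) ler_int => hb.
  by rewrite -[RHS]e2; exact: absz_shift_natr.
have := he v z hz gv f Ff; rewrite gv leNgt => /negP; apply.
rewrite (_ : p - N *m z - f = - (f + N *m z - p)); last first.
  by rewrite opprB opprD addrA [RHS]addrAC.
by rewrite normrN (lt_le_trans hfz)// ge_min lexx.
Qed.

(** For an interior point [y0] of an atom and an integer vector [g], write [y0 + g = f + N z] with
    [f] in [F]. Then [f] is an integer translate of [y0], hence equal to it, and [g = N z]. *)
Lemma lattice_inv_int i j : (invmx N) i j \is a Num.int.
Proof.
suff h g : Zvec g -> Zvec (invmx N *m g).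
  have := h (delta_mx j 0) _ i; rewrite -colE mxE; apply.
  by move=> k; rewrite mxE; case: (_ && _).
move=> hg; have [i0 [y0 iy0]] : exists i, interior (Fi i) !=set0.
  by have [y [x [/(_ 1%N)[h _] _]]] := exists_coding Ffd Fb np; exists (x 0%N), y.
have [f [z [Ff [hz e]]]] := lattice_cover (y0 + g).
have [k fk] := atom_exists np Ff.
have hz' : Zvec (N *m z - g) by apply: ZvecB => //; exact: Zvec_mulmx.
have d := @interior_atom_disjoint R m _ t F Fi ti Ffd Fb np i0 k y0 (N *m z - g) hz' iy0.
have /d[_ /eqP] : Fi k (y0 - (N *m z - g)) by rewrite opprB addrA e addrK.
by rewrite subr_eq0 => /eqP <-; rewrite mulKmx.
Qed.

Variable b : 'cV[R]_m.

Definition chart (x : 'cV[R]_m) : 'cV[R]_m := N *m x + b.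
Definition chart_inv (y : 'cV[R]_m) : 'cV[R]_m := invmx N *m (y - b).

Lemma chartK : cancel chart chart_inv.
Proof. by move=> x; rewrite /chart /chart_inv addrK mulKmx. Qed.

Lemma chart_invK : cancel chart_inv chart.
Proof. by move=> x; rewrite /chart /chart_inv mulKVmx// subrK. Qed.

Lemma chart_continuous : continuous chart. Proof. exact: affine_continuous. Qed.

Lemma chart_inv_continuous : continuous chart_inv.
Proof.
rewrite (_ : chart_inv = fun y => invmx N *m y + invmx N *m (- b)).
  exact: affine_continuous.
by apply/funext => y; rewrite /chart_inv mulmxDr.
Qed.

Lemma chart_interior A : interior (chart @^-1` A) = chart @^-1` interior A.
Proof.
apply/seteqP; split=> x.
  move=> hx; have : interior A (chart x); last by [].
  have : (chart_inv @^-1` interior (chart @^-1` A)) (chart x) by rewrite /= chartK.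
  apply: (@open_subset_interior _ (chart_inv @^-1` interior (chart @^-1` A))).
    by apply: open_comp; [move=> ? _; exact: chart_inv_continuous|exact: open_interior].
  by move=> y /interior_subset; rewrite /= chart_invK.
move: x; apply: open_subset_interior; last by move=> x /interior_subset.
by apply: open_comp; [move=> ? _; exact: chart_continuous|exact: open_interior].
Qed.

Lemma chart_closure A : closure (chart @^-1` A) = chart @^-1` closure A.
Proof.
have cE (B : set 'cV[R]_m) : closure B = ~` interior (~` B) by rewrite interiorC setCK.
have h : interior (~` (chart @^-1` A)) = chart @^-1` interior (~` A) := chart_interior (~` A).
by rewrite cE h [in RHS]cE.
Qed.

Lemma chart_measure S : measurable S -> lebesgueV (chart @^-1` S) = lebesgueV S.
Proof.
move=> mS; rewrite -[RHS](lebesgueV_translate b)//.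
rewrite -[RHS](@lebesgueV_unimodular R m N (invmx N))//.
- exact: lattice_inv_int.
- by rewrite mulmxV.
- by rewrite mulVmx.
- exact: measurable_translate_preimage.
Qed.

Lemma chart_measurable S : measurable S -> measurable (chart @^-1` S).
Proof.
move=> mS; have := measurable_mulmx N measurableT (measurable_translate_preimage b mS).
by rewrite setTI.
Qed.

Definition chart_translation i : 'cV[R]_m := invmx N *m ti i.
Local Notation Fi' := (fun i => chart @^-1` Fi i).
Local Notation ti' := chart_translation.

(** This is [proj_along_section] at a unit vector; it makes all the new translations congruent to
    [u'] modulo integers. *)
Lemma chart_translationE i : ti' i = drop_last u - drop_last (delta_mx i 0).
Proof.
have := proj_along_section Ffd Fb np tmin (delta_mx i 0).
have -> : \sum_j (delta_mx i 0 : 'cV[R]_m.+1) j 0 = 1.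
  by rewrite (bigD1 i)//= mxE !eqxx big1 ?addr0// => j /negbTE ji; rewrite mxE ji.
rewrite scale1r => /(congr1 (@drop_last R m)); rewrite drop_last_section_mx.
rewrite /chart_translation -colE (_ : col i T = ti i); last by apply/colP => k; rewrite !mxE.
move=> h; apply: oppr_inj; rewrite opprB -h; apply/colP => k; by rewrite !mxE.
Qed.

Lemma chart_shift i x : chart (x + ti' i) = chart x + ti i.
Proof. by rewrite /chart mulmxDr /chart_translation mulKVmx// addrAC. Qed.

Lemma chart_word_cylinder w : word_cylinder Fi' ti' w = chart @^-1` word_cylinder Fi ti w.
Proof.
elim: w => //= a w IH; rewrite chart_interior IH; apply/seteqP.
by split=> x /= [h1]; rewrite chart_shift.
Qed.

Lemma chart_closed_cylinder w : closed_cylinder Fi' ti' w = chart @^-1` closed_cylinder Fi ti w.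
Proof.
elim: w => //= a w IH; rewrite IH; apply/seteqP.
by split=> x /= [h1]; rewrite chart_shift.
Qed.

Lemma chart_bounded : bounded_set (chart @^-1` F).
Proof.
have [M M0 hM] := (bounded_setP F).1 Fb; have [K K0 hK] := mulmx_norm_bound (invmx N).
apply/bounded_setP; exists (K * (M + `|b|)); first by rewrite mulr_gt0// ltr_wpDr.
move=> x Fx; rewrite -[x in `|x|]chartK (le_trans (hK _))// ler_wpM2l ?(ltW K0)//.
by rewrite (le_trans (ler_normB _ _))// lerD2r hM.
Qed.

Lemma chart_fundamental_domain : fundamental_domain (chart @^-1` F).
Proof.
have [mF F1 _] := Ffd; split; [exact: chart_measurable|by rewrite chart_measure|].
apply/seteqP; split=> // x _.
have [f [z [Ff [hz e]]]] := lattice_cover (chart x).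
exists (x - z); last by exists z => //; rewrite subrK.
by rewrite /= /chart mulmxDr mulmxN addrAC -/(chart x) e addrK.
Qed.

Lemma chart_natural_partition : natural_partition (drop_last u) (chart @^-1` F) Fi' ti'.
Proof.
have mFi := atom_measurable np.
have [cF ov bd st] := np; split.
- by rewrite -preimage_bigcup cF.
- move=> i j ij; rewrite -preimage_setI chart_measure; first exact: ov.
  exact: measurableI.
- move=> i; have [ci bi] := bd i; split.
    by rewrite chart_interior chart_closure -ci.
  have -> : closure (chart @^-1` Fi i) `\` interior (chart @^-1` Fi i) =
      chart @^-1` (closure (Fi i) `\` interior (Fi i)).
    by rewrite chart_interior chart_closure.
  rewrite chart_measure//.
  apply: measurableD; first by apply: closed_measurable_cV; exact: closed_closure.
  by apply: open_measurable_cV; exact: open_interior.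
- move=> i; split.
    rewrite chart_translationE addrAC subrr add0r; apply: ZvecN => k.
    by rewrite drop_lastE mxE natr_int.
  move=> _ [x Fx <-] /=; rewrite addrC chart_shift; exact: (atom_step np).
Qed.

Lemma chart_partition_language : partition_language Fi' ti' = partition_language Fi ti.
Proof.
have L1 := partition_languageP chart_fundamental_domain chart_bounded chart_natural_partition.
have L2 := partition_languageP Ffd Fb np.
apply/seteqP; split=> w.
  move=> /L1[w0 [x]]; rewrite chart_word_cylinder => hx; apply/L2; split=> //.
  by exists (chart x).
move=> /L2[w0 [y hy]]; apply/L1; split=> //; exists (chart_inv y).
by rewrite chart_word_cylinder /= chart_invK.
Qed.

Lemma chart_natural_coding (X : set (nat -> 'I_m.+1)) :
  shift_space X -> shift_language X = partition_language Fi ti ->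
  (forall w, X w -> exists x, \bigcap_n closure (cylinder Fi ti n w) = [set x]) ->
  natural_coding X (drop_last u) (\bigcup_i (chart @^-1` Fi i)) Fi'.
Proof.
move=> sX lX pX.
have FE : \bigcup_i (chart @^-1` Fi i) = chart @^-1` F.
  by have [cF _ _ _] := np; rewrite -preimage_bigcup cF.
split=> //; first by rewrite FE; exact: chart_fundamental_domain.
exists ti'; split; first by rewrite FE; exact: chart_natural_partition.
  by rewrite chart_partition_language.
move=> w /pX[y hy]; exists (chart_inv y).
have cylE n : closure (cylinder Fi' ti' n w) = chart @^-1` closure (cylinder Fi ti n w).
  rewrite (cylinderE chart_fundamental_domain chart_bounded chart_natural_partition).
  by rewrite (cylinderE Ffd Fb np) chart_word_cylinder chart_closure.
have -> : \bigcap_n closure (cylinder Fi' ti' n w) = chart @^-1` [set y].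
  by rewrite -hy preimage_bigcap; apply: eq_bigcapr => n _; exact: cylE.
by apply/seteqP; split=> x /= => [<-|->]; rewrite ?chartK ?chart_invK.
Qed.

End chart.

(** * Words and substitutions *)

Lemma prefix_cat_split (T : eqType) (u a b : seq T) :
  prefix u (a ++ b) -> (size a <= size u)%N ->
  u = a ++ drop (size a) u /\ prefix (drop (size a) u) b.
Proof.
move=> /prefixP[r hr] h; have e : take (size a) u = a.
  by rewrite -(takel_cat r h) -hr take_size_cat.
have e' : u = a ++ drop (size a) u by have := cat_take_drop (size a) u; rewrite e.
split=> //; apply/prefixP; exists r; move: hr; rewrite {1}e' -catA => /eqP.
by rewrite eqseq_cat// => /andP[_ /eqP].
Qed.

Section substitution_words.
Variable d : nat.
Implicit Types (s : substitution d) (v w : seq 'I_d).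

Lemma subst_word_cat s v w : subst_word s (v ++ w) = subst_word s v ++ subst_word s w.
Proof. by rewrite /subst_word map_cat flatten_cat. Qed.

Lemma subst_word_cons s a w : subst_word s (a :: w) = s a ++ subst_word s w.
Proof. by []. Qed.

Lemma subst_word1 s a : subst_word s [:: a] = s a.
Proof. by rewrite /subst_word /= cats0. Qed.

Lemma subst_word_id w : subst_word (@subst_id d) w = w.
Proof. by elim: w => //= a w {2}<-. Qed.

Lemma subst_word_comp s1 s2 w :
  subst_word (subst_comp s1 s2) w = subst_word s1 (subst_word s2 w).
Proof. by elim: w => //= a w IH; rewrite !subst_word_cons subst_word_cat IH. Qed.

Lemma size_subst_word s w : (forall i, s i != [::]) -> (size w <= size (subst_word s w))%N.
Proof.
move=> s0; elim: w => //= a w IH; rewrite size_cat -add1n leq_add//.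
by rewrite lt0n size_eq0 s0.
Qed.

Lemma infix_subst_word s v w : infix v w -> infix (subst_word s v) (subst_word s w).
Proof.
move=> /infixP[p [q ->]]; rewrite !subst_word_cat; apply/infixP.
by exists (subst_word s p), (subst_word s q).
Qed.

Lemma mem_infix_subst_word s a w : a \in w -> infix (s a) (subst_word s w).
Proof.
move=> /path.splitPr[w1 w2]; rewrite subst_word_cat subst_word_cons; apply/infixP.
by exists (subst_word s w1), (subst_word s w2).
Qed.

Definition max_length s : nat := \max_i size (s i).

Lemma size_le_max_length s i : (size (s i) <= max_length s)%N.
Proof. exact: leq_bigmax. Qed.

Lemma prefix_subst_word s u w : prefix u (subst_word s w) ->
  exists v p, [/\ u = subst_word s v ++ p, prefix v w & (size p <= max_length s)%N].
Proof.
elim: w u => [|a w IH] u.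
  by rewrite prefixs0 => /eqP ->; exists [::], [::].
rewrite subst_word_cons => hu; have [hs|hs] := leqP (size u) (size (s a)).
  by exists [::], u; split=> //; rewrite (leq_trans hs)// size_le_max_length.
have [e hu'] := prefix_cat_split hu (ltnW hs).
have [v [p [e' pv hp]]] := IH _ hu'.
by exists (a :: v), p; split=> //=; rewrite ?eqxx// subst_word_cons -catA -e'.
Qed.

Lemma drop_subst_word s k w : exists r v,
  [/\ drop k (subst_word s w) = r ++ subst_word s v, infix v w & (size r <= max_length s)%N].
Proof.
elim: w k => [|a w IH] k; first by exists [::], [::].
rewrite subst_word_cons drop_cat; case: ltnP => hk.
  exists (drop k (s a)), w; split=> //; first by apply/infixP; exists [:: a], [::]; rewrite cats0.
  by rewrite size_drop (leq_trans (leq_subr _ _))// size_le_max_length.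
have [r [v [e vw hr]]] := IH (k - size (s a))%N; exists r, v; split=> //.
by apply: infix_trans vw _; apply/infixP; exists [:: a], [::]; rewrite cats0.
Qed.

Lemma infix_subst_wordP s u w : infix u (subst_word s w) ->
  exists r v p, [/\ u = r ++ subst_word s v ++ p, infix v w, (size r <= max_length s)%N &
                 (size p <= max_length s)%N].
Proof.
move=> /infixP[q [q' e]].
have [r [v [e2 vw hr]]] := drop_subst_word s (size q) w.
have : prefix u (r ++ subst_word s v).
  by rewrite -e2 e drop_size_cat// prefix_prefix.
have [hs|hs] := leqP (size u) (size r).
  move=> _; exists [::], [::], u; split=> //; last by rewrite (leq_trans hs).
  exact: infix0s.
move=> hu; have [eu hu'] := prefix_cat_split hu (ltnW hs).
have [v' [p [e' pv hp]]] := prefix_subst_word hu'.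
exists r, v', p; split=> //; first by rewrite -e'.
exact: infix_trans (prefixW pv) vw.
Qed.

End substitution_words.

Section incidence_matrices.
Variables (d : nat) (R : realType).
Implicit Types (s : substitution d) (v w : seq 'I_d).

Lemma incidence_comp (K : pzRingType) s1 s2 :
  incidence K (subst_comp s1 s2) = incidence K s1 *m incidence K s2.
Proof.
apply/matrixP => i j; rewrite !mxE /subst_comp.
rewrite (eq_bigr (fun k => (count_mem i (s1 k))%:R * (count_mem k (s2 j))%:R)); last first.
  by move=> k _; rewrite !mxE.
elim: (s2 j) => [|a w IH].
  by rewrite /= big1// => k _; rewrite mulr0.
rewrite subst_word_cons count_cat natrD IH (bigD1 a)//= [in RHS](bigD1 a)//=.
rewrite eqxx natrD mulrDr mulr1 -addrA; congr (_ + (_ + _)).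
by apply: eq_bigr => k /negbTE ka; rewrite /= eq_sym ka.
Qed.

Lemma incidence_id (K : pzRingType) : incidence K (@subst_id d) = 1%:M.
Proof. by apply/matrixP => i j; rewrite !mxE /= addn0 eq_sym. Qed.

Lemma abelianization_subst_word s w :
  abelianization R (subst_word s w) = incidence R s *m abelianization R w.
Proof.
elim: w => [|a w IH]; first by rewrite abelianization_nil mulmx0.
rewrite subst_word_cons abelianization_cat IH abelianization_cons mulmxDr; congr (_ + _).
rewrite -colE; by apply/colP => i; rewrite !mxE.
Qed.

Lemma incidence_ratr s : incidence R s = map_mx ratr (incidence rat s).
Proof. by apply/matrixP => i j; rewrite !mxE rmorph_nat. Qed.

Lemma incidence_intr s : incidence rat s = map_mx intr (incidence int s).
Proof. by apply/matrixP => i j; rewrite !mxE natz. Qed.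

End incidence_matrices.

Section directive_sequence.
Variables (d : nat) (sigma : nat -> substitution d).

Local Notation rng := (subst_range sigma).

Lemma subst_range_nil k n : (n <= k)%N -> rng k n = @subst_id d.
Proof. by move=> nk; rewrite /subst_range big_geq. Qed.

Lemma subst_range_ltn k n : (k < n)%N -> rng k n = subst_comp (sigma k) (rng k.+1 n).
Proof. by move=> kn; rewrite /subst_range big_ltn. Qed.

Lemma subst_range_split k l n w : (k <= l)%N -> (l <= n)%N ->
  subst_word (rng k n) w = subst_word (rng k l) (subst_word (rng l n) w).
Proof.
move=> kl ln; move: {2}(l - k)%N (erefl (l - k)%N) => e.
elim: e k kl => [|e IH] k kl he.
  have -> : k = l by lia.
  by rewrite [rng l l]subst_range_nil// subst_word_id.
have kl' : (k < l)%N by lia.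
rewrite (subst_range_ltn (leq_trans kl' ln)) (subst_range_ltn kl') !subst_word_comp IH//.
lia.
Qed.

Lemma subst_range_splitE k l n i : (k <= l)%N -> (l <= n)%N ->
  rng k n i = subst_word (rng k l) (rng l n i).
Proof. by move=> kl ln; rewrite -(subst_word1 (rng k n)) (@subst_range_split k l n)// subst_word1. Qed.

Hypothesis usigma : forall n, unimodular_subst (sigma n).

Lemma subst_range_neq0 k n i : rng k n i != [::].
Proof.
move: {2}(n - k)%N (erefl (n - k)%N) => e; elim: e k => [|e IH] k he.
  by rewrite subst_range_nil//; lia.
rewrite subst_range_ltn; last by lia.
rewrite /subst_comp -size_eq0 -lt0n; apply: leq_trans (size_subst_word _ _); last by case: (usigma k).
by rewrite lt0n size_eq0 IH//; lia.
Qed.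

Lemma subst_range_unit k n : incidence rat (rng k n) \in unitmx.
Proof.
move: {2}(n - k)%N (erefl (n - k)%N) => e; elim: e k => [|e IH] k he.
  by rewrite subst_range_nil ?incidence_id ?unitmx1//; lia.
rewrite subst_range_ltn; last by lia.
rewrite incidence_comp unitmx_mul IH ?andbT; last by lia.
have [_ det1] := usigma k.
rewrite incidence_intr unitmxE det_map_mx unitfE intr_eq0 -normr_eq0 det1//.
Qed.

Lemma subst_range_big (K : pzRingType) k n :
  \big[mulmx/1%:M]_(k <= l < n) incidence K (sigma l) = incidence K (rng k n).
Proof.
rewrite /subst_range; move: {2}(n - k)%N (erefl (n - k)%N) => e; elim: e k => [|e IH] k he.
  by rewrite !big_geq ?incidence_id//; lia.
have kn : (k < n)%N by lia.
rewrite [LHS]big_ltn// IH; last by lia.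
by rewrite -incidence_comp; congr (incidence K _); rewrite [RHS]big_ltn.
Qed.

(** A letter that never occurred would give a zero row in an invertible incidence matrix. *)
Lemma subst_range_mem k n j : exists i, j \in rng k n i.
Proof.
apply: contrapT => h.
have r0 : row j (incidence rat (rng k n)) = 0.
  apply/rowP => i; rewrite !mxE.
  by apply/eqP; rewrite pnatr_eq0 -leqn0 leqNgt -has_count has_pred1; apply/negP => hj; apply: h; exists i.
have := subst_range_unit k n; rewrite -row_free_unit => /row_free_inj/(_ (delta_mx 0 j : 'rV_d) 0).
rewrite -rowE mul0mx r0 => /(_ erefl)/rowP/(_ j); rewrite !mxE !eqxx => /eqP.
by rewrite oner_eq0.
Qed.

Lemma sadic_language_infix v w : infix v w -> sadic_language sigma w -> sadic_language sigma v.
Proof. by move=> vw [n [i wi]]; exists n, i; exact: infix_trans vw wi. Qed.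

Lemma sadic_language_raise n w : sadic_language sigma w ->
  exists K i, (n <= K)%N /\ infix w (rng 0 K i).
Proof.
move=> [k [i wi]]; have [nk|/ltnW kn] := leqP n k; first by exists k, i.
have [i' hi'] := subst_range_mem k n i.
exists n, i'; split=> //; apply: infix_trans wi _.
by rewrite (@subst_range_splitE 0 k n)//; exact: mem_infix_subst_word.
Qed.

Definition level_language n : set (seq 'I_d) :=
  [set v | exists K i, (n <= K)%N /\ infix v (rng n K i)].

Lemma level_language_infix n v w : infix v w -> level_language n w -> level_language n v.
Proof. by move=> vw [K [i [nK wi]]]; exists K, i; split=> //; exact: infix_trans vw wi. Qed.

Lemma level_language_subst n v : level_language n v ->
  sadic_language sigma (subst_word (rng 0 n) v).
Proof.
move=> [K [i [nK vi]]]; exists K, i.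
by rewrite (@subst_range_splitE 0 n K)//; exact: infix_subst_word.
Qed.

Lemma sadic_desubstitution n w : sadic_language sigma w ->
  exists r v p, [/\ w = r ++ subst_word (rng 0 n) v ++ p, level_language n v,
    (size r <= max_length (rng 0 n))%N & (size p <= max_length (rng 0 n))%N].
Proof.
move=> /(sadic_language_raise n)[K [i [nK]]]; rewrite (@subst_range_splitE 0 n K)//.
move=> /infix_subst_wordP[r [v [p [e vi hr hp]]]].
by exists r, v, p; split=> //; exists K, i.
Qed.

End directive_sequence.

(** * Level languages of a directive sequence *)

Lemma cV_compact (R : realType) (m : nat) (A : set 'cV[R]_m) :
  bounded_set A -> closed A -> compact A.
Proof.
move=> /bounded_setP[M M0 hM] cA.
have ctr n p : continuous (@trmx R n p).
  move=> x P [/= B nB sB]; exists (fun i j => B j i) => [i j|y By]; last first.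
    by apply: sB => i j; rewrite mxE; exact: By.
  by have := nB j i; rewrite mxE.
have -> : A = trmx @` (trmx @^-1` A : set 'rV[R]_m).
  apply/seteqP; split=> [x Ax|_ [y Ay <-]//].
  by exists x^T; rewrite /= trmxK.
apply: continuous_compact; first by apply: continuous_subspaceT => x; exact: ctr.
apply: bounded_closed_compact; last by apply: preimage_closed => // x _; exact: ctr.
apply/bounded_setP; exists M => // x /hM.
rewrite (cV_normP _ (ltW M0)) => h; rewrite /Num.norm/= mx_normrE.
apply/bigmax_leP; split=> [|[i j] _ /=]; first exact: ltW.
by have := h j; rewrite mxE (ord1 i).
Qed.

Lemma norm_sub_continuous (R : realType) (m : nat) (p : 'cV[R]_m) :
  continuous (fun q : 'cV[R]_m => `|q - p|).
Proof. by move=> q; have h := @translate_continuous R m (- p) q; exact: (cvg_norm h). Qed.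

Section pairing.
Variables (R : realType) (d : nat).

Definition pairing (q : 'I_d -> rat) (x : 'cV[R]_d) : R := \sum_i ratr (q i) * x i 0.

Lemma pairingB q x y : pairing q (x - y) = pairing q x - pairing q y.
Proof. by rewrite /pairing -sumrB; apply: eq_bigr => i _; rewrite !mxE mulrBr. Qed.

Lemma pairingD q x y : pairing q (x + y) = pairing q x + pairing q y.
Proof. by rewrite /pairing -big_split; apply: eq_bigr => i _; rewrite !mxE mulrDr. Qed.

Lemma pairingZ q a x : pairing q (a *: x) = a * pairing q x.
Proof. by rewrite /pairing mulr_sumr; apply: eq_bigr => i _; rewrite !mxE mulrCA. Qed.

Lemma pairing_bound q : exists2 K : R, 0 < K & forall x, `|pairing q x| <= K * `|x|.
Proof.
have [K K0 hK] := mulmx_norm_bound (\row_i ratr (q i) : 'rV[R]_d).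
exists K => // x; apply: le_trans (hK x); apply: le_trans (cV_coord_le _ 0).
by rewrite mxE /pairing; under [X in _ <= `|X|]eq_bigr do rewrite mxE.
Qed.

End pairing.

Lemma abelianization_subE (R : realType) (d : nat) (v : seq 'I_d) (a : R) (f : 'cV[R]_d) i :
  (abelianization R v - a *: f) i 0 = (count_mem i v)%:R - a * f i 0.
Proof. by rewrite !mxE. Qed.

Section sadic.
Variables (R : realType) (m : nat).
Variables (t : 'cV[R]_m) (F : set 'cV[R]_m) (Fi : 'I_m.+1 -> set 'cV[R]_m).
Variable ti : 'I_m.+1 -> 'cV[R]_m.
Hypotheses (Ffd : fundamental_domain F) (Fb : bounded_set F).
Hypothesis np : natural_partition t F Fi ti.
Hypothesis tmin : minimal_map (rotation t).
Variable sigma : nat -> substitution m.+1.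
Hypothesis usigma : forall n, unimodular_subst (sigma n).
Hypothesis langX : shift_language (sadic_shift sigma) = partition_language Fi ti.

Local Notation u := (freq Fi).
Local Notation T := (translation_mx ti).
Local Notation rng := (subst_range sigma 0).
Local Notation L := (sadic_language sigma).
Local Notation Ln := (level_language sigma).
Local Notation ab := (abelianization R).

Let plP w := partition_languageP Ffd Fb np w.

Lemma sadic_shift_nonempty : exists x, sadic_shift sigma x.
Proof.
have [y [x [cx _]]] := exists_coding Ffd Fb np.
have : partition_language Fi ti (mkseq x 1) by apply/plP; split=> //; exists y; exact: cx.
by rewrite -langX => -[w Xw _]; exists w.
Qed.

Lemma partition_language_infix v w : v != [::] -> infix v w ->
  partition_language Fi ti w -> partition_language Fi ti v.
Proof.
move=> v0 /infixP[p [q ->]] /plP[_ [y /word_cylinder_cat[_ /word_cylinder_cat[h _]]]].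
by apply/plP; split=> //; exists (y + displacement ti p).
Qed.

(** A word with nonempty cylinder is balanced; removing the two incomplete images at its ends
    changes the letter counts by bounded vectors, and [M^-1] keeps the error bounded. *)
Lemma level_desubstitution n : exists2 C : R, 0 < C & forall f, L f ->
  word_cylinder Fi ti f !=set0 -> exists r v p,
  [/\ f = r ++ subst_word (rng n) v ++ p, Ln n v,
     (size r <= max_length (rng n))%N /\ (size p <= max_length (rng n))%N &
     `|ab v - (size f)%:R *: (invmx (incidence R (rng n)) *m u)| <= C].
Proof.
have [C C0 hC] := language_balanced Ffd Fb np tmin.
set M := incidence R (rng n); have uM : M \in unitmx.
  by rewrite /M incidence_ratr map_unitmx; exact: subst_range_unit.
have [K K0 hK] := mulmx_norm_bound (invmx M).
pose B : R := (max_length (rng n))%:R.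
exists (K * (C + B + B)).
  by rewrite mulr_gt0// -addrA ltr_wpDr// addr_ge0// ler0n.
move=> f Lf [y /hC hf].
have [r [v [p [e Lv hr hp]]]] := sadic_desubstitution usigma n Lf.
exists r, v, p; split=> //.
have abv : ab v = invmx M *m (ab f - ab r - ab p).
  rewrite e !abelianization_cat abelianization_subst_word.
  rewrite [X in _ *m X](_ : _ = M *m ab v) ?mulKmx//.
  by rewrite [ab r + _]addrC !addrK.
rewrite abv scalemxAr -mulmxBr (le_trans (hK _))// ler_wpM2l ?(ltW K0)//.
rewrite (_ : _ - _ = (ab f - (size f)%:R *: u) - ab r - ab p); last first.
  by rewrite -!addrA; congr (_ + _); rewrite addrA addrC.
rewrite (le_trans (ler_normB _ _))// lerD//.
  rewrite (le_trans (ler_normB _ _))// lerD//.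
  by rewrite (le_trans (abelianization_le _ _))// ler_nat.
by rewrite (le_trans (abelianization_le _ _))// ler_nat.
Qed.

(** The words come from prefixes of one point of the shift. The prefix [f] is retained because it
    lies in the partition language; for general words of [sadic_language] this follows only in
    [sadic_language_partition]. *)
Lemma level_approx n : exists2 C : R, 0 < C & forall N : nat, exists v,
  [/\ Ln n v, exists2 f, partition_language Fi ti f & infix (subst_word (rng n) v) f &
     `|ab v - N.+1%:R *: (invmx (incidence R (rng n)) *m u)| <= C].
Proof.
have [x Xx] := sadic_shift_nonempty; have [C C0 hC] := level_desubstitution n.
exists C => // N; pose f := Defs.factor x 0 N.+1.
have pf : partition_language Fi ti f by rewrite -langX; exists x => //; exists 0%N, N.
have [r [v [p [e Lv _ hv]]]] := hC f (Xx _ _) ((plP f).1 pf).2.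
exists v; split=> //; last by rewrite /f size_mkseq in hv.
by exists f => //; rewrite e; apply/infixP; exists r, p.
Qed.

Lemma level_freq_independent n (q : 'I_m.+1 -> rat) :
  pairing q (invmx (incidence R (rng n)) *m u) = 0 -> forall i, q i = 0.
Proof.
set Mq := incidence rat (rng n).
have uM : Mq \in unitmx by exact: subst_range_unit.
pose qr : 'rV[rat]_m.+1 := \row_i q i.
have E x : pairing q x = (map_mx ratr qr *m x) 0 0.
  by rewrite /pairing mxE; apply: eq_bigr => i _; rewrite !mxE.
rewrite E mulmxA incidence_ratr -map_invmx -map_mxM/= => h.
have q0 : qr *m invmx Mq = 0.
  apply/rowP => i; rewrite [RHS]mxE; apply: (freq_independent Ffd Fb np tmin (q := fun i => (qr *m invmx Mq) 0 i)).
  by rewrite -[RHS]h mxE; apply: eq_bigr => j _; rewrite [in RHS]mxE.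
have : qr = 0 by rewrite -(mulmxKV uM qr) q0 mul0mx.
by move=> /rowP hq i; have := hq i; rewrite !mxE.
Qed.

(* Level-n words approximate arbitrarily large multiples of M^-1 u, whose
   coordinates are rationally independent. *)
Lemma level_functional_eq0 n (q : 'I_m.+1 -> rat) (C : R) :
  (forall v, Ln n v -> `|pairing q (ab v)| <= C) -> forall i, q i = 0.
Proof.
move=> hq; apply: (@level_freq_independent n).
have [C1 C10 hC1] := level_approx n; have [K K0 hK] := pairing_bound R q.
apply: (@bounded_multiples_eq0 R _ (C + K * C1)) => -[|N].
  rewrite mul0r normr0 addr_ge0//; last by rewrite mulr_ge0// ltW.
  by apply: le_trans (normr_ge0 _) (hq [::] _); have [v [Lv _ _]] := hC1 0%N; apply: level_language_infix Lv; exact: infix0s.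
have [v [Lv _ hv]] := hC1 N.
rewrite -pairingZ -[X in pairing q X](subKr (ab v)) pairingB (le_trans (ler_normB _ _))//.
by rewrite lerD ?hq// (le_trans (hK _))// ler_wpM2l ?(ltW K0).
Qed.

(** The coordinate is nonzero by rational independence. It is not negative, because its large
    multiples stay near letter counts. *)
Lemma level_freq_gt0 n i : 0 < (invmx (incidence R (rng n)) *m u) i 0.
Proof.
set f := invmx _ *m u; have [C C0 hC] := level_approx n.
have f0 : f i 0 != 0.
  apply/eqP => f0.
  suff : (i == i)%:R = 0 :> rat by move/eqP; rewrite eqxx oner_eq0.
  apply: (@level_freq_independent n (fun j => (j == i)%:R)).
  rewrite /pairing (bigD1 i)//= eqxx -/f f0 mulr0 big1 ?addr0// => j /negbTE ->.
  by rewrite rmorph0 mul0r.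
rewrite lt_neqAle eq_sym f0/= leNgt; apply/negP => fneg.
have := archi_boundP (divr_ge0 (ltW C0) (ltW (_ : 0 < - f i 0))).
rewrite oppr_gt0 => /(_ fneg); set N := Num.bound _ => hN.
have [v [_ _ hv]] := hC N; have := le_trans (cV_coord_le _ i) hv.
rewrite abelianization_subE -/f leNgt => /negP; apply.
have v0 : 0 <= (count_mem i v)%:R :> R by [].
have : C < - f i 0 * N%:R by rewrite -ltr_pdivrMl ?oppr_gt0// mulrC.
move=> hC1; rewrite ger0_norm.
  rewrite mulrSr mulrDl mul1r; move: hC1 v0 fneg; lra.
by rewrite subr_ge0 (@le_trans _ _ 0)// pmulr_rle0// ltW.
Qed.

Lemma level_all_letters n : exists v, [/\ Ln n v,
  exists2 f, partition_language Fi ti f & infix (subst_word (rng n) v) f & forall i, i \in v].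
Proof.
set f := invmx (incidence R (rng n)) *m u; have [C C0 hC] := level_approx n.
have f0 i : 0 < f i 0 by exact: level_freq_gt0.
pose N := \max_i Num.bound (C / f i ord0).
have [v [Lv hf hv]] := hC N; exists v; split=> // i.
apply: contraT => iv; have := le_trans (cV_coord_le _ i) hv.
rewrite abelianization_subE -/f (count_memPn iv) sub0r normrN ger0_norm ?mulr_ge0 ?(ltW (f0 i))//.
rewrite leNgt => /negP[]; rewrite -ltr_pdivrMr//.
apply: lt_le_trans (archi_boundP _) _; first by rewrite divr_ge0 ?ltW.
by rewrite ler_nat (leq_trans (@leq_bigmax _ (fun i => Num.bound (C / f i ord0)) i)).
Qed.

(** The word is a factor of the image of a letter, and all letters occur in one level word whose
    image is a factor of a word of the partition language. *)
Lemma sadic_language_partition w : w != [::] -> L w -> partition_language Fi ti w.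
Proof.
move=> w0 [n [i wi]]; have [v [_ [f pf vf] /(_ i) iv]] := level_all_letters n.
apply: partition_language_infix w0 _ pf; apply: infix_trans vf.
by apply: infix_trans wi _; exact: mem_infix_subst_word.
Qed.

Lemma partition_language_sadic w : partition_language Fi ti w -> L w.
Proof. by rewrite -langX => -[x Xx [k [n ->]]]; exact: Xx. Qed.

Lemma sadic_cylinder w : L w -> word_cylinder Fi ti w !=set0.
Proof.
have [->|w0 /(sadic_language_partition w0)/plP[]//] := eqVneq w [::].
by move=> _; exists 0.
Qed.

Lemma sadic_balanced : exists2 C : R, 0 < C & forall w, L w ->
  `|ab w - (size w)%:R *: u| <= C.
Proof.
have [C C0 hC] := language_balanced Ffd Fb np tmin; exists C => // w /sadic_cylinder[y].
exact: hC.
Qed.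

Hypothesis pointX : forall x, sadic_shift sigma x ->
  exists y, \bigcap_n closure (cylinder Fi ti n x) = [set y].

(* Koenig's lemma. *)
Lemma sadic_branch (P : seq 'I_m.+1 -> Prop) :
  (forall N, exists w, [/\ P w, L w & (N <= size w)%N]) ->
  (forall v w, prefix v w -> P w -> P v) ->
  exists x, sadic_shift sigma x /\ forall n, P (mkseq x n).
Proof.
move=> hP mono.
pose ext w := forall N, exists w', [/\ prefix w w', P w', L w' & (N <= size w')%N].
have ext0 : ext [::] by move=> N; have [w [? ? ?]] := hP N; exists w; split=> //; exact: prefix0s.
have extS w : ext w -> exists a, ext (rcons w a).
  move=> hw; apply: contrapT => h.
  have /choice[f hf] : forall a, exists N, forall w', ~ [/\ prefix (rcons w a) w', P w', L w' & (N <= size w')%N].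
    move=> a; apply: contrapT => h1; apply: h; exists a => N; apply: contrapT => h2.
    by apply: h1; exists N => w' hw'; apply: h2; exists w'.
  (* This length exceeds that of [w], so that there is a next letter [a], and it reaches the bound
     [f a] whichever letter this is. *)
  have [w' [/prefixP[r e] Pw' Lw' sw']] := hw (maxn (size w).+1 (\max_a f a)).
  case: r e => [|a r] e.
    by move: sw'; rewrite e cats0 geq_max ltnn.
  apply: (hf a w'); split=> //; first by rewrite e -cat_rcons prefix_prefix.
  by apply: leq_trans sw'; rewrite leq_max (leq_bigmax a) orbT.
pose nxt w := xget ord0 [set a | ext (rcons w a)].
pose W := fix W n := if n is n'.+1 then rcons (W n') (nxt (W n')) else [::].
have extW n : ext (W n).
  by elim: n => [//|n IH] /=; have := extS _ IH; exact: (@xgetPex _ ord0 [set a | ext (rcons (W n) a)]).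
pose x n := nxt (W n).
have WE n : W n = mkseq x n by elim: n => [//|n IH]; rewrite mkseqS -IH.
exists x; split=> [k n|n]; last first.
  by have [w' [pw' Pw' _ _]] := extW n 0%N; rewrite -WE; exact: mono pw' Pw'.
have [w' [pw' _ Lw' _]] := extW (k + n)%N 0%N.
apply: sadic_language_infix Lw'; apply: infix_trans (prefixW pw').
rewrite WE (_ : Defs.factor x k n = drop k (mkseq x (k + n))); last by rewrite drop_mkseq addKn.
exact: suffixW (suffix_drop _ _).
Qed.

(** Otherwise a branch of words with large cylinders gives a point of the shift. Each of its
    cylinders has a point at distance at least [e / 2] from the limit point [p], and a cluster point
    of these lies in all closures without being [p]. *)
Lemma sadic_diameter e : 0 < e -> exists N : nat, forall w, L w -> (N <= size w)%N ->
  forall y y', word_cylinder Fi ti w y -> word_cylinder Fi ti w y' -> `|y - y'| <= e.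
Proof.
move=> e0; apply: contrapT => h.
pose bad w := exists y y', [/\ word_cylinder Fi ti w y, word_cylinder Fi ti w y' & e < `|y - y'|].
have [||x [Xx badx]] := @sadic_branch bad.
- move=> N; apply: contrapT => h1; apply: h; exists N => w Lw sw y y' wy wy'.
  by rewrite leNgt; apply/negP => ey; apply: h1; exists w; split=> //; exists y, y'.
- move=> v w /prefixP[r ->] [y [y' [/word_cylinder_cat[? _] /word_cylinder_cat[? _] ?]]].
  by exists y, y'.
have [p hp] := pointX Xx.
have /choice[z hz] : forall n, exists z, word_cylinder Fi ti (mkseq x n.+1) z /\ e / 2 <= `|z - p|.
  move=> n; have [y [y' [wy wy' ey]]] := badx n.+1.
  have [h1|h1] := leP (e / 2) `|y - p|; first by exists y.
  exists y'; split=> //; rewrite leNgt; apply/negP => h2.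
  have := ler_distD p y y'; rewrite [`|p - y'|]distrC; lra.
pose K n := [set q | closure (word_cylinder Fi ti (mkseq x n.+1)) q /\ e / 2 <= `|q - p|].
have cnorm : continuous (fun q : 'cV[R]_m => `|q - p|).
  exact: norm_sub_continuous.
have clK n : closed (K n).
  apply: closedI; first exact: closed_closure.
  by apply: (@preimage_closed _ _ (fun q : 'cV[R]_m => `|q - p|) [set r | e / 2 <= r]) => [? _|]; [exact: cnorm|exact: closed_ge].
have zK n k : (n <= k)%N -> K n (z k).
  move=> nk; have [h1 h2] := hz k; split=> //; apply: subset_closure.
  have : mkseq x k.+1 = mkseq x n.+1 ++ drop n.+1 (mkseq x k.+1).
    rewrite -{1}(cat_take_drop n.+1 (mkseq x k.+1)); congr (_ ++ _).
    by rewrite /mkseq -map_take take_iota (minn_idPl _).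
  by move=> ek; move: h1; rewrite ek => /word_cylinder_cat[].
have [M M0 hM] := (bounded_setP F).1 Fb.
have Fcl : closed F := domain_closed np.
have cK : compact (K 0%N).
  apply: cV_compact => //; apply/bounded_setP; exists M => // q [hq _]; apply: hM.
  apply: Fcl; apply: closure_subset hq => q' [/interior_subset hq' _]; exact: (atom_sub np hq').
have [q [_ clq]] := cK (z @ \oo) _ (filterS (fun n _ => zK 0%N n isT) filterT).
have Kq n : K n q.
  apply: clK => B nB; apply: clq => //.
  by exists n => // k /= nk; exact: zK.
have : (\bigcap_n closure (cylinder Fi ti n x)) q.
  by move=> n _; rewrite (cylinderE Ffd Fb np); have [] := Kq n.
rewrite hp => /= qp; have [_] := Kq 0%N.
by rewrite qp subrr normr0 leNgt divr_gt0.
Qed.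

End sadic.

(** * Growth of the substituted letters *)

Lemma ultra_finite (I : finType) (U : set_system nat) (f : nat -> I) :
  UltraFilter U -> exists c, U [set n | f n = c].
Proof.
move=> UU; have PU := @ultra_proper _ _ UU; apply: contrapT => h.
have h1 c : U (~` [set n | f n = c]).
  by have [hc|//] := in_ultra_setVsetC [set n | f n = c] UU; case: h; exists c.
have [n hn] := filter_ex (@filter_forall _ _ _ _ _ h1).
exact: (hn (f n) erefl).
Qed.

(** Linear duality for a directed graph with edges [E], where starts and ends of edges count as
    different vertices: [c] lies in the row space of the vertex-edge incidences, or a vector [z]
    orthogonal to that space detects it. *)
Lemma potential_or_relation (E X : finType) (s e : E -> X) (c : E -> rat) :
  (exists h k : X -> rat, forall x, c x = h (e x) - k (s x)) \/
  (exists z : E -> rat, [/\ forall x, \sum_(i | e i == x) z i = 0,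
     forall x, \sum_(i | s i == x) z i = 0 & \sum_i z i * c i != 0]).
Proof.
pose A1 : 'M[rat]_(#|X|, #|E|) := \matrix_(i, j) (e (enum_val j) == enum_val i)%:R.
pose A2 : 'M[rat]_(#|X|, #|E|) := \matrix_(i, j) (s (enum_val j) == enum_val i)%:R.
pose r : 'rV[rat]_#|E| := \row_j c (enum_val j).
have sumE (x : X) (v : 'rV[rat]_#|X|) : \sum_j v 0 j * (x == enum_val j)%:R = v 0 (enum_rank x).
  rewrite (bigD1 (enum_rank x))//= enum_rankK eqxx mulr1 big1 ?addr0// => j jx.
  rewrite (_ : (x == _) = false) ?mulr0//; apply: contraNF jx => /eqP ->.
  by rewrite enum_valK.
have [/submxP[h hr]|] := boolP (r <= col_mx A1 A2)%MS.
  left; rewrite -[h]hsubmxK mul_row_col in hr.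
  exists (fun x => lsubmx h 0 (enum_rank x)), (fun x => - rsubmx h 0 (enum_rank x)) => x.
  have /rowP/(_ (enum_rank x)) := hr; rewrite mxE enum_rankK => ->.
  rewrite mxE opprK; congr (_ + _); rewrite mxE -sumE; apply: eq_bigr => j _;
    by rewrite !mxE enum_rankK.
move=> hr; right.
have : r *m cokermx (col_mx A1 A2) != 0 by rewrite -submxE.
move=> /matrix0Pn[i0 [j hj]]; rewrite (ord1 i0) {i0} in hj.
set Z := cokermx (col_mx A1 A2) in hj.
have AZ : col_mx A1 A2 *m Z = 0 by exact: mulmx_coker.
rewrite mul_col_mx in AZ.
have rsum (f : E -> rat) : \sum_(l < #|E|) f (enum_val l) = \sum_i f i.
  by rewrite [RHS](reindex (@enum_val _ E))//; exact/onW_bij/enum_val_bij.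
have [Z1 Z2] : A1 *m Z = 0 /\ A2 *m Z = 0.
  by split; [have := congr1 (@usubmx _ _ _ _) AZ|have := congr1 (@dsubmx _ _ _ _) AZ];
    rewrite ?col_mxKu ?col_mxKd linear0.
exists (fun i => Z (enum_rank i) j); split=> [x|x|].
- have /matrixP/(_ (enum_rank x) j) := Z1; rewrite !mxE => h1.
  rewrite [LHS]big_mkcond -[RHS]h1 -rsum; apply: eq_bigr => l _; rewrite !mxE enum_rankK enum_valK.
  by case: eqP; rewrite ?mul1r ?mul0r.
- have /matrixP/(_ (enum_rank x) j) := Z2; rewrite !mxE => h1.
  rewrite [LHS]big_mkcond -[RHS]h1 -rsum; apply: eq_bigr => l _; rewrite !mxE enum_rankK enum_valK.
  by case: eqP; rewrite ?mul1r ?mul0r.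
- move: hj; rewrite mxE -rsum; apply: contraNN => /eqP h1; apply/eqP; rewrite -[RHS]h1.
  by apply: eq_bigr => l _; rewrite mxE enum_valK mulrC.
Qed.

(* Between consecutive letters a, a' outside J, the block of letters of J
   contributes h a' - k a, so the sum telescopes along a word. *)
Lemma block_sum_bounded (d : nat) (L : set (seq 'I_d)) (J : pred 'I_d) (K : nat)
    (b : 'I_d) (h k : 'I_d -> rat) :
  (forall v w, infix v w -> L w -> L v) ->
  (forall B, L B -> all J B -> (size B <= K)%N) ->
  (forall a B a', L (a :: B ++ [:: a']) -> all J B -> ~~ J a -> ~~ J a' ->
     (count_mem b B)%:R = h a' - k a) ->
  exists C : rat, forall v, L v ->
    `|\sum_(x <- v) (if J x then (x == b)%:R else k x - h x)| <= C.
Proof.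
move=> Linf hK he; pose th x := if J x then (x == b)%:R else k x - h x.
pose H := \sum_a (`|h a| + `|k a|).
have hH a : `|h a| <= H /\ `|k a| <= H.
  have h0 : 0 <= \sum_(i | i != a) (`|h i| + `|k i|) by apply: sumr_ge0 => i _; rewrite addr_ge0.
  rewrite /H (bigD1 a)//=; have := normr_ge0 (h a); have := normr_ge0 (k a); move: h0; lra.
have sB B : all J B -> \sum_(x <- B) th x = (count_mem b B)%:R.
  elim: B => [|x B IH]; first by rewrite big_nil.
  by rewrite /= => /andP[Jx JB]; rewrite big_cons IH// /th Jx natrD eq_sym.
have cB B : L B -> all J B -> `|(count_mem b B)%:R : rat| <= K%:R.
  by move=> LB JB; rewrite ger0_norm// ler_nat (leq_trans (count_size _ _))// hK.
(* [B] is the block of letters of [J] read since [a]. Adding [h a] is what telescopes: at the next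
   letter [x] outside [J], the value becomes the same expression with [x] in place of [a]. *)
have step v : forall B a, ~~ J a -> all J B -> L (a :: B ++ v) ->
    `|\sum_(x <- a :: B ++ v) th x + h a| <= H + K%:R.
  elim: v => [|x v IH] B a Ja JB LB.
    rewrite cats0 big_cons sB// {1}/th (negbTE Ja) addrAC subrK.
    rewrite (le_trans (ler_normD _ _))// lerD//; first by case: (hH a).
    by apply: cB => //; apply: Linf LB; rewrite cats0 -cat1s suffixW// suffix_suffix.
  have [Jx|Jx] := boolP (J x).
    rewrite -cat_rcons; apply: IH => //; first by rewrite all_rcons Jx.
    by rewrite cat_rcons.
  rewrite big_cons big_cat/= sB// (he a B x)//; last first.
    by apply: Linf LB; rewrite -cat_cons -[x :: v]cat1s catA prefixW// prefix_prefix.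
  rewrite {1}/th (negbTE Ja).
  rewrite (_ : _ + _ = \sum_(j <- x :: v) th j + h x); last by ring.
  apply: (IH [::]) => //.
  by apply: Linf LB; apply: suffixW; exact: (suffix_suffix (a :: B)).
exists (K%:R + (H + K%:R + H)) => v Lv.
have : forall B v, all J B -> L (B ++ v) ->
    `|\sum_(x <- B ++ v) th x| <= K%:R + (H + K%:R + H).
  move=> B {Lv}v; elim: v B => [|x v IH] B JB LB.
    rewrite cats0 in LB *; rewrite sB// (le_trans (cB _ LB JB))// lerDl.
    by rewrite !addr_ge0//; apply: le_trans (hH b).1.
  have [Jx|Jx] := boolP (J x).
    by rewrite -cat_rcons; apply: IH => //; rewrite ?all_rcons ?Jx ?cat_rcons.
  rewrite big_cat/= sB// (le_trans (ler_normD _ _))// lerD//.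
    by apply: cB => //; apply: Linf LB; rewrite prefixW// prefix_prefix.
  rewrite -[X in `|X|](addrK (h x)) (le_trans (ler_normB _ _))// lerD//; last by case: (hH x).
  by apply: (step v [::]) => //; apply: Linf LB; rewrite suffixW// suffix_suffix.
by move=> /(_ [::] v erefl Lv).
Qed.

Lemma sum_scale_fiber (R : realType) (m : nat) (E X : finType) (f : E -> X) (z : E -> rat)
    (g : X -> 'cV[R]_m) :
  (forall x, \sum_(i | f i == x) z i = 0) -> \sum_i ratr (z i) *: g (f i) = 0.
Proof.
move=> hz; rewrite (partition_big f predT)//= big1// => x _.
rewrite (eq_bigr (fun i => ratr (z i) *: g x)); last by move=> i /eqP ->.
by rewrite -scaler_suml -rmorph_sum/= hz rmorph0 scale0r.
Qed.

Lemma pairing_abelianization (R : realType) (d : nat) (q : 'I_d -> rat) (v : seq 'I_d) :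
  pairing q (abelianization R v) = ratr (\sum_(x <- v) q x).
Proof.
elim: v => [|a v IH].
  rewrite abelianization_nil big_nil rmorph0 /pairing big1// => i _; by rewrite mxE mulr0.
rewrite abelianization_cons pairingD IH big_cons rmorphD/=; congr (_ + _).
rewrite /pairing (bigD1 a)//= mxE !eqxx mulr1 big1 ?addr0// => i /negbTE ia.
by rewrite mxE ia mulr0.
Qed.

Section growth.
Variables (R : realType) (m : nat).
Variables (t : 'cV[R]_m) (F : set 'cV[R]_m) (Fi : 'I_m.+1 -> set 'cV[R]_m).
Variable ti : 'I_m.+1 -> 'cV[R]_m.
Hypotheses (Ffd : fundamental_domain F) (Fb : bounded_set F).
Hypothesis np : natural_partition t F Fi ti.
Hypothesis tmin : minimal_map (rotation t).
Variable sigma : nat -> substitution m.+1.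
Hypothesis usigma : forall n, unimodular_subst (sigma n).
Hypothesis langX : shift_language (sadic_shift sigma) = partition_language Fi ti.
Hypothesis pointX : forall x, sadic_shift sigma x ->
  exists y, \bigcap_n closure (cylinder Fi ti n x) = [set y].

Local Notation u := (freq Fi).
Local Notation T := (translation_mx ti).
Local Notation rng := (subst_range sigma 0).
Local Notation L := (sadic_language sigma).
Local Notation Ln := (level_language sigma).
Local Notation ab := (abelianization R).

Section short_letters.
Variable U : set_system nat.
Hypothesis UU : UltraFilter U.
Hypothesis Uoo : forall n0, U [set n | (n0 <= n)%N].

Let PU : ProperFilter U := @ultra_proper _ _ UU.

(** Every function of the level with finitely many values is constant along the ultrafilter [U],
    which thus replaces repeated passages to subsequences. *)
Definition short i := exists K, U [set n | (size (rng n i) <= K)%N].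

Lemma long_size i K : ~ short i -> U [set n | (K <= size (rng n i))%N].
Proof.
move=> li; have [h|] := in_ultra_setVsetC [set n | (size (rng n i) <= K)%N] UU.
  by case: li; exists K.
by apply: filterS => n /= /negP; rewrite -ltnNge => /ltnW.
Qed.

Lemma short_bounded : exists K, U [set n | forall i, short i -> (size (rng n i) <= K)%N].
Proof.
have /choice[K hK] : forall i, exists K, short i -> U [set n | (size (rng n i) <= K)%N].
  by move=> i; have [[K hK]|?] := pselect (short i); [exists K|exists 0%N].
exists (\max_i K i).
have h i : U [set n | short i -> (size (rng n i) <= \max_i K i)%N].
  have [si|nsi] := pselect (short i); last by apply: filterS filterT => n _ /nsi.
  by apply: filterS (hK i si) => n /= h _; rewrite (leq_trans h)// leq_bigmax.
exact: (@filter_forall _ _ _ _ _ h).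
Qed.

Lemma short_counts : exists c : 'I_m.+1 -> 'I_m.+1 -> nat,
  U [set n | forall i, short i -> forall j, count_mem j (rng n i) = c i j].
Proof.
have [K UK] := short_bounded.
pose f n := [ffun i => [ffun j => inord (count_mem j (rng n i)) : 'I_K.+1]].
have [c Uc] := ultra_finite f UU.
exists (fun i j => c i j : nat); apply: filterS2 UK Uc => n hK <- i si j.
by rewrite !ffunE inordK// ltnS (leq_trans (count_size _ _))// hK.
Qed.

Lemma exists_long : exists a, ~ short a.
Proof.
apply: contrapT => h; have hs i : short i by apply: contrapT => li; apply: h; exists i.
have [K UK] := short_bounded.
have [x Xx] := sadic_shift_nonempty Ffd Fb np langX.
have [k [i wi]] := Xx 0%N K.+1.
have [n [nk /(_ _ (hs _)) hn]] := filter_ex (filterI (Uoo k) UK).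
have [i' hi'] := subst_range_mem usigma k n i.
have := hn i'; rewrite leqNgt => /negP; apply.
have /size_infix : infix (Defs.factor x 0 K.+1) (rng n i').
  apply: infix_trans wi _; rewrite (@subst_range_splitE _ sigma 0 k n)//.
  exact: mem_infix_subst_word.
by rewrite size_mkseq.
Qed.

(* Along U the images of the short letters J have constant abelianizations, and
   maximal J-blocks have bounded length, so the set of triples (a, B, a') with
   a B a' in level-n words (B a J-block, a and a' long) is constant too.  The
   displacement over the image of B is nearly y_a' - (y_a + displacement of the
   image of a), as the cylinders of long words are small.  By rational
   independence of the frequencies, every rational relation satisfied by the
   right-hand sides is satisfied by the block counts; hence the number of b in B
   is h a' - k a, and block_sum_bounded yields a nonzero bounded functional. *)
Lemma no_short b : ~ short b.
Proof.
move=> sb; pose J i := `[<short i>].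
have [c Uc] := short_counts; have [a0 la0] := exists_long.
have [n1 good1] := filter_ex Uc.
set good := [set n | _] in Uc good1.
have Ja0 : ~~ J a0 by apply/negP => /asboolP.
have swE n B : good n -> all J B -> ab (subst_word (rng n) B) = incidence R (rng n1) *m ab B.
  move=> gn; rewrite -abelianization_subst_word; elim: B => [//|x B IH] /= /andP[/asboolP Jx JB].
  rewrite !subst_word_cons !abelianization_cat IH//; congr (_ + _).
  by apply/colP => j; rewrite !mxE gn// good1.
set M1 := incidence R (rng n1) in swE *.
have uM1 : M1 \in unitmx by rewrite /M1 incidence_ratr map_unitmx; exact: subst_range_unit.
pose f1 := invmx M1 *m u.
have f10 : 0 < f1 a0 0 by exact: (level_freq_gt0 Ffd Fb np tmin usigma langX).
have countJ B : all J B -> count_mem a0 B = 0%N.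
  by move=> /allP JB; apply/count_memPn; apply: contra Ja0 => /JB.
pose q i := invmx (incidence rat (rng n1)) a0 i.
have qE x : pairing q x = (invmx M1 *m x) a0 0.
  by rewrite /M1 incidence_ratr -map_invmx mxE; apply: eq_bigr => i _; rewrite [in RHS]mxE.
(* [q] is the row [a0] of [M1^-1]. It vanishes on the image of a [J]-block, which does not contain
   [a0], while [pairing q u] is [f1 a0 0 > 0]; balance therefore bounds the length of this image. *)
have [K2 hK2] : exists K, forall n B, good n -> Ln n B -> all J B -> (size B <= K)%N.
  have [C C0 hC] := sadic_balanced Ffd Fb np tmin usigma langX.
  have [Kq Kq0 hKq] := pairing_bound R q.
  exists (Num.bound (Kq * C / f1 a0 0)) => n B gn LB JB.
  pose s := size (subst_word (rng n) B).
  have hs : (size B <= s)%N by apply: size_subst_word; exact: subst_range_neq0.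
  apply: (leq_trans hs); rewrite ltnW// -(ltr_nat R).
  apply: le_lt_trans (archi_boundP _); last by rewrite divr_ge0 ?mulr_ge0 ?ltW.
  rewrite ler_pdivlMr//.
  have := hC _ (level_language_subst LB); rewrite -/s => h1.
  have := le_trans (hKq _) (ler_wpM2l (ltW Kq0) h1).
  rewrite pairingB pairingZ swE// !qE mulKmx// -/f1 mxE countJ// sub0r normrN.
  by rewrite ger0_norm// mulr_ge0// ltW.
pose Edge := ('I_m.+1 * {ffun 'I_m.+1 -> 'I_K2.+1} * 'I_m.+1)%type.
pose isE n (e : Edge) := exists B, [/\ all J B, ~~ J e.1.1 && ~~ J e.2,
  forall j, count_mem j B = e.1.2 j & Ln n (e.1.1 :: B ++ [:: e.2])].
have [E UE] := ultra_finite (fun n => [set e | `[<isE n e>]]%SET) UU.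
have isEP n : [set e | `[<isE n e>]]%SET = E -> forall e, (e \in E) <-> isE n e.
  by move=> <- e; rewrite inE; split=> /asboolP.
pose V (e : Edge) : 'cV[R]_m.+1 := \col_j (e.1.2 j)%:R.
have [n2 [good2 /isEP E2]] := filter_ex (filterI Uc UE).
pose ET := {e | e \in E}.
have [[h [k hk]]|[z [z1 z2 zc]]] := potential_or_relation
    (fun e : ET => (val e).1.1) (fun e : ET => (val e).2) (fun e => ((val e).1.2 b : nat)%:R).
  have [||a B a' LB JB Ja Ja'|C hC] := @block_sum_bounded _ (Ln n2) J K2 b h k.
  - by move=> v w vw; exact: level_language_infix.
  - by move=> B LB JB; exact: hK2 LB JB.
  - pose e : Edge := (a, [ffun j => inord (count_mem j B)], a').
    have cB j : count_mem j B = e.1.2 j.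
      rewrite ffunE inordK// ltnS (leq_trans (count_size _ _))// (hK2 n2)//.
      by apply: level_language_infix LB; apply/infixP; exists [:: a], [:: a'].
    have eE : e \in E by apply/E2; exists B; rewrite Ja Ja'.
    by rewrite cB; exact: (hk (exist _ e eE)).
  have := level_functional_eq0 Ffd Fb np tmin usigma langX (C := ratr C) (n := n2)
    (q := fun x => if J x then (x == b)%:R else k x - h x).
  move=> /(_ _ b); rewrite (_ : J b) ?eqxx; last exact/asboolP.
  move=> H; suff : 1 = 0 :> rat by [].
  by apply: H => v Lv; rewrite pairing_abelianization -ratr_norm ler_rat hC.
(* The coefficients [z] kill all functions of either endpoint of an edge, whereas the coordinate [b]
   of [Q] is the sum that is nonzero by [zc]. The aim is to show that it vanishes. *)
pose Q := \sum_e ratr (z e) *: V (val e).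
pose W e := T *m (M1 *m V e).
have WE n (e : Edge) B : good n -> all J B -> (forall j, count_mem j B = e.1.2 j) ->
    displacement ti (subst_word (rng n) B) = W e.
  move=> gn JB cB; rewrite -translation_mx_abelianization swE//; congr (_ *m (_ *m _)).
  by apply/colP => j; rewrite !mxE cB.
have TQ : T *m (M1 *m Q) = 0.
  have -> : T *m (M1 *m Q) = \sum_e ratr (z e) *: W (val e).
    rewrite !mulmx_sumr; apply: eq_bigr => e _; by rewrite -!scalemxAr.
  set w := \sum_e _; pose S : R := \sum_e `|ratr (z e)|.
  have S0 : 0 <= S by exact: sumr_ge0.
  apply/eqP; rewrite -normr_eq0 eq_le normr_ge0 andbT; apply/ler_addgt0Pr => e e0; rewrite add0r.
  (* Chosen so that the total error [2 S de = e S / (S + 1)] is at most [e]. *)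
  pose de := e / (2 * (S + 1)).
  have de0 : 0 < de by rewrite divr_gt0 ?mulr_gt0 ?ltr_wpDl.
  have [N hN] := sadic_diameter Ffd Fb np pointX de0.
  have /(@filter_forall _ _ _ _ _) UN : forall i, U [set n | ~~ J i -> (N <= size (rng n i))%N].
    move=> i; have [Ji|/asboolP li] := boolP (J i); first by apply: filterS filterT.
    by apply: filterS (long_size N li) => ? ?.
  have [n [gn [/isEP En hsz]]] := filter_ex (filterI Uc (filterI UE UN)).
  have Lrng a : L (rng n a) by exists n, a; exact: infix_refl.
  have /choice[y hy] : forall a, exists y, word_cylinder Fi ti (rng n a) y.
    by move=> a; exact: (sadic_cylinder Ffd Fb np tmin usigma langX).
  pose g a := y a + displacement ti (rng n a).
  have hW x : x \in E -> `|W x - (y x.2 - g x.1.1)| <= de + de.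
    move=> /En[B [JB /andP[J1 J2] cB LB]].
    have [p] := sadic_cylinder Ffd Fb np tmin usigma langX (level_language_subst LB).
    rewrite subst_word_cons subst_word_cat subst_word1.
    move=> /word_cylinder_cat[h1 /word_cylinder_cat[_]]; rewrite (WE _ x)// => h2.
    rewrite (_ : _ - _ = (p + displacement ti (rng n x.1.1) + W x - y x.2) - (p - y x.1.1)).
      apply: le_trans (ler_normB _ _) _; apply: lerD.
        exact: (hN (rng n x.2) (Lrng _) (hsz _ J2)).
      exact: (hN (rng n x.1.1) (Lrng _) (hsz _ J1)).
    by apply/colP => k; rewrite !mxE; ring.
  have -> : w = \sum_e ratr (z e) *: (W (val e) - (y (val e).2 - g (val e).1.1)).
    rewrite /w; under [RHS]eq_bigr do rewrite scalerBr scalerBr.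
    rewrite !sumrB (sum_scale_fiber y z1) (sum_scale_fiber g z2) subrr subr0//.
  apply: (le_trans (ler_norm_sum _ _ _)).
  apply: (@le_trans _ _ (S * (de + de))).
    rewrite mulr_suml; apply: ler_sum => x _; rewrite normrZ ler_wpM2l//.
    by apply: hW; exact: valP.
  rewrite /de -mulr2n -[_ *+ 2]mulr_natl mulrCA -[leRHS]mulr1.
  rewrite (_ : 2 * _ = e * (S / (S + 1))).
    by rewrite ler_wpM2l ?(ltW e0)// ler_pdivrMr ?ltr_wpDl// mul1r lerDl.
  by field; rewrite lt0r_neq0// ltr_wpDl.
(* Zero displacement means that [M1 Q] is a multiple of [u]. The coordinate [a0] of [Q] vanishes and
   that of [f1] does not, so the multiple is 0. *)
have QE : Q = (\sum_i (M1 *m Q) i 0) *: f1.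
  have /eqP := proj_along_section Ffd Fb np tmin (M1 *m Q).
  rewrite TQ mulmx0 subr_eq0 => /eqP h.
  by rewrite /f1 -[LHS](mulKmx uM1) {1}h scalemxAr.
set s := \sum_i _ in QE.
have Va0 e : e \in E -> V e a0 0 = 0.
  by move=> /E2[B [JB _ cB _]]; rewrite mxE -cB countJ.
have Qa0 : Q a0 0 = 0.
  by rewrite summxE big1// => e _; rewrite mxE Va0 ?mulr0//; exact: valP.
have s0 : s = 0.
  move: Qa0; rewrite QE mxE => /eqP; rewrite mulf_eq0 => /orP[/eqP//|/eqP f0].
  by rewrite f0 ltxx in f10.
have Qb : Q b 0 = 0 by rewrite QE s0 scale0r mxE.
move/negP: zc; apply; rewrite -(fmorph_eq0 (@ratr R)) rmorph_sum/=; apply/eqP.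
rewrite -[RHS]Qb summxE; apply: eq_bigr => e _; by rewrite !mxE rmorphM/= rmorph_nat.
Qed.

End short_letters.

(** If images of length at most [K] occurred at infinitely many levels, an ultrafilter concentrated
    on these levels would have a short letter, contrary to [no_short]. *)
Lemma subst_range_growth K : exists n0, forall n i, (n0 <= n)%N -> (K <= size (rng n i))%N.
Proof.
apply: contrapT => h.
pose D := [set n | exists i, (size (rng n i) <= K)%N].
have PF : ProperFilter (within D \oo).
  split; last exact: within_filter.
  move=> [n0 _ hn0]; apply: h; exists n0 => n i n0n; rewrite leqNgt; apply/negP => hi.
  by apply: (hn0 n n0n); exists i; exact: ltnW.
have [U [UU hU]] := ultraFilterLemma PF.
have PU := @ultra_proper _ _ UU.
have Uoo n0 : U [set n | (n0 <= n)%N].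
  by apply: hU; exists n0 => // n /=.
have UD : U D by apply: hU; exists 0%N => // n _ /=.
have [[i si]|h1] := pselect (exists i, short U i).
  exact: (no_short UU Uoo si).
have h2 i : U [set n | (K.+1 <= size (rng n i))%N].
  by apply: long_size => // si; apply: h1; exists i.
have [n [[i hi] /(_ i)/=]] := filter_ex (filterI UD (@filter_forall _ _ _ _ _ h2)).
by rewrite ltnNge hi.
Qed.

End growth.

(** * The base point *)

Lemma infinite_levelsP (d : nat) (S : set (nat * 'I_d)) :
  infinite_set S <-> forall n0, exists nj, S nj /\ (n0 <= nj.1)%N.
Proof.
split=> [iS n0|h fS].
  apply: contrapT => h; apply: iS.
  apply: (@sub_finite_set _ _ (`I_n0 `*` [set: 'I_d])).
    move=> nj Snj; split=> //=; rewrite ltnNge; apply/negP => hn.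
    by apply: h; exists nj.
  by apply: finite_setX; [exact: finite_II|exact: finite_finset].
have [X SX] := (finite_seqP S).1 fS.
have [nj []] := h (\max_(x <- X) x.1).+1.
rewrite SX /= => njX; rewrite ltnNge => /negP; apply.
exact: (@leq_bigmax_seq _ _ xpredT (fun x : nat * 'I_d => x.1)).
Qed.

Lemma closure_subset_closed (T : topologicalType) (A B : set T) :
  closed B -> A `<=` B -> closure A `<=` B.
Proof. by move=> cB AB x hx; apply: cB; exact: closure_subset hx. Qed.

Section base_point.
Variables (R : realType) (m : nat).
Variables (t : 'cV[R]_m) (F : set 'cV[R]_m) (Fi : 'I_m.+1 -> set 'cV[R]_m).
Variable ti : 'I_m.+1 -> 'cV[R]_m.
Hypotheses (Ffd : fundamental_domain F) (Fb : bounded_set F).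
Hypothesis np : natural_partition t F Fi ti.
Hypothesis tmin : minimal_map (rotation t).
Variable sigma : nat -> substitution m.+1.
Hypothesis usigma : forall n, unimodular_subst (sigma n).
Hypothesis langX : shift_language (sadic_shift sigma) = partition_language Fi ti.
Hypothesis pointX : forall x, sadic_shift sigma x ->
  exists y, \bigcap_n closure (cylinder Fi ti n x) = [set y].

Local Notation u := (freq Fi).
Local Notation T := (translation_mx ti).
Local Notation rng := (subst_range sigma 0).
Local Notation L := (sadic_language sigma).
Local Notation Ln := (level_language sigma).
Local Notation ab := (abelianization R).
Local Notation cyl := (word_cylinder Fi ti).

Let growth := subst_range_growth Ffd Fb np tmin usigma langX pointX.
Let nonempty_cyl w := @sadic_cylinder _ _ _ _ _ _ Ffd Fb np tmin _ usigma langX w.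

Let Lrng n a : L (rng n a). Proof. by exists n, a; exact: infix_refl. Qed.

(** If [c] precedes both letters, the cylinder of the image of [c], moved by its displacement, meets
    the cylinders of both images; when all these are small, the latter two are close. *)
Definition common_predecessor n : rel 'I_m.+1 :=
  fun a a' => `[< exists c, Ln n [:: c; a] /\ Ln n [:: c; a'] >].

(* For S the component of a0 and P its set of predecessors, 1_S - 1_P telescopes
   along level-n words, so it vanishes and S is stable along words. *)
Lemma common_predecessor_connect n a0 a : connect (common_predecessor n) a0 a.
Proof.
pose S a := connect (common_predecessor n) a0 a.
pose P c := `[< exists a, S a /\ Ln n [:: c; a] >].
have SP c x : Ln n [:: c; x] -> P c = S x.
  move=> Lcx; apply/asboolP/idP => [[a' [Sa' La']]|Sx]; last by exists x.
  by apply: connect_trans Sa' (connect1 _); apply/asboolP; exists c.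
have tel c v : Ln n (c :: v) -> \sum_(x <- c :: v) ((S x)%:R - (P x)%:R : rat) = (S c)%:R - (P (last c v))%:R.
  elim: v c => [|x v IH] c Lv; first by rewrite big_seq1.
  rewrite big_cons IH; last by apply: level_language_infix Lv; apply/infixP; exists [:: c], [::]; rewrite cats0.
  rewrite (SP c x) /=; last by apply: level_language_infix Lv; apply/infixP; exists [::], v.
  by rewrite addrA subrK.
have h x : (S x)%:R - (P x)%:R = 0 :> rat.
  apply: (level_functional_eq0 Ffd Fb np tmin usigma langX (C := 1) (n := n)
    (q := fun x => (S x)%:R - (P x)%:R)) => -[|c v] Lv; rewrite pairing_abelianization.
    by rewrite big_nil rmorph0 normr0.
  rewrite tel// -ratr_norm -(rmorph1 (@ratr R)) ler_rat.
  by case: (S c); case: (P _); rewrite ?subrr ?subr0 ?sub0r ?normrN ?normr0 ?normr1.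
have {}h x : S x = P x.
  by move: (h x); case: (S x); case: (P x); rewrite ?subr0 ?sub0r// => /eqP; rewrite ?oppr_eq0 oner_eq0.
have [v [Lv _ hv]] := level_all_letters Ffd Fb np tmin usigma langX n.
have const c w : Ln n (c :: w) -> forall x, x \in c :: w -> S x = S c.
  elim: w c => [|y w IH] c Lw x; first by rewrite inE => /eqP ->.
  have Lcy : Ln n [:: c; y] by apply: level_language_infix Lw; apply/infixP; exists [::], w.
  rewrite inE => /orP[/eqP ->//|xw]; rewrite (h c) (SP c y)//; apply: IH => //.
  by apply: level_language_infix Lw; apply/infixP; exists [:: c], [::]; rewrite cats0.
case: v Lv hv => [_ /(_ a)//|c v /const hc hv].
by rewrite -/(S a) (hc a)// -(hc a0)// /S connect0.
Qed.

(** Any two letters are joined by a chain without repetition. Each link costs two diameters, for the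
    images of a letter and of the common predecessor, and the end costs one more; hence the constant
    [2 * m.+1 + 1]. *)
Lemma letter_cylinders_shrink e : 0 < e -> exists n0, forall n a a' y y', (n0 <= n)%N ->
  cyl (rng n a) y -> cyl (rng n a') y' -> `|y - y'| <= e.
Proof.
move=> e0; pose K : R := (2 * m.+1 + 1)%N%:R; pose de := e / K.
have K0 : 0 < K by rewrite ltr0n addn1.
have de0 : 0 < de by rewrite divr_gt0.
have [N hN] := sadic_diameter Ffd Fb np pointX de0.
have [n0 hn0] := growth N; exists n0 => n a a' y y' nn0 ya ya'.
have hd b z z' : cyl (rng n b) z -> cyl (rng n b) z' -> `|z - z'| <= de.
  exact: hN (Lrng _ _) (hn0 _ _ nn0) _ _.
have step p : forall b z z', path (common_predecessor n) b p ->
    cyl (rng n b) z -> cyl (rng n (last b p)) z' -> `|z - z'| <= (2 * size p + 1)%N%:R * de.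
  elim: p => [|c p IH] b z z' /=; first by rewrite mul1r => _; exact: hd.
  move=> /andP[/asboolP[x [Lb Lc]] pp] zb zc.
  have [q] := nonempty_cyl (level_language_subst Lb).
  have [q'] := nonempty_cyl (level_language_subst Lc).
  rewrite (subst_word_cons _ x [:: b]) (subst_word_cons _ x [:: c]) !subst_word1 => /word_cylinder_cat[h1 h2] /word_cylinder_cat[h3 h4].
  rewrite (_ : z - z' = (z - (q + displacement ti (rng n x))) + ((q - q') +
    ((q' + displacement ti (rng n x)) - z'))); last by apply/colP => k; rewrite !mxE; ring.
  rewrite (_ : _ * de = de + (de + (2 * size p + 1)%N%:R * de)); last first.
    by rewrite (_ : (2 * (size p).+1 + 1 = 2 + (2 * size p + 1))%N) ?natrD; [ring|lia].
  apply: le_trans (ler_normD _ _) _; apply: lerD; first exact: hd zb h4.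
  apply: le_trans (ler_normD _ _) _; apply: lerD; first exact: hd h3 h1.
  exact: IH pp h2 zc.
have /connectP[p0 pp0 ea'] := common_predecessor_connect n a a'.
move: ea' ya'; case/shortenP: pp0 => p pp up _ -> ya'.
apply: le_trans (step _ _ _ _ pp ya ya') _.
rewrite -[leRHS](divfK (lt0r_neq0 K0)) mulrC -/de ler_wpM2l ?(ltW de0)// ler_nat leq_add2r leq_mul2l/=.
have := max_card (mem (a :: p)); rewrite (card_uniqP up) card_ord.
exact: ltnW.
Qed.

(** The cylinder of an image at level [N] lies in that of an image at any lower level, namely of the
    first letter of the level word. A cluster point of points chosen in these cylinders is therefore
    near all of them. *)
Lemma base_point_exists : exists ys, forall e, 0 < e -> exists n0, forall n a y,
  (n0 <= n)%N -> cyl (rng n a) y -> `|y - ys| <= e.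
Proof.
have nested n N a : (n <= N)%N -> exists a', cyl (rng N a) `<=` cyl (rng n a').
  move=> nN; rewrite (@subst_range_splitE _ sigma 0 n N)//.
  have := subst_range_neq0 usigma n N a; case: (subst_range sigma n N a) => // a' w _.
  by exists a' => y; rewrite subst_word_cons => /word_cylinder_cat[].
have /choice[z hz] : forall n, exists y, cyl (rng n ord0) y.
  by move=> n; exact: nonempty_cyl.
have zF n : F (z n).
  by have [] := word_cylinder_ends np (subst_range_neq0 usigma 0 n ord0) (hz n).
have Fcl : closed F := domain_closed np.
have cF : compact F by exact: cV_compact.
have [ys [_ clys]] := cF (z @ \oo) _ (filterS (fun n _ => zF n) filterT).
exists ys => e e0; have [n0 hn0] := letter_cylinders_shrink e0.
exists n0 => n a y nn0 ya; rewrite distrC.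
have cl : closed [set q | `|q - y| <= e].
  by apply: (@preimage_closed _ _ (fun q : 'cV[R]_m => `|q - y|) [set r | r <= e]) => [? _|]; [exact: norm_sub_continuous|exact: closed_le].
apply: cl => B nB; apply: clys => //; exists n => // N /= nN.
have [a' ha'] := nested n N ord0 nN.
exact: hn0 nn0 (ha' _ (hz N)) ya.
Qed.

End base_point.

(** * Rauzy fractals *)

Section rauzy_pieces.
Variables (R : realType) (m : nat).
Variables (t : 'cV[R]_m) (F : set 'cV[R]_m) (Fi : 'I_m.+1 -> set 'cV[R]_m).
Variable ti : 'I_m.+1 -> 'cV[R]_m.
Hypotheses (Ffd : fundamental_domain F) (Fb : bounded_set F).
Hypothesis np : natural_partition t F Fi ti.
Hypothesis tmin : minimal_map (rotation t).
Variable sigma : nat -> substitution m.+1.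
Hypothesis usigma : forall n, unimodular_subst (sigma n).
Hypothesis langX : shift_language (sadic_shift sigma) = partition_language Fi ti.
Hypothesis pointX : forall x, sadic_shift sigma x ->
  exists y, \bigcap_n closure (cylinder Fi ti n x) = [set y].

Local Notation u := (freq Fi).
Local Notation T := (translation_mx ti).
Local Notation N := (lattice_mx ti).
Local Notation S := (section_mx ti).
Local Notation rng := (subst_range sigma 0).
Local Notation L := (sadic_language sigma).
Local Notation ab := (abelianization R).
Local Notation cyl := (word_cylinder Fi ti).

Let growth := subst_range_growth Ffd Fb np tmin usigma langX pointX.
Let nonempty_cyl w := @sadic_cylinder _ _ _ _ _ _ Ffd Fb np tmin _ usigma langX w.

Variable ys : 'cV[R]_m.
Hypothesis hys : forall e, 0 < e -> exists n0, forall n a y,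
  (n0 <= n)%N -> cyl (rng n a) y -> `|y - ys| <= e.

Definition recurrent_prefix (w p : seq 'I_m.+1) :=
  infinite_set [set nj : nat * 'I_m.+1 | prefix (p ++ w) (rng nj.1 nj.2)].

(** Points in the cylinders of images of high level tend to [ys]; following the prefix [p] brings
    them into the cylinder of [w], and the limit stays in the closed one. *)
Lemma recurrent_prefix_cylinder w p : recurrent_prefix w p ->
  closed_cylinder Fi ti w (ys + displacement ti p).
Proof.
move=> /infinite_levelsP hp.
apply: (closed_closed_cylinder (atom_closed np)) => B /nbhs_ballP[e /= e0 eB].
have [n0 hn0] := hys (divr_gt0 e0 (ltr0Sn _ 1)).
have [[n j] [/= /prefixP[r hr] n0n]] := hp n0.
have [y hy] : cyl (rng n j) !=set0 by apply: nonempty_cyl; exists n, j; exact: infix_refl.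
exists (y + displacement ti p); split.
  apply: word_cylinder_sub_closed.
  by move: hy; rewrite hr -catA => /word_cylinder_cat[_ /word_cylinder_cat[]].
apply: eB; rewrite -ball_normE /= opprD addrACA subrr addr0 distrC.
by apply: le_lt_trans (hn0 _ _ _ n0n hy) _; rewrite ltr_pdivrMr// mulr_natr mulr2n ltrDl.
Qed.

(* By density y_n + t k + z is near y for some k and every large n, where y_n is in
   the cylinder of the n-th word; the prefix of length k of that word then leads
   to y, and an ultrafilter selects one such prefix for infinitely many n. *)
Lemma cylinder_recurrent_prefix w y e : w != [::] -> cyl w y -> 0 < e ->
  exists p, recurrent_prefix w p /\ `|y - (ys + displacement ti p)| < e.
Proof.
case: w => // a0 w0 _; set w := a0 :: w0 => wy e0.
have /nbhs_ballP[r /= r0 hr] : nbhs y (cyl w).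
  by apply: open_nbhs_nbhs; split=> //; exact: open_word_cylinder.
pose eta := Num.min (e / 4) (r / 4).
have eta0 : 0 < eta by rewrite lt_min !divr_gt0.
have [k [z [hz hk]]] := minimal_orbit_dense ys y tmin eta0.
have [n1 hn1] := hys eta0; have [n2 hn2] := growth (k + size w).
pose p n := take k (rng n ord0).
have key n : (maxn n1 n2 <= n)%N -> [/\ prefix (p n ++ w) (rng n ord0), size (p n) = k &
    `|y - (ys + displacement ti (p n))| < e].
  rewrite geq_max => /andP[/hn1 h1 /(hn2 n ord0) h2].
  have sp : size (p n) = k by rewrite size_takel// (leq_trans _ h2)// leq_addr.
  have [y' hy'] : cyl (rng n ord0) !=set0 by apply: nonempty_cyl; exists n, ord0; exact: infix_refl.
  have {}h1 := h1 _ _ hy'.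
  pose q := y' + t *+ k + z.
  have hq : `|q - y| < eta + eta.
    rewrite (_ : q - y = (y' - ys) + (ys + t *+ k + z - y)); last first.
      by rewrite /q; apply/colP => i; rewrite !mxE; ring.
    by rewrite (le_lt_trans (ler_normD _ _))// ler_ltD.
  have wq : cyl w q.
    apply: hr; rewrite -ball_normE /= distrC (lt_le_trans hq)//.
    have : eta <= r / 4 by rewrite ge_min lexx orbT.
    by lra.
  move: hy'; rewrite -(cat_take_drop k (rng n ord0)) -/(p n) => /word_cylinder_cat[_].
  set v := drop k _ => hv.
  have sv : (size w <= size v)%N by rewrite size_drop leq_subRL// (leq_trans _ h2)// leq_addr.
  move: hv; rewrite -(cat_take_drop (size w) v) => /word_cylinder_cat[hv _].
  have sv' : size w = size (take (size w) v) by rewrite size_takel.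
  (* The two points differ by an integer vector; [q] is interior to its atom and the other point
     lies in an atom, so they coincide. *)
  have eq : q = y' + displacement ti (p n).
    have hz' : Zvec (q - (y' + displacement ti (p n))).
      rewrite (_ : _ - _ = z - (displacement ti (p n) - t *+ size (p n))).
        apply: ZvecB => //; exact: (displacement_cong np).
      by rewrite sp /q; apply/colP => i; rewrite !mxE; ring.
    have [iq _] := wq.
    move: hv sv'; case: (take _ v) => [//|b v'] [ib _] _.
    have [] := interior_atom_disjoint Ffd Fb np (j := b) hz' iq.
      by rewrite subKr; exact: interior_subset ib.
    by move=> _ /eqP; rewrite subr_eq0 => /eqP.
  rewrite -eq in hv; split=> //.
    have ew := word_cylinder_inj Ffd Fb np sv' wq (word_cylinder_sub_closed hv).
    apply/prefixP; exists (drop (size w) v).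
    by rewrite -ew catA.
  rewrite (_ : _ - _ = (y - q) + (y' - ys)); last first.
    by rewrite eq; apply/colP => i; rewrite !mxE; ring.
  rewrite (le_lt_trans (ler_normD _ _))// distrC.
  have : eta <= e / 4 by rewrite ge_min lexx.
  by move: hq h1 e0; lra.
have [U [UU hU]] := ultraFilterLemma (eventually_filter).
have PU := @ultra_proper _ _ UU.
(* From a certain level on, [p n] has length [k] and is an element of a finite type of tuples; the
   default can only occur before. *)
pose f n := insubd (nseq_tuple k (ord0 : 'I_m.+1)) (p n).
have [c Uc] := ultra_finite f UU.
have Un n0 : U [set n | (n0 <= n)%N] by apply: hU; exists n0.
have pE n : (maxn n1 n2 <= n)%N -> f n = c -> p n = c.
  by move=> /key[_ sp _] <-; rewrite /f insubdK// -topredE /= sp.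
exists c; split; last first.
  have [n [hn fn]] := filter_ex (filterI (Un (maxn n1 n2)) Uc).
  by rewrite -(pE _ hn fn); case: (key n hn).
apply/infinite_levelsP => n0.
have [n [hn [hn' fn]]] := filter_ex (filterI (Un n0) (filterI (Un (maxn n1 n2)) Uc)).
exists (n, ord0); split=> //=.
by rewrite -(pE _ hn' fn); case: (key n hn').
Qed.

Lemma rauzyE w : rauzy u sigma w =
  closure [set S *m displacement ti p | p in recurrent_prefix w].
Proof.
rewrite /rauzy; congr closure; apply/eq_imagel => p _.
rewrite -(translation_mx_abelianization ti p).
rewrite -(proj_along_section Ffd Fb np tmin) /proj_along (sum_freq Ffd Fb np) divr1//.
Qed.

Lemma rauzy_sub w z : rauzy u sigma w z ->
  z = S *m (T *m z) /\ closed_cylinder Fi ti w (T *m z + ys).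
Proof.
rewrite rauzyE => hz; split.
  apply: (sum_zero_section Ffd Fb np tmin).
  pose f (x : 'cV[R]_m.+1) := ((const_mx 1 : 'rV[R]_m.+1) *m x : 'cV[R]_1) 0 0.
  have fE x : f x = \sum_i x i 0.
    by rewrite /f mxE; apply: eq_bigr => j _; rewrite mxE mul1r.
  have cl : closed (f @^-1` [set 0]).
    apply: preimage_closed => [x _|]; last exact: closed_eq.
    apply: (@continuous_comp _ _ _ (mulmx (const_mx 1 : 'rV[R]_m.+1)) (fun A : 'cV[R]_1 => A 0 0)).
      exact: mulmx_continuous.
    exact: coord_continuous.
  rewrite -fE; apply: (closure_subset_closed cl) hz => _ [p _ <-] /=.
  by rewrite fE sum_section_mx.
have cl : closed ((fun z => T *m z + ys) @^-1` closed_cylinder Fi ti w).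
  apply: preimage_closed => [? _|]; first exact: affine_continuous.
  exact: (closed_closed_cylinder (atom_closed np)).
apply: (closure_subset_closed cl) hz => _ [p hp <-] /=.
by rewrite (translation_section Ffd Fb np tmin) addrC; exact: recurrent_prefix_cylinder.
Qed.

Lemma cylinder_sub_rauzy w y : w != [::] -> closure (cyl w) y ->
  rauzy u sigma w (S *m (y - ys)).
Proof.
move=> w0; have clr : closed ((fun y => S *m (y - ys)) @^-1` rauzy u sigma w).
  apply: preimage_closed => [z _|]; last exact: closed_closure.
  rewrite (_ : (fun y => S *m (y - ys)) = fun y => S *m y + S *m (- ys)).
    exact: affine_continuous.
  by apply/funext => y'; rewrite mulmxDr.
move=> hy; apply: (closure_subset_closed clr) hy => {}y wy /=; rewrite rauzyE.
have [K K0 hK] := mulmx_norm_bound S.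
move=> B /nbhs_ballP[e /= e0 eB].
have [p [hp hyp]] := cylinder_recurrent_prefix w0 wy (divr_gt0 e0 K0).
exists (S *m displacement ti p); split; first by exists p.
apply: eB; rewrite -ball_normE /= -mulmxBr -addrA -opprD (le_lt_trans (hK _))//.
by rewrite -ltr_pdivlMl// mulrC.
Qed.

(** For a single letter the inner and the outer bound of the Rauzy fractal agree, as an atom is the
    closure of its interior. *)
Lemma atom_rauzy i : Fi i = [set T *m x + ys | x in rauzy u sigma [:: i]].
Proof.
apply/seteqP; split=> [y Fy|_ [x /rauzy_sub[_ [hx _]] <-//]].
exists (S *m (y - ys)); last by rewrite (translation_section Ffd Fb np tmin) subrK.
apply: cylinder_sub_rauzy => //; have [_ _ /(_ i)[FE _] _] := np.
by move: Fy; rewrite FE; apply: closure_subset => z iz; split.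
Qed.

Lemma neg_rauzyE w :
  neg_rauzy' u sigma w = (fun x => S *m (N *m x)) @^-1` rauzy u sigma w.
Proof.
have uN := lattice_mx_unit Ffd Fb np tmin.
apply/seteqP; split=> [_ [z hz <-]|x hx] /=; last first.
  by exists (S *m (N *m x)) => //; rewrite drop_last_section_mx opprK mulKmx.
have [-> _] := rauzy_sub hz.
by rewrite drop_last_section_mx opprK mulKVmx// -(rauzy_sub hz).1.
Qed.

Lemma neg_rauzy_closed w : closed (neg_rauzy' u sigma w).
Proof.
rewrite neg_rauzyE; apply: preimage_closed => [x _|]; last exact: closed_closure.
rewrite (_ : (fun x => S *m (N *m x)) = fun x => (S *m N) *m x).
  exact: mulmx_continuous.
by apply/funext => ?; rewrite mulmxA.
Qed.

Lemma neg_rauzy_sub w : neg_rauzy' u sigma w `<=` chart ti ys @^-1` closed_cylinder Fi ti w.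
Proof.
move=> x; rewrite neg_rauzyE => /rauzy_sub[_].
by rewrite (translation_section Ffd Fb np tmin).
Qed.

Lemma sub_neg_rauzy w : w != [::] ->
  chart ti ys @^-1` closure (cyl w) `<=` neg_rauzy' u sigma w.
Proof.
by move=> w0 x /(cylinder_sub_rauzy w0); rewrite neg_rauzyE /chart addrK.
Qed.

Lemma neg_rauzy_letter i : neg_rauzy' u sigma [:: i] = chart ti ys @^-1` Fi i.
Proof.
apply/seteqP; split=> x; first by move=> /neg_rauzy_sub[].
move=> hx; apply: sub_neg_rauzy => //=; have [_ _ /(_ i)[FE _] _] := np.
by move: hx; rewrite /= {1}FE; apply: closure_subset => z iz; split.
Qed.

(** A vector [v] of the intersection is a nonnegative combination of the letter-count vectors of the
    images of level [n]. Each is within [C] of its length times [u], and the lengths are at least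
    [K] for large [n], so [K |v - s u|] is at most [C s]. *)
Lemma generalized_right_eigenvector_freq : generalized_right_eigenvector sigma u.
Proof.
have [C C0 hC] := sadic_balanced Ffd Fb np tmin usigma langX.
have uE n : u = incidence R (rng n) *m (invmx (incidence R (rng n)) *m u).
  rewrite mulKVmx// incidence_ratr map_unitmx; exact: subst_range_unit.
split.
- apply/eqP => u0; have := sum_freq Ffd Fb np; rewrite u0 big1 => [/eqP|i _]; last by rewrite mxE.
  by rewrite eq_sym oner_eq0.
- by move=> i; rewrite mxE fine_ge0.
apply/seteqP; split=> v; last first.
  move=> [c c0 <-] n _; rewrite /= subst_range_big.
  exists (c *: (invmx (incidence R (rng n)) *m u)); last by rewrite -scalemxAr -uE.
  move=> i; rewrite mxE mulr_ge0//.
  exact: ltW (level_freq_gt0 Ffd Fb np tmin usigma langX n i).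
move=> hv; pose s := \sum_i v i 0.
have key K : (0 < K)%N -> 0 <= s /\ K%:R * `|v - s *: u| <= C * s.
  move=> K0; have [n /(_ n)hn] := growth K.
  have [x x0 ] := hv n I; rewrite subst_range_big => xv.
  have vE : v = \sum_i x i 0 *: ab (rng n i).
    rewrite -xv; apply/colP => k; rewrite mxE summxE; apply: eq_bigr => i _.
    by rewrite !mxE mulrC.
  have sE : s = \sum_i x i 0 * (size (rng n i))%:R.
    rewrite /s vE; under eq_bigr do rewrite summxE.
    rewrite exchange_big/=; apply: eq_bigr => i _; rewrite -(sum_abelianization R) mulr_sumr.
    by apply: eq_bigr => k _; rewrite mxE.
  split; first by rewrite sE; apply: sumr_ge0 => i _; rewrite mulr_ge0//; exact: x0.
  apply: (@le_trans _ _ (K%:R * (C * \sum_i x i 0))).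
    rewrite ler_wpM2l// sE {1}vE scaler_suml -sumrB mulr_sumr (le_trans (ler_norm_sum _ _ _))//.
    apply: ler_sum => i _; rewrite -scalerA -scalerBr normrZ ger0_norm; last exact: x0.
    by rewrite mulrC ler_wpM2r// hC//; exists n, i; exact: infix_refl.
  rewrite mulrCA ler_wpM2l ?(ltW C0)// sE mulr_sumr; apply: ler_sum => i _.
  by rewrite mulrC ler_wpM2l ?ler_nat ?hn//; exact: x0.
have [s0 _] := key 1%N isT.
exists s => //; apply/esym/eqP; rewrite -subr_eq0 -normr_eq0; apply/eqP.
apply: (@bounded_multiples_eq0 R _ (C * s)) => -[|K].
  by rewrite mul0r normr0 mulr_ge0// ltW.
by rewrite normrM !ger0_norm//; exact: (key K.+1 isT).2.
Qed.

End rauzy_pieces.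

(** * Left proper directive sequences *)

Section overlapping_occurrences.
Variable T : eqType.
Implicit Types v s e q : seq T.

Lemma occurrences_catl v r s :
  (occurrences v s <= occurrences v (r ++ s) <= size r + occurrences v s)%N.
Proof.
elim: r => [|a r /andP[IH1 IH2]]; first by rewrite /= leqnn.
by rewrite /= occurrences_cons; case: (prefix _ _); lia.
Qed.

Lemma occurrences_catr v s e :
  (occurrences v s <= occurrences v (s ++ e) <= occurrences v s + size v + size e)%N.
Proof.
suff : (occurrences v s <= occurrences v (s ++ e) <= occurrences v s + minn (size s) (size v) + size e)%N.
  by lia.
elim: s => [|a s /andP[IH1 IH2]].
  by have := occurrences_catl v e [::]; rewrite cats0 /= /occurrences /=; lia.
rewrite cat_cons !occurrences_cons.
have h1 : prefix v (a :: s) -> prefix v (a :: s ++ e).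
  by move=> /prefixP[z ez]; apply/prefixP; exists (z ++ e); rewrite catA -ez.
have h2 : (size v <= size (a :: s))%N -> prefix v (a :: s ++ e) = prefix v (a :: s).
  by move=> hv; rewrite !prefixE -cat_cons takel_cat.
move: h1 h2 => /=; case: (prefix v (a :: s)); case: (prefix v (a :: s ++ e)) => h1 h2; lia.
Qed.

(** An occurrence of [v] in [s ++ q ++ e] that starts in [s] ends within [q], so [e] has no
    influence on it. *)
Lemma occurrences_overlap v s q e : (size v <= size q)%N ->
  (occurrences v (s ++ q ++ e) + occurrences v q =
   occurrences v (s ++ q) + occurrences v (q ++ e))%N.
Proof.
move=> vq; elim: s => [|a s IH] /=; first by rewrite addnC.
rewrite !occurrences_cons -!addnA IH; congr (nat_of_bool _ + _)%N.
rewrite !prefixE -!cat_cons catA takel_cat//= size_cat; lia.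
Qed.

End overlapping_occurrences.

Section left_proper.
Variables (R : realType) (m : nat).
Variables (t : 'cV[R]_m) (F : set 'cV[R]_m) (Fi : 'I_m.+1 -> set 'cV[R]_m).
Variable ti : 'I_m.+1 -> 'cV[R]_m.
Hypotheses (Ffd : fundamental_domain F) (Fb : bounded_set F).
Hypothesis np : natural_partition t F Fi ti.
Hypothesis tmin : minimal_map (rotation t).
Variable sigma : nat -> substitution m.+1.
Hypothesis usigma : forall n, unimodular_subst (sigma n).
Hypothesis langX : shift_language (sadic_shift sigma) = partition_language Fi ti.
Hypothesis pointX : forall x, sadic_shift sigma x ->
  exists y, \bigcap_n closure (cylinder Fi ti n x) = [set y].

Local Notation u := (freq Fi).
Local Notation rng := (subst_range sigma 0).
Local Notation L := (sadic_language sigma).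
Local Notation ab := (abelianization R).

Hypothesis lp : left_proper_seq sigma.

(* All images start with a common word q at least as long as v, so occurrences of
   v starting in the image of a letter do not depend on what follows. *)
Lemma left_proper_occurrences v : exists n (c : 'I_m.+1 -> nat) C,
  forall z, (occurrences v (subst_word (rng n) z) <= \sum_(a <- z) c a + C)%N /\
            (\sum_(a <- z) c a <= occurrences v (subst_word (rng n) z) + C)%N.
Proof.
have [k hk] := subst_range_growth Ffd Fb np tmin usigma langX pointX (size v).
have [n kn [j hj]] := lp k.
pose q := rng k j; have vq : (size v <= size q)%N by exact: hk.
have rq a : exists e, rng n a = q ++ e.
  have [e he] := hj a; exists (subst_word (rng k) e).
  by rewrite (@subst_range_splitE _ sigma 0 k n)// ?(ltnW kn)// he.
(* This counts the occurrences that start in the image of [a] when [q] follows; the truncated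
   subtraction is exact by [occurrences_catl]. *)
pose c a := (occurrences v (rng n a ++ q) - occurrences v q)%N.
exists n, c, (size v + size q)%N => z.
have E : occurrences v (subst_word (rng n) z ++ q) = (\sum_(a <- z) c a + occurrences v q)%N.
  elim: z => [|a z IH]; first by rewrite big_nil.
  rewrite subst_word_cons -catA big_cons.
  have [e ez] : exists e, subst_word (rng n) z ++ q = q ++ e.
    case: (z) => [|b z']; first by exists [::]; rewrite cats0.
    by have [e he] := rq b; exists (e ++ subst_word (rng n) z' ++ q); rewrite subst_word_cons he -!catA.
  have := occurrences_overlap (rng n a) e vq; rewrite -ez IH.
  have /andP[+ _] := occurrences_catl v (rng n a) q; rewrite [c a]/c.
  move: (\sum_(_ <- z) _)%N => S; move: (occurrences v _) (occurrences v _) (occurrences v _); lia.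
have /andP[h1 h2] := occurrences_catr v (subst_word (rng n) z) q.
have /andP[_ h3] := occurrences_catl v q [::].
rewrite cats0 {2}/occurrences /= addn0 in h3.
move: h1 h2 h3; rewrite E; move: (\sum_(_ <- z) _)%N => S.
by move: (occurrences v _) (occurrences v _) (size v) (size q); lia.
Qed.

(** [kappa] sums [c a] times the coordinate [a] of [M^-1 u]: occurrences per letter image, weighted
    by the number of such images per letter of [s]. The constant collects the ends cut off by
    desubstitution and the imbalance of the level word. *)
Lemma left_proper_balanced v : exists kappa C : R, 0 <= kappa /\
  forall s, partition_language Fi ti s -> `|(occurrences v s)%:R - kappa * (size s)%:R| <= C.
Proof.
have [n [c [B hB]]] := left_proper_occurrences v.
have [C C0 hC] := level_desubstitution Ffd Fb np tmin usigma n.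
set f := invmx _ *m u in hC.
pose q a : rat := (c a)%:R; have [K K0 hK] := pairing_bound R q.
pose ml := max_length (rng n).
exists (pairing q f), ((B + ml + ml + size v)%:R + K * C); split.
  apply: sumr_ge0 => i _; rewrite mulr_ge0 ?ler0q//.
  exact: ltW (level_freq_gt0 Ffd Fb np tmin usigma langX n i).
move=> s ps; have Ls := partition_language_sadic langX ps.
have [r [z [p [e _ [hr hp] hz]]]] := hC s Ls (((partition_languageP Ffd Fb np s).1 ps).2).
have [h1 h2] := hB z.
have hsum : pairing q (ab z) = (\sum_(a <- z) c a)%N%:R.
  by rewrite pairing_abelianization -natr_sum ratr_nat.
have hK' := le_trans (hK _) (ler_wpM2l (ltW K0) hz).
rewrite pairingB pairingZ hsum in hK'.
have /andP[h3 h4] := occurrences_catl v r (subst_word (rng n) z ++ p).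
have /andP[h5 h6] := occurrences_catr v (subst_word (rng n) z) p.
rewrite -e in h3 h4.
have hn : `|(occurrences v s)%:R - (\sum_(a <- z) c a)%N%:R : R| <= (B + ml + ml + size v)%:R.
  move: h1 h2 h3 h4 h5 h6 hr hp; rewrite -/ml; move: ml (size v) (size r) (size p) (\sum_(_ <- z) _)%N => ml' sv sr sp S.
  move: (occurrences v s) (occurrences v _) (occurrences v _) => o1 o2 o3 h1 h2 h3 h4 h5 h6 hr hp.
  have a1 : (o1 <= S + (B + ml' + ml' + sv))%N by lia.
  have a2 : (S <= o1 + (B + ml' + ml' + sv))%N by lia.
  by rewrite ler_distl; move: a1 a2; rewrite -2!(ler_nat R) !natrD; lra.
rewrite (_ : _ - _ = ((occurrences v s)%:R - (\sum_(a <- z) c a)%N%:R) +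
   ((\sum_(a <- z) c a)%N%:R - (size s)%:R * pairing q f)); last by ring.
by rewrite (le_trans (ler_normD _ _))// lerD.
Qed.

Lemma cylinder_bounded_remainder (w : nat -> 'I_m.+1) (n : nat) :
  bounded_remainder_set (rotation t) haar
    (\bigcap_(k in [set k | (k <= n)%N])
       iter k (rotation t) @^-1` (torus_pi @` Fi (w k))).
Proof.
have [kappa [C [kappa0 hC]]] := left_proper_balanced (mkseq w n.+1).
have mpi k i : measurable (iter k (rotation t) @^-1` (torus_pi @` Fi i)).
  apply: (haar_iter_rotation t k _).1; apply: measurable_image_torus_pi.
  exact: (atom_measurable np).
have := @coding_bounded_remainder R m _ t F Fi ti Ffd Fb np (mkseq w n.+1) _ kappa C.
move=> /(_ (\bigcap_(k in [set k | (k <= n)%N]) iter k (rotation t) @^-1` (torus_pi @` Fi (w k)))).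
case=> //; first exact: bigcap_measurableType.
move=> y x [_ hx]; rewrite size_mkseq; split=> [h|h k /= kn].
  apply: (@eq_from_nth _ (w 0%N)) => [|k]; rewrite !size_mkseq// => kn.
  rewrite !nth_mkseq//; apply/esym/hx.
  by have := h k kn; rewrite /= iter_rotation.
rewrite iter_rotation; apply/hx.
by have := congr1 (nth (w 0%N) ^~ k) h; rewrite !nth_mkseq.
Qed.

(** It suffices that the fractal lies between the closure of the open cylinder and the closed
    cylinder of the charted partition: a point of a coded orbit in the closed one has the prefix [w]
    by [word_cylinder_inj], and a point with this prefix is in the open one. *)
Lemma neg_rauzy_bounded_remainder w : w != [::] ->
  bounded_remainder_set (rotation (drop_last u)) haar (torus_pi @` neg_rauzy' u sigma w).
Proof.
have [ys hys] := base_point_exists Ffd Fb np tmin usigma langX pointX.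
have fd := chart_fundamental_domain Ffd Fb np tmin ys.
have cb := chart_bounded Ffd Fb np tmin ys.
have cnp := chart_natural_partition Ffd Fb np tmin ys.
move=> w0; have [kappa [C [kappa0 hC]]] := left_proper_balanced w.
have := @coding_bounded_remainder R m _ _ _ _ _ fd cb cnp w (torus_pi @` neg_rauzy' u sigma w) kappa C.
case=> //.
- apply: measurable_image_torus_pi; apply: closed_measurable_cV.
  exact: (neg_rauzy_closed Ffd Fb np tmin usigma langX hys).
- move=> y x [cx _]; split=> [[x0 hx0 /torus_piP/ZvecN]|xw].
    rewrite opprB => exy.
    have hx0' := neg_rauzy_sub Ffd Fb np tmin usigma langX hys hx0.
    rewrite -(chart_closed_cylinder Ffd Fb np tmin) in hx0'.
    have sw : size (mkseq x (size w)) = size w by rewrite size_mkseq.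
    apply: (word_cylinder_inj fd cb cnp sw (cx (size w))).
    rewrite (_ : y = x0)//; apply/eqP; rewrite -subr_eq0; apply/eqP.
    case: w w0 {hC hx0 sw} hx0' => // a w _ [ax0 _].
    have := cx 1%N; rewrite /= => -[ix _].
    have [] := interior_atom_disjoint fd cb cnp (j := a) exy ix; last by [].
    by rewrite subKr.
  exists y => //.
  apply: (sub_neg_rauzy Ffd Fb np tmin usigma langX pointX hys w0).
  apply: subset_closure; have := cx (size w).
  by rewrite xw (chart_word_cylinder Ffd Fb np tmin).
- by move=> s; rewrite (chart_partition_language Ffd Fb np tmin); exact: hC.
Qed.

End left_proper.


Theorem theorem3p8 (R : realType) (m : nat) (X : set (nat -> 'I_m.+1))
    (t : 'cV[R]_m) (F : set 'cV[R]_m) (Fi : 'I_m.+1 -> set 'cV[R]_m)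
    (Fbounded : bounded_set F)
    (Rt_minimal : minimal_map (rotation t))
    (X_coding : natural_coding X t F Fi) :
  [/\ forall i, bounded_remainder_set (rotation t) haar (torus_pi @` Fi i),
      forall q : 'I_m.+1 -> rat,
        \sum_i ratr (q i) * fine (lebesgueV (Fi i)) = 0 -> forall i, q i = 0
    & forall sigma : nat -> substitution m.+1,
      (forall n, unimodular_subst (sigma n)) ->
      X = sadic_shift sigma ->
      let u : 'cV[R]_m.+1 := \col_i fine (lebesgueV (Fi i)) in
      [/\ generalized_right_eigenvector sigma u,
          exists (A : 'M[R]_(m, m.+1)) (b : 'cV[R]_m), forall i,
            Fi i = [set A *m x + b | x in rauzy u sigma [:: i]],
          natural_coding (sadic_shift sigma) (drop_last u)
            (\bigcup_i neg_rauzy' u sigma [:: i])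
            (fun i => neg_rauzy' u sigma [:: i])
        & left_proper_seq sigma ->
          forall (w : nat -> 'I_m.+1) (n : nat),
          sadic_language sigma (mkseq w n.+1) ->
          bounded_remainder_set (rotation t) haar
            (\bigcap_(k in [set k | (k <= n)%N])
               iter k (rotation t) @^-1` (torus_pi @` Fi (w k))) /\
          bounded_remainder_set (rotation (drop_last u)) haar
            (torus_pi @` neg_rauzy' u sigma (mkseq w n.+1))]].
Proof.
have [sX Ffd [ti [np langX pointX]]] := X_coding.
split.
- exact: (atom_bounded_remainder Ffd Fbounded np Rt_minimal).
- move=> q hq; apply: (freq_independent Ffd Fbounded np Rt_minimal).
  by rewrite -[RHS]hq; apply: eq_bigr => i _; rewrite mxE.
move=> sigma usigma XE; rewrite {X}XE in X_coding sX langX pointX * => u.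
have [ys hys] := base_point_exists Ffd Fbounded np Rt_minimal usigma langX pointX.
split.
- exact: (generalized_right_eigenvector_freq Ffd Fbounded np Rt_minimal usigma langX pointX).
- exists (translation_mx ti), ys => i.
  exact: (atom_rauzy Ffd Fbounded np Rt_minimal usigma langX pointX hys).
- have -> : (fun i => neg_rauzy' u sigma [:: i]) = (fun i => chart ti ys @^-1` Fi i).
    apply/funext => i.
    exact: (neg_rauzy_letter Ffd Fbounded np Rt_minimal usigma langX pointX hys).
  exact: (chart_natural_coding Ffd Fbounded np Rt_minimal ys sX langX pointX).
- move=> lp w n _; split.
    exact: (cylinder_bounded_remainder Ffd Fbounded np Rt_minimal usigma langX pointX lp).
  exact: (neg_rauzy_bounded_remainder Ffd Fbounded np Rt_minimal usigma langX pointX lp).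
Qed.
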